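(* Suppose $m,n$ are positive integers, $m \leq n$, $U$ is an open subset of $\mathbf{R}^n$, $V$ is an $m$ dimensional rectifiable varifold in $U$, $\|\delta V\|$ is a Radon measure, $f \in \mathbf{T}(V)$, $T \in \mathscr{D}'(U\times\mathbf{R},\mathbf{R}^n)$ satisfies $$T(\phi) = \int \langle \phi(x,f(x)), V\mathbf{D}f(x)\rangle \, d\|V\|x \quad \text{for } \phi \in \mathscr{D}(U\times\mathbf{R},\mathbf{R}^n),$$ and $E(y) = \{ x : f(x) > y \}$ for $y \in \mathbf{R}$. Then $T$ is representable by integration and $$T(\phi) = \int V\partial E(y)\,(\phi(\cdot,y))\, d\mathscr{L}^1 y, \qquad \int g \, d\|T\| = \int\int g(x,y)\, d\|V\partial E(y)\|x\, d\mathscr{L}^1 y$$ whenever $\phi \in \mathbf{L}_1(\|T\|,\mathbf{R}^n)$ and $g$ is an $\overline{\mathbf{R}}$ valued $\|T\|$ integrable function. In particular, for $\mathscr{L}^1$ almost all $y$, the distribution $V\partial E(y)$ is representable by integration and $\|V\partial E(y)\|(U\cap\{x : f(x)\neq y\}) = 0$.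
   Context: Measures are outer measures. $\mathbf{G}(n,m)$ is the set of $m$ dimensional subspaces of $\mathbf{R}^n$; $P_\natural$ is the orthogonal projection onto $P$; $\sigma\bullet\tau = \operatorname{trace}(\sigma^\ast\circ\tau)$ for linear maps of $\mathbf{R}^n$. $\mathscr{D}(U,Y)$, $\mathscr{E}(U,Y)$ are the smooth functions $U\to Y$ with compact, respectively arbitrary, support; $\mathscr{D}'$ denotes the corresponding continuous linear functionals $\mathscr{D}(U,Y)\to\mathbf{R}$ (distributions). $\langle v,\alpha\rangle=\alpha(v)$ for a linear map $\alpha$. $\overline{\mathbf{R}} = \mathbf{R}\cup\{-\infty,\infty\}$. An $m$ dimensional varifold in $U$ is a Radon measure $V$ over $U\times\mathbf{G}(n,m)$; $\|V\|(A)=V(A\times\mathbf{G}(n,m))$; it is rectifiable if it is given by integration over a countably $(\mathscr{H}^m,m)$ rectifiable, $\mathscr{H}^m$ measurable set, with its approximate tangent planes and a positive multiplicity function. $\delta V(\theta)=\int P_\natural\bullet D\theta(x)\,dV(x,P)$ for $\theta\in\mathscr{D}(U,\mathbf{R}^n)$. For a linear $S:\mathscr{D}(\Omega,\mathbf{R}^n)\to\mathbf{R}$, $\Omega$ open in a Euclidean space, $\|S\|$ is the largest Borel regular measure over $\Omega$ with $\|S\|(G)=\sup\{S(\theta):\operatorname{spt}\theta\subset G, |\theta|\leq 1\}$ for open $G$; $S$ is representable by integration if and only if $\|S\|$ is a Radon measure, and then $S$ also denotes the unique continuous extension to $\mathbf{L}_1(\|S\|,\mathbf{R}^n)$; for $\|S\|$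 measurable $A$, $(S\llcorner A)(\theta)=S(\theta_A)$ with $\theta_A=\theta$ on $A$, $\theta_A=0$ elsewhere. For $\|V\|+\|\delta V\|$ measurable $E$, $V\partial E=(\delta V)\llcorner E-\delta(V\llcorner(E\times\mathbf{G}(n,m)))\in\mathscr{D}'(U,\mathbf{R}^n)$. For a finite dimensional normed vectorspace $Y$, $\mathbf{T}(V,Y)$ is the set of all $Y$ valued $\|V\|+\|\delta V\|$ measurable functions $f$ with domain contained in $U$ (defined $\|V\|+\|\delta V\|$ almost everywhere) such that for some $\|V\|$ measurable $\operatorname{Hom}(\mathbf{R}^n,Y)$ valued function $F$: (i) $\int_{K\cap\{x:|f(x)|\leq s\}}\|F\|\,d\|V\|<\infty$ for every compact $K\subset U$ and $0\leq s<\infty$; (ii) $(\delta V)((\gamma\circ f)\theta)=\int\gamma(f(x))P_\natural\bullet D\theta(x)\,dV(x,P)+\int\langle\theta(x),D\gamma(f(x))\circ F(x)\rangle\,d\|V\|x$ for all $\theta\in\mathscr{D}(U,\mathbf{R}^n)$ and $\gamma\in\mathscr{E}(Y,\mathbf{R})$ with $\operatorname{spt}D\gamma$ compact. $F$ is $\|V\|$ almost unique and is denoted $V\mathbf{D}f$ (normalised by taking approximate limits of $F$ with respect to $\|V\|$ and closed balls). $\mathbf{T}(V)=\mathbf{T}(V,\mathbf{R})$. *)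

(* Defs.v *)
From HB Require Import structures.
From mathcomp Require Import all_boot all_order all_algebra.
From mathcomp Require Import all_classical all_reals all_analysis.
Import Order.TTheory GRing.Theory Num.Theory.
Import numFieldNormedType.Exports.

Set Implicit Arguments.
Unset Strict Implicit.
Unset Printing Implicit Defensive.

Local Open Scope classical_set_scope.
Local Open Scope ring_scope.

(* Conventions.
   - A measure over a subset Om of a space X is an outer measure on X for which
     the complement of Om is null ([measure_over]); it is determined by its
     values on the subsets of Om.
   - Vectors of R^n are row vectors, with the Euclidean norm [enorm]; the norm
     `|_| of the library on 'rV[R]_n is the maximum norm and is used for
     topological purposes only.
   - An element of Hom(R^n, R) is a column vector a, and <v, a> is
     (v *m a) 0 0.
   - An m dimensional subspace P of R^n is represented by the matrix of the
     orthogonal projection of R^n onto P, so that G(n,m) is a (compact) subset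
     of 'M[R]_n and carries the induced topology. *)

Section outer_measures.
Context {R : realType}.
Local Open Scope ereal_scope.

Definition zero_outer {X : Type} (A : set X) : \bar R := 0.

Lemma zero_outer_sigma_subadditive (X : Type) :
  sigma_subadditive (@zero_outer X).
Proof. by move=> F; rewrite /zero_outer; apply: nneseries_ge0. Qed.

HB.instance Definition _ (X : Type) :=
  isOuterMeasure.Build R X (@zero_outer X) erefl (fun=> lexx _)
    (fun _ _ _ => lexx _) (@zero_outer_sigma_subadditive X).

Definition outer_restr {X : Type} (mu : {outer_measure set X -> \bar R})
  (A : set X) (B : set X) : \bar R := mu (B `&` A).

Section outer_restr_lemmas.
Variables (X : Type) (mu : {outer_measure set X -> \bar R}) (A : set X).

Lemma outer_restr0 : outer_restr mu A set0 = 0.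
Proof. by rewrite /outer_restr set0I outer_measure0. Qed.

Lemma outer_restr_ge0 B : 0 <= outer_restr mu A B.
Proof. exact: outer_measure_ge0. Qed.

Lemma le_outer_restr : {homo outer_restr mu A : B C / B `<=` C >-> B <= C}.
Proof. by move=> B C BC; apply: le_outer_measure; exact: setSI. Qed.

Lemma outer_restr_sigma_subadditive : sigma_subadditive (outer_restr mu A).
Proof.
by move=> F; rewrite /outer_restr setI_bigcupl;
  exact: outer_measure_sigma_subadditive.
Qed.

HB.instance Definition _ := isOuterMeasure.Build R X (outer_restr mu A)
  outer_restr0 outer_restr_ge0 le_outer_restr outer_restr_sigma_subadditive.
End outer_restr_lemmas.

Definition outer_add {X : Type} (mu nu : {outer_measure set X -> \bar R})
  (A : set X) : \bar R := mu A + nu A.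

Section outer_add_lemmas.
Variables (X : Type) (mu nu : {outer_measure set X -> \bar R}).

Lemma outer_add0 : outer_add mu nu set0 = 0.
Proof. by rewrite /outer_add !outer_measure0 adde0. Qed.

Lemma outer_add_ge0 A : 0 <= outer_add mu nu A.
Proof. by apply: adde_ge0; exact: outer_measure_ge0. Qed.

Lemma le_outer_add : {homo outer_add mu nu : A B / A `<=` B >-> A <= B}.
Proof. by move=> A B AB; apply: leeD; exact: le_outer_measure. Qed.

Lemma outer_add_sigma_subadditive : sigma_subadditive (outer_add mu nu).
Proof.
move=> F; rewrite /outer_add nneseriesD; last 2 first.
- by move=> *; exact: outer_measure_ge0.
- by move=> *; exact: outer_measure_ge0.
by apply: leeD; exact: outer_measure_sigma_subadditive.
Qed.

HB.instance Definition _ := isOuterMeasure.Build R X (outer_add mu nu)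
  outer_add0 outer_add_ge0 le_outer_add outer_add_sigma_subadditive.
End outer_add_lemmas.

(* The measure of the sigma-algebra of Caratheodory measurable sets given by an
   outer measure; integrals with respect to an outer measure are taken with
   respect to it. *)
Definition cara {X : pointedType} (mu : {outer_measure set X -> \bar R}) :
  {measure set (caratheodory_type mu) -> \bar R} := mu.

Definition leb1 : {outer_measure set measurableTypeR R -> \bar R} :=
  (@lebesgue_measure R)^*%mu.

(* mu measurability of a function with domain D. *)
Definition omeasurable {X : pointedType} {Y : topologicalType}
  (mu : {outer_measure set X -> \bar R}) (D : set X) (f : X -> Y) : Prop :=
  forall G : set Y, open G -> mu.-caratheodory (D `&` f @^-1` G).

(* Existence of the integral in the extended reals (infinite values allowed),
   as in geometric measure theory; when the integral is finite, one speaks of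
   a summable function. *)
Definition ointegrable {X : pointedType} (mu : {outer_measure set X -> \bar R})
  (g : X -> \bar R) : Prop :=
  omeasurable mu setT g /\
  (\int[cara mu]_x g^\+ x < +oo \/ \int[cara mu]_x g^\- x < +oo).

Definition borel {X : topologicalType} : set (set X) := <<s @open X >>.

Definition borel_regular {X : topologicalType}
  (mu : {outer_measure set X -> \bar R}) : Prop :=
  (forall B, borel B -> mu.-caratheodory B) /\
  (forall A, exists B, [/\ borel B, A `<=` B & mu B = mu A]).

Definition measure_over {X : Type} (Om : set X)
  (mu : {outer_measure set X -> \bar R}) : Prop := mu (~` Om) = 0.

(* Radon measures over the locally compact subspace Om of X. *)
Definition radon {X : topologicalType} (Om : set X)
    (mu : {outer_measure set X -> \bar R}) : Prop :=
  [/\ measure_over Om mu,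
      forall K, compact K -> K `<=` Om -> mu K < +oo,
      forall G, open G -> mu.-caratheodory (G `&` Om),
      forall G, open G -> mu (G `&` Om) =
        ereal_sup [set mu K | K in [set K | compact K /\ K `<=` G `&` Om]] &
      forall A, A `<=` Om -> mu A =
        ereal_inf [set mu (G `&` Om) | G in [set G | open G /\ A `<=` G]] ].

End outer_measures.

Section distributions.
Context {R : realType}.

Definition enorm {n : nat} (v : 'rV[R]_n) : R := Num.sqrt (\sum_i v 0 i ^+ 2).

Definition opnorm {n : nat} (a : 'cV[R]_n) : R :=
  sup [set `|(v *m a) 0 0| | v in [set v : 'rV[R]_n | enorm v <= 1]].

Definition iter_derive {X Y : normedModType R} (vs : seq X) (f : X -> Y) :
  X -> Y := foldr (fun v g => 'D_v g) f vs.

Definition smooth {X Y : normedModType R} (f : X -> Y) : Prop :=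
  forall (vs : seq X) (x : X), differentiable (iter_derive vs f) x.

Definition spt {X Y : normedModType R} (f : X -> Y) : set X :=
  closure [set x | f x != 0].

(* Elements of D(Om, Y), extended by 0 outside the open set Om. *)
Definition test_function {X Y : normedModType R} (Om : set X) (f : X -> Y) :
  Prop := [/\ smooth f, compact (spt f) & spt f `<=` Om].

(* T is in D'(Om, Y), for an open set Om; only the values of T on
   D(Om, Y) matter. A linear functional is continuous on D(Om, Y) if and only
   if it is so on each of the metrizable spaces of smooth functions supported
   in a given compact subset K of Om, with the topology of uniform convergence
   of all derivatives. *)
Definition is_distribution {X Y : normedModType R} (Om : set X)
    (T : (X -> Y) -> R) : Prop :=
  (forall (a : R) (phi psi : X -> Y),
     test_function Om phi -> test_function Om psi ->
     T (fun x => a *: phi x + psi x) = a * T phi + T psi) /\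
  (forall (K : set X) (phi : nat -> X -> Y), compact K -> K `<=` Om ->
     (forall k, test_function Om (phi k) /\ spt (phi k) `<=` K) ->
     (forall (vs : seq X) (e : R), 0 < e ->
        \forall k \near \oo, forall x, `|iter_derive vs (phi k) x| <= e) ->
     T (phi k) @[k --> \oo] --> (0 : R)).

Section variation.
Context {X : normedModType R} {n : nat}.
Implicit Types (Om : set X) (S : (X -> 'rV[R]_n) -> R).

Definition variation_candidate Om S (mu : {outer_measure set X -> \bar R}) :
  Prop :=
  [/\ measure_over Om mu, borel_regular mu &
      forall G, open G -> G `<=` Om -> mu G =
        ereal_sup [set (S theta)%:E | theta in [set theta : X -> 'rV[R]_n |
          [/\ test_function Om theta, spt theta `<=` G &
              forall x, enorm (theta x) <= 1]]] ].

Definition is_variation Om S (mu : {outer_measure set X -> \bar R}) : Prop :=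
  variation_candidate Om S mu /\
  forall nu : {outer_measure set X -> \bar R}, variation_candidate Om S nu ->
    forall A, (nu A <= mu A)%E.

(* ||S||, which exists for every functional S that is linear on D(Om, R^n). *)
Definition variation_measure Om S : {outer_measure set X -> \bar R} :=
  if pselect (exists mu, is_variation Om S mu) is left h then projT1 (cid h)
  else @zero_outer R X.

Definition representable Om S : Prop := radon Om (variation_measure Om S).

(* L_1(mu, R^n) *)
Definition L1 (mu : {outer_measure set X -> \bar R}) (theta : X -> 'rV[R]_n) :
  Prop :=
  omeasurable mu setT theta /\
  (\int[cara mu]_x (enorm (theta x))%:E < +oo)%E.

(* The trace on D(Om, R^n) of the filter of neighbourhoods of theta for the
   seminorm of L_1(||S||, R^n). *)
Definition L1_nbhs Om S (theta : X -> 'rV[R]_n) : set_system (X -> 'rV[R]_n) :=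
  filter_from [set e : R | 0 < e] (fun e => [set psi |
    test_function Om psi /\
    (\int[cara (variation_measure Om S)]_x (enorm (psi x - theta x))%:E
       < e%:E)%E]).

(* The value at theta of the continuous extension of S to L_1(||S||, R^n),
   meaningful if S is representable by integration and theta belongs to that
   space. *)
Definition L1_ext Om S (theta : X -> 'rV[R]_n) : R :=
  lim (S @ L1_nbhs Om S theta).

(* The restriction of S to a ||S|| measurable set A. *)
Definition drestr Om S (A : set X) (theta : X -> 'rV[R]_n) : R :=
  L1_ext Om S (patch (fun=> 0) A theta).

End variation.

End distributions.

Section rectifiability.
Context {R : realType}.
Local Open Scope ereal_scope.

(* The Lebesgue measure alpha(m) of the unit ball of R^m; the recursion is
   alpha(l) = (2 pi / l) alpha(l - 2). *)
Fixpoint ball_volume (m : nat) : R :=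
  match m with
  | 0 => 1
  | 1 => 2
  | (k.+1 as l).+1 => 2 * pi / (l.+1)%:R * ball_volume k
  end%R.

Lemma ball_volume_ge0 m : (0 <= ball_volume m)%R.
Proof.
have [] : (0 <= ball_volume m)%R /\ (0 <= ball_volume m.+1)%R; last by [].
elim: m => [|m [IH1 IH2]]; first by split.
split=> //; rewrite [ball_volume m.+2]/=; apply: mulr_ge0 => //.
by apply: divr_ge0 => //; apply: mulr_ge0 => //; exact: pi_ge0.
Qed.

Context {n : nat}.
Implicit Types (A S : set 'rV[R]_n) (a v : 'rV[R]_n).

Definition diam A : R :=
  sup [set enorm (p.1 - p.2)%R | p in [set p | A p.1 /\ A p.2]].

Definition hgauge (m : nat) A : \bar R :=
  if A == set0 then 0 else (ball_volume m / 2 ^+ m * diam A ^+ m)%R%:E.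

Lemma enorm_ge0 (p : nat) (v : 'rV[R]_p) : (0 <= enorm v)%R.
Proof. exact: sqrtr_ge0. Qed.

Lemma diam_ge0 A : (0 <= diam A)%R.
Proof.
rewrite /diam; set B := (X in sup X).
have [sB|nsB] := pselect (has_sup B); last by rewrite sup_out.
have [x Bx] := sB.1; apply: (le_trans _ (ub_le_sup sB.2 Bx)).
by case: Bx => p _ <-; exact: enorm_ge0.
Qed.

Lemma hgauge_ge0 m A : 0 <= hgauge m A.
Proof.
rewrite /hgauge; case: ifP => // _; rewrite lee_fin.
by rewrite mulr_ge0 ?exprn_ge0 ?diam_ge0// divr_ge0 ?ball_volume_ge0 ?exprn_ge0.
Qed.

Definition hcover (d : R) A : set (nat -> set 'rV[R]_n) :=
  [set S | (forall k x y, S k x -> S k y -> enorm (x - y) <= d)%R /\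
           A `<=` \bigcup_k S k].

Definition hausdorff_pre (m : nat) (d : R) A : \bar R :=
  ereal_inf [set \sum_(k <oo) hgauge m (S k) | S in hcover d A].

(* The m dimensional Hausdorff measure of R^n *)
Definition hausdorff (m : nat) A : \bar R :=
  ereal_sup [set hausdorff_pre m d A | d in [set d : R | (0 < d)%R]].

Lemma hausdorff_pre_ge0 m d A : 0 <= hausdorff_pre m d A.
Proof.
apply: le_ereal_inf_tmp => _ [S _ <-].
by apply: nneseries_ge0 => *; exact: hgauge_ge0.
Qed.

Lemma hausdorff_pre0 m d : hausdorff_pre m d set0 = 0.
Proof.
apply/eqP; rewrite eq_le hausdorff_pre_ge0 andbT.
apply: ereal_inf_lbound; exists (fun=> set0); first by split.
by apply: eseries0 => k _ _; rewrite /hgauge eqxx.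
Qed.

Lemma le_hausdorff_pre m d :
  {homo hausdorff_pre m d : A B / A `<=` B >-> A <= B}.
Proof.
move=> A B AB; apply/ereal_inf_le_tmp => x [S [dS BS] <-{x}].
by exists S => //; split => //; exact: subset_trans AB BS.
Qed.

Lemma hausdorff_pre_sigma_subadditive m d :
  sigma_subadditive (hausdorff_pre m d).
Proof.
move=> A; have [[i ioo]|] := pselect (exists i, hausdorff_pre m d (A i) = +oo).
  rewrite (eseries_pinfty _ _ ioo) ?leey// => k _.
  by rewrite -ltNye (lt_le_trans _ (hausdorff_pre_ge0 _ _ _)).
rewrite -forallNE => Aoo.
suff add2e (e : {posnum R}) : hausdorff_pre m d (\bigcup_n A n) <=
    \sum_(i <oo) hausdorff_pre m d (A i) + e%:num%:E.
  by apply/lee_addgt0Pr => _/posnumP[].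
rewrite (le_trans _ (epsilon_trick _ _ _))//; last first.
  by move=> *; exact: hausdorff_pre_ge0.
pose P k (B : (set 'rV[R]_n)^nat) := hcover d (A k) B /\
  \sum_(j <oo) hgauge m (B j) <=
  hausdorff_pre m d (A k) + (e%:num / (2 ^ k.+1)%:R)%:E.
have [G PG] : {G : ((set 'rV[R]_n)^nat)^nat & forall k, P k (G k)}.
  apply: (@choice _ _ P) => k; rewrite /P /hausdorff_pre.
  set S := (X in ereal_inf X); move infS : (ereal_inf S) => iS.
  case: iS infS => [r Sr|Soo|Soo].
  - have en1 : (0 < e%:num / (2 ^ k.+1)%:R)%R by [].
    have /(lb_ereal_inf_adherent en1) : ereal_inf S \is a fin_num by rewrite Sr.
    move=> [x [B [dB AB] muBx] xS].
    by exists B; split => //; rewrite muBx -Sr; exact/ltW.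
  - by have := Aoo k; rewrite /hausdorff_pre Soo.
  - have := hausdorff_pre_ge0 m d (A k).
    by rewrite /hausdorff_pre Soo.
have muG_ge0 x : 0 <= (hgauge m \o uncurry G) x by exact: hgauge_ge0.
apply: (@le_trans _ _ (\esum_(i in setT) (hgauge m \o uncurry G) i)).
  apply: ereal_inf_lbound => /=.
  have /card_esym/ppcard_eqP[f] := card_nat2.
  exists (uncurry G \o f).
    split => [i x y|].
      by rewrite /= /uncurry; case: (f i) => a b; exact: (PG a).1.1.
    apply: (@subset_trans _ (\bigcup_k \bigcup_j G k j)) => [t [i _]|].
      by move=> /(PG i).1.2 -[j _ ?]; exists i => //; exists j.
    move=> t [i _ [j _ Bijt]]; exists (f^-1%FUN (i, j)) => //=.
    by rewrite invK ?inE.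
  rewrite -(esum_pred_image (hgauge m \o uncurry G) _ xpredT) ?[fun=> _]set_true//.
  by rewrite image_eq.
rewrite (_ : esum _ _ = \sum_(i <oo) \sum_(j <oo) hgauge m (G i j)); last first.
  pose J : nat -> set (nat * nat) := fun i => [set (i, j) | j in setT].
  rewrite (_ : setT = \bigcup_k J k); last first.
    by rewrite predeqE => -[a b]; split => // _; exists a => //; exists b.
  rewrite esum_bigcupT /=; last 2 first.
    - apply/trivIsetP => i j _ _ ij.
      rewrite predeqE => -[k l] /=; split => //= -[] [_] _ [<-{k} _].
      by move=> [m' _] [] /esym/eqP; rewrite (negbTE ij).
    - by move=> /= [k l] *; exact: (muG_ge0 (k, l)).
  rewrite -(image_id [set: nat]) -fun_true esum_pred_image//; last first.
    by move=> k _; apply: esum_ge0 => x _; exact: muG_ge0.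
  apply: eq_eseriesr => /= j _.
  rewrite -(esum_pred_image (hgauge m \o uncurry G) (pair j) predT)//=; last 2 first.
    by move=> k _; exact: (muG_ge0 (j, k)).
    by move=> ? ? _ _; exact: (@can_inj _ _ _ snd).
  by congr esum; rewrite predeqE => -[a b]; split; move=> [i _ <-]; exists i.
apply: lee_nneseries.
- by move=> k *; apply: nneseries_ge0 => l *; exact: hgauge_ge0.
- by move=> k *; exact: (PG k).2.
Qed.

Lemma hausdorff_pre_le m d A : (0 < d)%R ->
  hausdorff_pre m d A <= hausdorff m A.
Proof. by move=> d0; apply: ereal_sup_ubound; exists d. Qed.

Lemma hausdorff_ge0 m A : 0 <= hausdorff m A.
Proof.
exact: le_trans (hausdorff_pre_ge0 m 1 A) (hausdorff_pre_le _ _ ltr01).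
Qed.

Lemma hausdorff0 m : hausdorff m set0 = 0.
Proof.
apply/eqP; rewrite eq_le hausdorff_ge0 andbT.
by apply: ge_ereal_sup => _ [d d0 <-]; rewrite hausdorff_pre0.
Qed.

Lemma le_hausdorff m : {homo hausdorff m : A B / A `<=` B >-> A <= B}.
Proof.
move=> A B AB; apply: ge_ereal_sup => _ [d d0 <-].
exact: le_trans (le_hausdorff_pre _ _ AB) (hausdorff_pre_le _ _ d0).
Qed.

Lemma hausdorff_sigma_subadditive m : sigma_subadditive (hausdorff m).
Proof.
move=> F; apply: ge_ereal_sup => _ [d d0 <-].
apply: le_trans (hausdorff_pre_sigma_subadditive _ _ _) _.
apply: lee_nneseries => k *; first exact: hausdorff_pre_ge0.
exact: hausdorff_pre_le.
Qed.

HB.instance Definition _ (m : nat) := isOuterMeasure.Build R _ (hausdorff m)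
  (hausdorff0 m) (hausdorff_ge0 m) (@le_hausdorff m)
  (@hausdorff_sigma_subadditive m).

Definition countably_rectifiable (m : nat) A : Prop :=
  exists (B : nat -> set 'rV[R]_m) (g : nat -> 'rV[R]_m -> 'rV[R]_n),
    (forall k, bounded_set (B k) /\
       exists L : R, forall x y, B k x -> B k y ->
         (enorm (g k x - g k y) <= L * enorm (x - y))%R) /\
    hausdorff m (A `\` \bigcup_k (g k @` B k)) = 0.

(* Tan(S, a) *)
Definition tangent_cone S a : set 'rV[R]_n :=
  [set v | forall e : R, (0 < e)%R -> exists x (r : R),
     [/\ S x, 0 < r, enorm (x - a) < e & enorm (r *: (x - a) - v) < e]%R].

(* The complement of S has m dimensional mu density 0 at a. *)
Definition density0_compl (m : nat) (mu : {outer_measure set 'rV[R]_n -> \bar R})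
    S a : Prop :=
  mu ([set x | enorm (x - a) <= r]%R `\` S) * ((ball_volume m * r ^+ m)^-1)%:E
    @[r --> (0 : R)^'+] --> 0.

(* Tan^m(mu, a), the approximate tangent vectors *)
Definition approx_tangent_cone (m : nat)
    (mu : {outer_measure set 'rV[R]_n -> \bar R}) a : set 'rV[R]_n :=
  \bigcap_(S in [set S | density0_compl m mu S a]) tangent_cone S a.

End rectifiability.

Section varifolds.
Context {R : realType} {n : nat}.
Variable m : nat.

Definition grassmann : set 'M[R]_n :=
  [set P | [/\ P *m P = P, P^T = P & \rank P = m]].

Implicit Types (U E : set 'rV[R]_n)
  (V : {outer_measure set ('rV[R]_n * 'M[R]_n) -> \bar R}).

Definition is_varifold U V : Prop := radon (U `*` grassmann) V.

(* ||V|| *)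
Definition weight V (A : set 'rV[R]_n) : \bar R := V (A `*` grassmann).

Section weight_lemmas.
Variable V : {outer_measure set ('rV[R]_n * 'M[R]_n) -> \bar R}.
Local Open Scope ereal_scope.

Lemma weight0 : weight V set0 = 0.
Proof. by rewrite /weight set0X outer_measure0. Qed.

Lemma weight_ge0 A : 0 <= weight V A.
Proof. exact: outer_measure_ge0. Qed.

Lemma le_weight : {homo weight V : A B / A `<=` B >-> A <= B}.
Proof. by move=> A B AB; apply: le_outer_measure; exact: setSX. Qed.

Lemma weight_sigma_subadditive : sigma_subadditive (weight V).
Proof.
move=> F; rewrite /weight; apply: (le_trans (le_outer_measure V _ _ _));
  last exact: outer_measure_sigma_subadditive.
by move=> [x P] [/= [k _ Fkx] GP]; exists k.
Qed.

HB.instance Definition _ := isOuterMeasure.Build R _ (weight V)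
  weight0 weight_ge0 le_weight weight_sigma_subadditive.
End weight_lemmas.

(* V is given by integration over M with multiplicity theta, tau x being the
   approximate tangent plane at x. The latter is taken with respect to ||V||,
   that is, to the measure theta H^m restricted to M; unlike H^m restricted to
   M, this measure is locally finite. *)
Definition rectifiable_varifold U V : Prop :=
  is_varifold U V /\
  exists (M : set 'rV[R]_n) (theta : 'rV[R]_n -> R) (tau : 'rV[R]_n -> 'M[R]_n),
    [/\ [/\ M `<=` U, (hausdorff m).-caratheodory M & countably_rectifiable m M],
        omeasurable (hausdorff m) M theta /\ (forall x, M x -> 0 < theta x),
        omeasurable (hausdorff m) M tau,
        {ae cara (hausdorff m), forall x, M x -> grassmann (tau x) /\
           approx_tangent_cone m (weight V) x = [set v | v *m tau x = v]} &
        forall A, borel A ->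
          V A = (\int[cara (hausdorff m)]_(x in M `&` [set x | A (x, tau x)])
                   (theta x)%:E)%E].

(* delta V; the trace is the inner product of P and D theta(x) *)
Definition first_variation V (theta : 'rV[R]_n -> 'rV[R]_n) : R :=
  (\int[cara V]_z \tr (z.2^T *m jacobian theta z.1))%R.

(* ||delta V|| *)
Definition dvar U V : {outer_measure set 'rV[R]_n -> \bar R} :=
  variation_measure U (first_variation V).

(* V boundary E, that is,
   (delta V) restricted to E - delta (V restricted to E x G(n,m)) *)
Definition vboundary U V E (theta : 'rV[R]_n -> 'rV[R]_n) : R :=
  drestr U (first_variation V) E theta
  - first_variation (outer_restr V (E `*` grassmann)) theta.

(* f, with domain D, belongs to T(V) and F is a version of its generalised
   V weak derivative. *)
Definition weak_derivative U V (D : set 'rV[R]_n) (f : 'rV[R]_n -> R)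
    (F : 'rV[R]_n -> 'cV[R]_n) : Prop :=
  [/\ D `<=` U /\ outer_add (weight V) (dvar U V) (U `\` D) = 0%E,
      omeasurable (outer_add (weight V) (dvar U V)) D f,
      omeasurable (weight V) setT F,
      forall (K : set 'rV[R]_n) (s : R), compact K -> K `<=` U -> 0 <= s ->
        (\int[cara (weight V)]_(x in K `&` (D `&` [set x | (`|f x| <= s)%R]))
           (opnorm (F x))%:E < +oo)%E &
      forall (theta : 'rV[R]_n -> 'rV[R]_n) (gamma : R -> R),
        test_function U theta -> smooth gamma -> compact (spt (derive1 gamma)) ->
        L1_ext U (first_variation V) (fun x => gamma (f x) *: theta x) =
        (\int[cara V]_z
           (gamma (f z.1) * \tr (z.2^T *m jacobian theta z.1)))%R +
        (\int[cara (weight V)]_x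
           (derive1 gamma (f x) * (theta x *m F x) 0 0))%R].

Definition in_T U V (D : set 'rV[R]_n) (f : 'rV[R]_n -> R) : Prop :=
  exists F, weak_derivative U V D f F.

End varifolds.

(* Main.v *)
(* For y in R let S_y := V\partial E(y), and for a bounded function a on U let
   Lam a (theta) := (delta V)(a theta) - \int a(x) (P . D theta(x)) dV(x,P), so
   that S_y = Lam (1_{f > y}). If omega is in D(R) and gamma is its primitive
   t |-> \int_{-oo}^t omega, the defining identity of T(V) reads
   T(omega (x) theta) = Lam (gamma o f) (theta). Since gamma o f is the limit of
   the sums \sum_j (\int_{I_j} omega) 1_{f > y_j} over finer and finer partitions
   of R into intervals I_j, dominated convergence yields
   T(omega (x) theta) = \int omega(y) S_y(theta) dy, without Fubini's theorem.

   The rest of the coarea formula only uses this identity, the fact that ||T||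
   is a Radon measure and that y |-> S_y(theta) is right continuous and bounded.
   A smooth partition of unity in y gives T(phi) = \int S_y(phi(.,y)) dy for test
   functions phi, hence ||T||(W) <= \int ||S_y||(W_y) dy for open W; comparing
   S_y(theta) with averages over short intervals gives the reverse inequality.
   Outer regularity, applied to A and to W \ A, then extends the equality to
   every ||T|| measurable set A, and approximation to integrable functions.

   For O open in U and I an open interval, ||T||(O x I) is at most the integral
   of |V D f|_1 over O \cap f^{-1}(I). This shows that ||T|| is a Radon measure.
   For r < s and A := {f not in ]r,s[} it also shows ||T||(A x ]r,s[) = 0, taking
   the infimum over the open sets containing A; these products cover
   {(x,y) : f(x) <> y}. *)

From HB Require Import structures.
Require Import Defs.
From mathcomp Require Import all_boot all_order all_algebra.
From mathcomp Require Import all_classical all_reals all_analysis.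
From mathcomp Require Import measurable_realfun ring lra.
Import Order.TTheory GRing.Theory Num.Theory.
Import numFieldNormedType.Exports.

Set Implicit Arguments.
Unset Strict Implicit.
Unset Printing Implicit Defensive.

Local Open Scope classical_set_scope.
Local Open Scope ring_scope.

(** * Smooth functions *)

(** The main obstacle is measurability. The measure ||V boundary E(y)|| changes with y and is a
    supremum over uncountably many fields, extended to all sets by coverings, so nothing says a
    priori that y |-> ||V boundary E(y)||(A_y) is measurable. On bounded pieces it is enclosed
    between measurable functions with equal integrals, and the completeness of Lebesgue measure on
    its Caratheodory measurable sets transfers the measurability. The same squeeze handles the
    slices of a ||T|| measurable set, which need not be Borel.

    All statements on L_1 rest on S(theta) <= 8 \int |theta| d||S||, proved by cut-offs, so that no
    vector valued density of S with respect to ||S|| has to be constructed.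

    Finally, delta V and V are integrated over different sigma-algebras: a function of x that is
    measurable for ||V|| must be shown to be V measurable on the product. This holds because ||V||
    is again a Radon measure, which follows from the compactness of G(n,m). *)

Lemma smooth_differentiable (R : realType) (X Y : normedModType R) (f : X -> Y) x :
  smooth f -> differentiable f x.
Proof. by move=> /(_ [::] x). Qed.

Lemma smooth_derive (R : realType) (X Y : normedModType R) (f : X -> Y) v :
  smooth f -> smooth ('D_v f).
Proof.
by move=> sf vs x; have := sf (rcons vs v) x; rewrite /iter_derive foldr_rcons.
Qed.

Lemma smooth_continuous (R : realType) (X Y : normedModType R) (f : X -> Y) :
  smooth f -> continuous f.
Proof.
by move=> sf x; apply: differentiable_continuous; exact: smooth_differentiable.
Qed.

(** The derivative of a product or of a composition is a combination of other products, so an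
    induction along a fixed list of directions does not close. Counting the order allows an
    induction on [k] with the functions generalised. *)
Fixpoint csmooth (R : realType) (k : nat) (X Y : normedModType R) (f : X -> Y)
    : Prop :=
  (forall x, differentiable f x) /\
  if k is k'.+1 then forall v, csmooth k' ('D_v f) else True.

Lemma csmooth_diff (R : realType) k (X Y : normedModType R) (f : X -> Y) x :
  csmooth k f -> differentiable f x.
Proof. by case: k => [|k] [+ _]; exact. Qed.

Lemma csmoothP (R : realType) (X Y : normedModType R) (f : X -> Y) :
  smooth f <-> forall k, csmooth k f.
Proof.
split=> [sf k|cf vs].
  elim: k f sf => [|k IH] f sf; split => //.
  - by move=> x; exact: smooth_differentiable.
  - by move=> x; exact: smooth_differentiable.
  - by move=> v; apply: IH; exact: smooth_derive.
elim/last_ind: vs f cf => [|vs v IH] f cf x; first exact: csmooth_diff (cf 0%N).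
rewrite /iter_derive foldr_rcons; apply: IH => k.
by have [_] := cf k.+1; exact.
Qed.

Lemma csmooth_derive (R : realType) k (X Y : normedModType R) (f : X -> Y) v :
  csmooth k.+1 f -> csmooth k ('D_v f).
Proof. by move=> [_]; exact. Qed.

Lemma csmoothS (R : realType) k (X Y : normedModType R) (f : X -> Y) :
  csmooth k.+1 f -> csmooth k f.
Proof.
elim: k f => [|k IH] f [df Df]; split => // v.
by apply: IH; exact: Df.
Qed.

Lemma csmooth_cst (R : realType) k (X Y : normedModType R) (a : Y) :
  csmooth k (fun _ : X => a).
Proof.
have dc (b : Y) x : differentiable (fun _ : X => b) x by exact: differentiable_cst.
elim: k a => [|k IH] a; split => // v.
rewrite (_ : 'D_v _ = fun=> 0) //.
by apply/funext => x; exact: derive_cst.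
Qed.

Lemma csmoothD (R : realType) k (X Y : normedModType R) (f g : X -> Y) :
  csmooth k f -> csmooth k g -> csmooth k (fun x => f x + g x).
Proof.
have dD (f' g' : X -> Y) x : differentiable f' x -> differentiable g' x ->
  differentiable (fun x => f' x + g' x) x by exact: differentiableD.
elim: k f g => [|k IH] f g [df Df] [dg Dg]; split.
- by move=> x; exact: dD.
- by [].
- by move=> x; exact: dD.
move=> v; rewrite (_ : 'D_v _ = fun x => 'D_v f x + 'D_v g x).
  by apply: IH; [exact: Df|exact: Dg].
by apply/funext => x; apply: deriveD; exact: diff_derivable.
Qed.

Section scale_bilinear.
Variables (R : realType) (Y : normedModType R).

(** A head symbol of its own for scalar multiplication, to carry the bilinear structure that the
    rule for differentials of continuous bilinear maps expects. *)
Definition scale_fun (a : R) (v : Y) := a *: v.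

Lemma scaler_is_bilinear :
  bilinear_for
    (GRing.Scale.Law.clone _ _ *:%R _) (GRing.Scale.Law.clone _ _ *:%R _)
    scale_fun.
Proof.
rewrite /scale_fun; split=> [u'|u] a x y /=; first by rewrite scalerDl scalerA.
by rewrite scalerDr !scalerA mulrC.
Qed.

HB.instance Definition _ := bilinear_isBilinear.Build R R Y Y _ _
  scale_fun scaler_is_bilinear.

Definition scale_bil : {bilinear R -> Y -> Y} := scale_fun.

Lemma scale_bil_cont : continuous (fun p : R * Y => scale_bil p.1 p.2).
Proof. by move=> p; exact: scale_continuous. Qed.

End scale_bilinear.

Lemma differentiable_scale (R : realType) (X Y : normedModType R) (a : X -> R)
    (f : X -> Y) x : differentiable a x -> differentiable f x ->
  differentiable (fun x => a x *: f x) x.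
Proof.
move=> da df.
rewrite (_ : (fun x => a x *: f x) =
  (fun p : R * Y => scale_bil Y p.1 p.2) \o (fun x => (a x, f x))) //.
apply: differentiable_comp; first exact: differentiable_pair.
apply: differentiable_bilin; exact: scale_bil_cont.
Qed.

Lemma derive_scale (R : realType) (X Y : normedModType R) (a : X -> R)
    (f : X -> Y) x v : differentiable a x -> differentiable f x ->
  'D_v (fun x => a x *: f x) x = a x *: 'D_v f x + 'D_v a x *: f x.
Proof.
move=> da df; rewrite !deriveE//; last exact: differentiable_scale.
rewrite (_ : (fun x => a x *: f x) =
  (fun p : R * Y => scale_bil Y p.1 p.2) \o (fun x => (a x, f x))) //.
rewrite diff_comp /=; last 2 first.
- exact: differentiable_pair.
- apply: differentiable_bilin; exact: scale_bil_cont.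
rewrite (diff_pair da df) diff_bilin //; exact: scale_bil_cont.
Qed.

Lemma csmooth_scale (R : realType) k (X Y : normedModType R) (a : X -> R)
    (f : X -> Y) :
  csmooth k a -> csmooth k f -> csmooth k (fun x => a x *: f x).
Proof.
elim: k a f => [|k IH] a f ca cf; split => //;
  do ?[by move=> x; apply: differentiable_scale; [exact: csmooth_diff ca|
    exact: csmooth_diff cf]].
move=> v; rewrite (_ : 'D_v _ = fun x => a x *: 'D_v f x + 'D_v a x *: f x).
  apply: csmoothD; apply: IH.
  - exact: csmoothS.
  - exact: csmooth_derive.
  - exact: csmooth_derive.
  - exact: csmoothS.
by apply/funext => x; apply: derive_scale; [exact: csmooth_diff ca|
    exact: csmooth_diff cf].
Qed.

Lemma csmooth_comp1 (R : realType) k (X : normedModType R) (g : R -> R)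
    (a : X -> R) :
  csmooth k g -> csmooth k a -> csmooth k (fun x => g (a x)).
Proof.
elim: k g a => [|k IH] g a cg ca; split => //;
  do ?[by move=> x; apply: differentiable_comp; [exact: csmooth_diff ca|
    exact: csmooth_diff cg]].
move=> v; rewrite (_ : 'D_v _ = fun x => 'D_v a x *: 'D_1 g (a x)).
  apply: csmooth_scale; first exact: csmooth_derive.
  by apply: (IH ('D_1 g)); [exact: csmooth_derive|exact: csmoothS].
apply/funext => x; have dg := csmooth_diff (a x) cg.
have da := csmooth_diff x ca.
rewrite !deriveE //; last exact: differentiable_comp.
rewrite (_ : (fun x => g (a x)) = g \o a) // diff_comp //=.
(* The differential of [g] is linear on the line: its value at the number ['d a x v] is that number
   times its value at 1. *)
by rewrite -[in LHS](mulr1 ('d a x v)) -[_ * 1]/('d a x v *: 1) linearZ.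
Qed.

Lemma csmoothV (R : realType) k (X : normedModType R) (a : X -> R) :
  (forall x, a x != 0) -> csmooth k a -> csmooth k (fun x => (a x)^-1).
Proof.
move=> a0; elim: k a a0 => [|k IH] a a0 ca; split => //;
  do ?[by move=> x; apply: differentiableV; [exact: csmooth_diff ca|]].
(* The inverse square is written as two scalings by [(a x)^-1], to each of which the induction
   hypothesis applies. *)
move=> v; rewrite (_ : 'D_v _ = fun x => (-1) *: ((a x)^-1 *: ((a x)^-1 *: 'D_v a x))).
  have ck := csmoothS ca; have iv := IH _ a0 ck.
  apply: csmooth_scale; first exact: csmooth_cst.
  by do 2![apply: csmooth_scale => //]; exact: csmooth_derive.
apply/funext => x; have da := csmooth_diff x ca.
rewrite deriveV //; last exact: diff_derivable.
by rewrite scaleN1r scalerA scaleNr expr2 invfM.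
Qed.

Section affine.
Variables (R : realType) (X Z Y : normedModType R) (L : X -> Z) (l : X -> Z).
Hypothesis dL : forall x, differentiable L x.
Hypothesis DL : forall x v, 'D_v L x = l v.

(** The hypotheses make [L] affine: its derivative in direction [v] is [l v] at every point.
    Differentiating [f] after [L] thus gives another function after the same [L], and the induction
    closes. *)
Lemma csmooth_affine k (f : Z -> Y) : csmooth k f -> csmooth k (fun x => f (L x)).
Proof.
elim: k f => [|k IH] f cf; split => //;
  do ?[by move=> x; apply: differentiable_comp => //; exact: csmooth_diff cf].
move=> v; rewrite (_ : 'D_v _ = fun x => 'D_(l v) f (L x)).
  by apply: (IH ('D_(l v) f)); exact: csmooth_derive.
apply/funext => x; have df := csmooth_diff (L x) cf.
rewrite !deriveE //; last exact: differentiable_comp.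
by rewrite (_ : (fun x => f (L x)) = f \o L) // diff_comp //= -[in RHS](DL x) deriveE.
Qed.

Lemma smooth_affine (f : Z -> Y) : smooth f -> smooth (fun x => f (L x)).
Proof. by move=> /csmoothP cf; apply/csmoothP => k; exact: csmooth_affine. Qed.

End affine.

Section smooth_closure.
Variables (R : realType) (X Y : normedModType R).
Implicit Types (f g : X -> Y) (a b : X -> R).

Lemma smooth_cst (c : Y) : smooth (fun _ : X => c).
Proof. by apply/csmoothP => k; exact: csmooth_cst. Qed.

Lemma smoothD f g : smooth f -> smooth g -> smooth (fun x => f x + g x).
Proof.
by move=> /csmoothP cf /csmoothP cg; apply/csmoothP => k; exact: csmoothD.
Qed.

Lemma smooth_scale a f : smooth a -> smooth f -> smooth (fun x => a x *: f x).
Proof.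
by move=> /csmoothP cf /csmoothP cg; apply/csmoothP => k; exact: csmooth_scale.
Qed.

Lemma smoothZ (c : R) f : smooth f -> smooth (fun x => c *: f x).
Proof.
move=> /csmoothP cf; apply/csmoothP => k; apply: csmooth_scale => //.
exact: csmooth_cst.
Qed.

Lemma smoothN f : smooth f -> smooth (fun x => - f x).
Proof.
move=> sf; rewrite (_ : (fun x => - f x) = (fun x => (-1) *: f x)); first exact: smoothZ.
by apply/funext => x; rewrite scaleN1r.
Qed.

Lemma smoothB f g : smooth f -> smooth g -> smooth (fun x => f x - g x).
Proof. by move=> sf sg; apply: (smoothD sf (smoothN sg)). Qed.

Lemma smooth_comp1 (g : R -> R) a : smooth g -> smooth a -> smooth (fun x => g (a x)).
Proof.
by move=> /csmoothP cf /csmoothP cg; apply/csmoothP => k; exact: csmooth_comp1.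
Qed.

Lemma smoothV a : (forall x, a x != 0) -> smooth a -> smooth (fun x => (a x)^-1).
Proof. by move=> a0 /csmoothP ca; apply/csmoothP => k; exact: csmoothV. Qed.

Lemma smooth_sum (I : Type) (r : seq I) (P : pred I) (h : I -> X -> Y) :
  (forall i, P i -> smooth (h i)) -> smooth (fun x => \sum_(i <- r | P i) h i x).
Proof.
move=> hs; elim: r => [|i r IH].
  by under eq_fun do rewrite big_nil; exact: smooth_cst.
under eq_fun do rewrite big_cons.
case: (boolP (P i)) => Pi //; apply: smoothD => //; exact: hs.
Qed.

End smooth_closure.

Lemma smoothM (R : realType) (X : normedModType R) (a b : X -> R) :
  smooth a -> smooth b -> smooth (fun x => a x * b x).
Proof. exact: smooth_scale. Qed.

Lemma smooth_prod (R : realType) (X : normedModType R) (I : Type) (r : seq I)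
    (h : I -> X -> R) :
  (forall i, smooth (h i)) -> smooth (fun x => \prod_(i <- r) h i x).
Proof.
move=> hs; elim: r => [|i r IH].
  by under eq_fun do rewrite big_nil; exact: smooth_cst.
by under eq_fun do rewrite big_cons; apply: smoothM.
Qed.

Lemma smooth_of_affine (R : realType) (X Y : normedModType R) (L l : X -> Y) :
  (forall x, differentiable L x) -> (forall x v, 'D_v L x = l v) -> smooth L.
Proof.
move=> dL DL; apply/csmoothP => -[|k]; split => // v.
rewrite (_ : 'D_v L = fun=> l v); first exact: csmooth_cst.
by apply/funext => x; exact: DL.
Qed.

Lemma smooth_id (R : realType) (X : normedModType R) : smooth (fun x : X => x).
Proof.
apply: (@smooth_of_affine _ _ _ _ id) => [x|x v].
- exact: (@ex_diff _ _ _ _ _ _ _ (is_diff_id x)).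
- exact: derive_id.
Qed.

Lemma derive_coord (R : realType) n (i : 'I_n) (x v : 'rV[R]_n) :
  'D_v (fun x : 'rV[R]_n => x 0 i) x = v 0 i.
Proof.
rewrite deriveE; last exact: differentiable_coord.
have @f : {linear 'rV[R]_n -> R}.
  by exists (fun N : 'rV[R]_n => N 0 i); do 2![eexists]; do ?[constructor];
     rewrite ?mxE// => ? *; rewrite ?mxE//; move=> ?; rewrite !mxE.
rewrite (_ : (fun _ => _) = f) // diff_lin //; exact: coord_continuous.
Qed.

Lemma smooth_coord (R : realType) n (i : 'I_n) :
  smooth (fun x : 'rV[R]_n => x 0 i).
Proof.
apply: (@smooth_of_affine _ _ _ _ (fun x : 'rV[R]_n => x 0 i)) => [x|x v].
  exact: differentiable_coord.
exact: derive_coord.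
Qed.

Section product_maps.
Variables (R : realType) (X Z Y : normedModType R).

Lemma differentiable_fst (x : X * Z) : differentiable fst x.
Proof. by apply: (@linear_differentiable R (X * Z)%type X fst) => p; exact: cvg_fst. Qed.

Lemma differentiable_snd (x : X * Z) : differentiable snd x.
Proof. by apply: (@linear_differentiable R (X * Z)%type Z snd) => p; exact: cvg_snd. Qed.

Lemma derive_fst (x v : X * Z) : 'D_v fst x = v.1.
Proof.
rewrite deriveE ?diff_lin //; last exact: differentiable_fst.
by move=> p; exact: cvg_fst.
Qed.

Lemma derive_snd (x v : X * Z) : 'D_v snd x = v.2.
Proof.
rewrite deriveE ?diff_lin //; last exact: differentiable_snd.
by move=> p; exact: cvg_snd.
Qed.

Lemma smooth_fst (f : X -> Y) : smooth f -> smooth (fun p : X * Z => f p.1).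
Proof. exact: smooth_affine differentiable_fst derive_fst _. Qed.

Lemma smooth_snd (f : Z -> Y) : smooth f -> smooth (fun p : X * Z => f p.2).
Proof. exact: smooth_affine differentiable_snd derive_snd _. Qed.

Lemma smooth_slice (f : X * Z -> Y) (z : Z) :
  smooth f -> smooth (fun x => f (x, z)).
Proof.
apply: (@smooth_affine _ _ _ _ _ (fun v => (v, 0))) => [x|x v].
  apply: differentiable_pair; last exact: differentiable_cst.
  exact: (@ex_diff _ _ _ _ _ _ _ (is_diff_id x)).
have d1 : differentiable (id : X -> X) x by exact: (@ex_diff _ _ _ _ _ _ _ (is_diff_id x)).
have d2 : differentiable (cst z : X -> Z) x by exact: differentiable_cst.
rewrite deriveE; last exact: differentiable_pair.
by rewrite (diff_pair d1 d2) diff_cst (@diff_val _ _ _ _ _ _ _ (is_diff_id x)).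
Qed.

End product_maps.

(** * A smooth step function *)

Section smooth_step.
Variable R : realType.

(* The linear span of these functions is closed under differentiation. *)
Definition flat (j : nat) (t : R) : R :=
  if 0 < t then t^-1 ^+ j * expR (- t^-1) else 0.

Lemma flat_ge0 j t : 0 <= flat j t.
Proof.
rewrite /flat; case: ifP => // t0.
by rewrite mulr_ge0 ?expR_ge0 ?exprn_ge0 ?invr_ge0 ?ltW.
Qed.

Lemma flatE0 j t : t <= 0 -> flat j t = 0.
Proof. by move=> t0; rewrite /flat ltNge t0. Qed.

Lemma flatE j t : 0 < t -> flat j t = t^-1 ^+ j * expR (- t^-1).
Proof. by move=> t0; rewrite /flat t0. Qed.

(** The difference quotient of [flat j] at 0 is [flat j.+1], so a bound linear in t, for every
    order, gives the derivative 0 there. The bound comes from a single term of the exponential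
    series at 1/t. *)
Lemma flat_bound j t : flat j t <= (j.+1)`!%:R * `|t|.
Proof.
have [t0|t0] := ltP 0 t; last by rewrite flatE0// mulr_ge0.
have x0 : 0 < t^-1 by rewrite invr_gt0.
rewrite flatE// gtr0_norm// expRN ler_pdivrMr ?expR_gt0//.
have := expR_ge1Dxn j (ltW x0); set e := expR _ => he.
have {he} : t^-1 ^+ j.+1 / (j.+1)`!%:R <= e by apply: le_trans he; rewrite lerDr.
rewrite ler_pdivrMr ?ltr0n ?fact_gt0// exprSr ler_pdivrMr// => /le_trans; apply.
by rewrite [X in _ <= X]mulrC mulrA.
Qed.

Lemma flat_is_derive j (t : R) :
  is_derive t 1 (flat j) (flat j.+2 t - j%:R * flat j.+1 t).
Proof.
case: (ltgtP t 0) => t0.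
- rewrite !flatE0 ?ltW// mulr0 subr0.
  apply: (@near_eq_is_derive _ _ _ (cst 0)) => //.
  by near=> x; rewrite /= flatE0//; near: x; exact: lt_le_nbhsl.
- pose g (t : R) : R := t^-1 ^+ j * expR (- t^-1).
  apply: (@near_eq_is_derive _ _ _ g) => //.
    by near=> x; rewrite flatE//; near: x; exact: lt_nbhsr.
  have t0' : t != 0 by rewrite gt_eqF.
  have dV : is_derive t 1 (fun t : R => t^-1) (- t ^- 2).
    apply: DeriveDef; first exact: derivableV.
    by rewrite deriveV// derive_id scaler1.
  have dE : is_derive t 1 (fun t => expR (- t^-1)) (expR (- t^-1) * (- - t ^- 2)).
    exact: is_derive1_comp.
  rewrite !flatE // /g.
  rewrite (_ : (fun _ => _) =
    (fun t : R => t^-1) ^+ j * (fun t => expR (- t^-1))); last first.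
    by apply/funext => s; rewrite /= !fctE.
  apply: (is_derive_eq (is_deriveM (is_deriveX j dV) dE)).
  rewrite /= !fctE /GRing.scale /=; clear g; case: j => [|j].
    by rewrite !expr0 !mulr0n !mul0r !mulr0 subr0 addr0 -exprVn; ring.
  by rewrite /= -!exprVn !exprS -mulr_natl; ring.
- subst t; rewrite !flatE0// mulr0 subr0.
  have H : (fun h => h^-1 *: ((flat j \o shift 0) (h *: (1 : R)) - flat j 0)) @ 0^' --> (0 : R).
    rewrite flatE0//.
    apply/cvgr0Pnorm_le => e e0; near=> h.
    have h0 : h != 0 by near: h; exact: nbhs_dnbhs_neq.
    rewrite /= subr0 addr0 /GRing.scale /= mulr1.
    have -> : h^-1 * flat j h = flat j.+1 h.
      by rewrite /flat; case: ifP => _; [rewrite exprS mulrA|rewrite mulr0].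
    rewrite ger0_norm ?flat_ge0//.
    apply: le_trans (flat_bound _ _) _.
    rewrite mulrC -ler_pdivlMr ?ltr0n ?fact_gt0//.
    near: h; apply: dnbhs0_le; rewrite divr_gt0 ?ltr0n ?fact_gt0//.
  apply: DeriveDef; first by apply/cvg_ex; exists 0.
  by apply/cvg_lim.
Unshelve. all: by end_near. Qed.

Lemma smooth_flat j : smooth (flat j).
Proof.
apply/csmoothP => k; elim: k j => [|k IH] j; split => //.
- by move=> x; apply/derivable1_diffP; have [] := flat_is_derive j x.
- by move=> x; apply/derivable1_diffP; have [] := flat_is_derive j x.
move=> v.
rewrite (_ : 'D_v _ = fun t => v *: (flat j.+2 t + (- j%:R) *: flat j.+1 t)).
  apply: csmooth_scale; first exact: csmooth_cst.
  apply: csmoothD => //; apply: csmooth_scale => //; exact: csmooth_cst.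
apply/funext => t; have [d1 d2] := flat_is_derive j t.
have /derivable1_diffP df := d1.
rewrite deriveE// -[in LHS](mulr1 v) -[v * 1]/(v *: 1) linearZ -deriveE// d2.
by rewrite /GRing.scale /= mulNr.
Qed.

(** Equal to 0 for t <= 0 and to 1 for t >= 1. One of t and 1 - t is always positive, so the
    denominator never vanishes. *)
Definition step (t : R) : R := flat 0 t / (flat 0 t + flat 0 (1 - t)).

Lemma flat0_gt0 t : 0 < t -> 0 < flat 0 t.
Proof. by move=> t0; rewrite flatE// mul1r expR_gt0. Qed.

Lemma step_den t : 0 < flat 0 t + flat 0 (1 - t).
Proof.
have [t0|t0] := ltP 0 t.
  by rewrite ltr_pwDl ?flat0_gt0 ?flat_ge0.
by rewrite ltr_wpDl ?flat0_gt0 ?flat_ge0// subr_gt0 (le_lt_trans t0).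
Qed.

Lemma smooth_step : smooth step.
Proof.
apply: smoothM; first exact: smooth_flat.
apply: smoothV => [x|]; first by rewrite gt_eqF ?step_den.
apply: smoothD; first exact: smooth_flat.
apply: smooth_comp1; first exact: smooth_flat.
apply: smoothB; [exact: smooth_cst|exact: smooth_id].
Qed.

Lemma step_ge0 t : 0 <= step t.
Proof. by rewrite divr_ge0 ?flat_ge0 ?ltW ?step_den. Qed.

Lemma step_le1 t : step t <= 1.
Proof. by rewrite ler_pdivrMr ?step_den// mul1r lerDl flat_ge0. Qed.

Lemma step0 t : t <= 0 -> step t = 0.
Proof. by move=> t0; rewrite /step flatE0// mul0r. Qed.

Lemma step1 t : 1 <= t -> step t = 1.
Proof.
move=> t1; have := step_den t; rewrite /step [flat 0 (1 - t)]flatE0 ?subr_le0// addr0.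
by move=> h; rewrite divff// gt_eqF.
Qed.

End smooth_step.

(** * Supports and cut-off functions *)

Lemma open_setX (T T' : topologicalType) (A : set T) (B : set T') :
  open A -> open B -> open (A `*` B).
Proof.
move=> oA oB; rewrite (_ : A `*` B = fst @^-1` A `&` snd @^-1` B); last first.
  by apply/seteqP; split => -[x y].
by apply: openI; apply: open_comp => // p _; [exact: cvg_fst|exact: cvg_snd].
Qed.

Lemma open_forall (T : topologicalType) (I : finType) (A : I -> set T) :
  (forall i, open (A i)) -> open [set x | forall i, A i x].
Proof.
move=> oA; rewrite openE => x Ax; apply: filter_forall => i.
exact: open_nbhs_nbhs.
Qed.

Section supports.
Variables (R : realType) (X Y : normedModType R).
Implicit Types (f : X -> Y).

Lemma closed_spt f : closed (spt f).
Proof. exact: closed_closure. Qed.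

Lemma spt_sub f (C : set X) : closed C -> (forall x, f x != 0 -> C x) ->
  spt f `<=` C.
Proof.
move=> cC fC; rewrite [X in _ `<=` X](closure_id C).1//.
by apply: closureS => x; exact: fC.
Qed.

Lemma spt_neq0 f x : f x != 0 -> spt f x.
Proof. by move=> fx; exact: subset_closure. Qed.

Lemma spt_eq0 f x : ~ spt f x -> f x = 0.
Proof. by move=> nf; apply/eqP; apply: contra_notT nf; exact: spt_neq0. Qed.

Lemma compact_spt_sub f (C : set X) : compact C -> (forall x, f x != 0 -> C x) ->
  compact (spt f) /\ spt f `<=` C.
Proof.
move=> cC fC; have sC : spt f `<=` C.
  by apply: spt_sub => //; apply: compact_closed => //; exact: norm_hausdorff.
by split => //; apply: subclosed_compact sC => //; exact: closed_spt.
Qed.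

End supports.

Definition bump (R : realType) (X : normedModType R) (O W : set X) (chi : X -> R) :=
  [/\ smooth chi, forall x, 0 <= chi x <= 1, forall x, W x -> chi x = 1,
      compact (spt chi) & spt chi `<=` O].

(** The variation measure is needed both over U and over U x R. Its theory only uses smooth cut-offs
    at points, and this property passes from the line to R^n and to products. *)
Definition has_bumps (R : realType) (X : normedModType R) :=
  forall (O : set X) x, open O -> O x ->
    exists chi W, [/\ open W, W x & bump O W chi].

Section bumps.
Variable R : realType.

Lemma has_bumps_real : has_bumps R.
Proof.
move=> O x oO Ox.
have /nbhs_ballP[r /= r0 rO] : nbhs x O by exact: open_nbhs_nbhs.
(* A quadratic polynomial instead of an expression in |t - x|, hence smooth. It is at least 1 where
   |t - x| < r/2 and equals 2 - 9/4 < 0 where |t - x| = 3r/4. *)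
pose q t : R := 2 - (t - x) * (t - x) * (2 / r) ^+ 2.
have q0 t : `|t - x| >= r * (3 / 4) -> q t <= 0.
  move=> h; have h2 : (r * (3/4)) ^+ 2 <= (t - x) * (t - x).
    by rewrite -expr2 -[(t - x) ^+ 2]real_normK ?num_real// lerXn2r ?nnegrE// mulr_ge0 ?ltW.
  rewrite /q subr_le0 -ler_pdivrMr; last by rewrite exprn_gt0// divr_gt0.
  apply: le_trans h2; rewrite !expr2 invfM !invf_div; nra.
have q1 t : `|t - x| < r / 2 -> 1 <= q t.
  move=> h; have h2 : (t - x) * (t - x) <= (r / 2) ^+ 2.
    by rewrite -expr2 -[(t - x) ^+ 2]real_normK ?num_real// lerXn2r ?nnegrE ?divr_ge0// ltW.
  rewrite /q lerBrDl addrC -lerBrDl -ler_pdivlMr; last by rewrite exprn_gt0// divr_gt0.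
  apply: le_trans h2 _; rewrite -exprVn invf_div; nra.
exists (fun t => step (q t)), (ball x (r / 2)).
have hr2 : 0 < r / 2 by rewrite divr_gt0.
have [cs ss] : compact (spt (fun t => step (q t))) /\
    spt (fun t => step (q t)) `<=` `[x - r * (3/4), x + r * (3/4)].
  apply: compact_spt_sub; first exact: segment_compact.
  move=> t; apply: contra_neqP => /negP; rewrite /= in_itv /= => h.
  apply: step0; apply: q0; move: h; rewrite -ler_distlC distrC => /negP.
  by case: (leP `|t - x| (r * (3 / 4))) => // /ltW.
split; [exact: ball_open|exact: ballxx|split => //].
- apply: smooth_comp1; first exact: smooth_step.
  apply: smoothB; first exact: smooth_cst.
  apply: smoothM; last exact: smooth_cst.
  by apply: smoothM; apply: smoothB; do ?[exact: smooth_id|exact: smooth_cst].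
- by move=> t; rewrite step_ge0 step_le1.
- by move=> t; rewrite /ball /= distrC => h; apply: step1; exact: q1.
- apply: (subset_trans ss) => t; rewrite /= in_itv /= -ler_distlC => h.
  by apply: rO; rewrite /ball /=; apply: le_lt_trans h _; rewrite -[X in _ < X]mulr1 ltr_pM2l//; lra.
Qed.

Lemma has_bumps_prod (X Z : normedModType R) : has_bumps X -> has_bumps Z ->
  has_bumps (X * Z)%type.
Proof.
move=> bX bZ O [x z] oO Oxz.
have : nbhs (x, z) O by exact: open_nbhs_nbhs.
move=> [[A B] /= [+ +] AB].
rewrite nbhsE => -[A' [oA A'x] sA]; rewrite nbhsE => -[B' [oB B'z] sB].
have [chi [W [oW Wx [sc c01 c1 cc sO]]]] := bX A' x oA A'x.
have [chi' [W' [oW' Wx' [sc' c01' c1' cc' sO']]]] := bZ B' z oB B'z.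
exists (fun p => chi p.1 * chi' p.2), (W `*` W').
have [cs ss] : compact (spt (fun p => chi p.1 * chi' p.2)) /\
    spt (fun p => chi p.1 * chi' p.2) `<=` spt chi `*` spt chi'.
  apply: compact_spt_sub; first exact: compact_setX.
  by move=> [a b] /=; rewrite mulf_eq0 negb_or => /andP[h h']; split; exact: spt_neq0.
split; [exact: open_setX|by []|split => //].
- by apply: smoothM; [exact: smooth_fst|exact: smooth_snd].
- move=> [a b] /=; have /andP[h1 h2] := c01 a; have /andP[h3 h4] := c01' b.
  by rewrite mulr_ge0// mulr_ile1.
- by move=> [a b] [/= ha hb]; rewrite c1// c1'// mulr1.
- apply: (subset_trans ss) => -[a b] [/= ha hb]; apply: AB => /=.
  by split; [apply: sA; exact: sO|apply: sB; exact: sO'].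
Qed.

(** Balls of the maximum norm are products of intervals, so a product of cut-offs in the single
    coordinates is a cut-off. *)
Lemma has_bumps_row n : has_bumps 'rV[R]_n.
Proof.
move=> O x oO Ox.
have /nbhs_ballP[r /= r0 rO] : nbhs x O by exact: open_nbhs_nbhs.
have /choice[c hc] : forall i : 'I_n, exists chi, exists W : set R,
    [/\ open W, W (x 0 i) & bump (ball (x 0 i) r) W chi].
  by move=> i; apply: has_bumps_real; [exact: ball_open|exact: ballxx].
have /choice[W hW] := hc.
pose chi (y : 'rV[R]_n) := \prod_i c i (y 0 i).
exists chi, [set y : 'rV[R]_n | forall i, W i (y 0 i)].
have [cs ss] : compact (spt chi) /\
    spt chi `<=` [set v : 'rV[R]_n | forall i, spt (c i) (v ord0 i)].
  apply: compact_spt_sub.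
    apply: (@rV_compact R n (fun i => spt (c i))) => i.
    by have [_ _ []] := hW i.
  move=> v; rewrite /chi => /prodf_neq0 h i.
  by apply: spt_neq0; exact: h.
split.
- apply: (@open_forall _ _ (fun i => (fun y : 'rV[R]_n => y 0 i) @^-1` W i)) => i.
  apply: open_comp; last by have [] := hW i.
  by move=> y _; exact: coord_continuous.
- by move=> i /=; have [] := hW i.
split => //.
- apply: smooth_prod => i; apply: (@smooth_comp1 _ _ (c i)); last exact: smooth_coord.
  by have [_ _ []] := hW i.
- move=> y; rewrite /chi; elim/big_ind: _ => [|a b /andP[a0 a1] /andP[b0 b1]|i _].
  + by rewrite ler01 lexx.
  + by rewrite mulr_ge0// mulr_ile1.
  + by have [_ _ [_ ]] := hW i.
- move=> y hy; rewrite /chi big1// => i _.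
  by have [_ _ [_ _ h _ _]] := hW i; apply: h; exact: (hy i).
- apply: (subset_trans ss) => y /= hy; apply: rO.
  split=> // i j; rewrite ord1.
  by have [_ _ [_ _ _ _ h]] := hW j; apply: h.
Qed.

Lemma bump_setU (X : normedModType R) (O W W' : set X) chi chi' :
  bump O W chi -> bump O W' chi' -> exists chi2, bump O (W `|` W') chi2.
Proof.
move=> [s1 b1 e1 c1 o1] [s2 b2 e2 c2 o2].
(* This is 1 - (1 - chi)(1 - chi'): it stays in [0,1] and is 1 as soon as one factor vanishes. *)
exists (fun x => chi x + chi' x - chi x * chi' x).
have [cs ss] : compact (spt (fun x => chi x + chi' x - chi x * chi' x)) /\
    spt (fun x => chi x + chi' x - chi x * chi' x) `<=` spt chi `|` spt chi'.
  apply: compact_spt_sub; first exact: compactU.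
  move=> x; apply: contra_neqP => /not_orP[h1 h2].
  by rewrite (spt_eq0 h1) (spt_eq0 h2) mulr0 addr0 subr0.
split => //.
- by apply: smoothB; [exact: smoothD|exact: smoothM].
- move=> x; have /andP[h1 h2] := b1 x; have /andP[h3 h4] := b2 x; nra.
- move=> x [/e1 ->|/e2 ->]; first by rewrite mul1r addrK.
  by rewrite mulr1 addrC addKr.
- by apply: (subset_trans ss) => x [/o1|/o2].
Qed.

(** The cut-off is 1 on an open neighbourhood of K and not merely on K; this keeps the support, a
    closure, of (1 - chi) theta away from K. *)
Lemma bump_compact (X : normedModType R) (O K : set X) : has_bumps X ->
  open O -> compact K -> K `<=` O ->
  exists chi W, [/\ open W, K `<=` W & bump O W chi].
Proof.
move=> bX oO cK KO.
have H x : exists W : set X, [/\ open W, exists chi, bump O W chi & K x -> W x].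
  have [Kx|nKx] := pselect (K x).
    by have [chi [W [oW Wx b]]] := bX O x oO (KO _ Kx); exists W; split => //; exists chi.
  exists set0; split; [exact: open0| |by move=> /nKx].
  exists (fun=> 0).
  have [h1 h2] : compact (spt (fun _ : X => (0 : R))) /\
      spt (fun _ : X => (0 : R)) `<=` set0.
    by apply: compact_spt_sub; [exact: compact0|move=> y; rewrite eqxx].
  split => //; [exact: smooth_cst|by move=> _; rewrite lexx ler01|].
  exact: subset_trans h2 (@sub0set _ _).
have /choice[W hW] := H.
move: (cK); rewrite compact_cover => /(_ X K W).
case=> [x _|x Kx|D DK KD]; first by have [] := hW x.
  by exists x => //; have [_ _] := hW x; exact.
have {DK} : forall s : seq X, exists chi, bump O (\bigcup_(i in [set` s]) W i) chi.
  elim=> [|x s [chi IH]].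
    have [_ [chi [s1 b1 _ c1 o1]] _] := hW 0; exists chi; split => //.
    by move=> y [i].
  have [_ [chi' hx] _] := hW x.
  have [chi2 h2] := bump_setU hx IH; exists chi2.
  rewrite (_ : \bigcup_(i in _) _ = W x `|` \bigcup_(i in [set` s]) W i)//.
  by rewrite -bigcup_setU1; congr bigcup; apply/seteqP; split => y /=;
    rewrite inE => /predU1P.
move=> /(_ (finmap.enum_fset D))[chi hchi].
exists chi, (\bigcup_(i in [set` finmap.enum_fset D]) W i); split => //.
by apply: bigcup_open => i _; have [] := hW i.
Qed.

End bumps.

(** * The Euclidean norm *)

Section enorm_theory.
Variables (R : realType) (n : nat).
Implicit Types (u v w : 'rV[R]_n).

Lemma enorm0 : enorm (0 : 'rV[R]_n) = 0.
Proof. by rewrite /enorm big1 ?sqrtr0// => i _; rewrite mxE expr0n. Qed.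

Lemma enorm_sqr v : enorm v ^+ 2 = \sum_i v 0 i ^+ 2.
Proof. by rewrite sqr_sqrtr// sumr_ge0// => i _; exact: sqr_ge0. Qed.

Lemma coord_le_enorm v i : `|v 0 i| <= enorm v.
Proof.
rewrite -sqrtr_sqr ler_wsqrtr// (bigD1 i)//= lerDl sumr_ge0// => j _.
exact: sqr_ge0.
Qed.

Lemma enorm_eq0 v : enorm v = 0 -> v = 0.
Proof.
move=> v0; apply/rowP => i; rewrite mxE; apply/eqP; rewrite -normr_le0 -v0.
exact: coord_le_enorm.
Qed.

Lemma enormZ a v : enorm (a *: v) = `|a| * enorm v.
Proof.
rewrite /enorm -sqrtr_sqr -sqrtrM ?sqr_ge0// mulr_sumr; congr Num.sqrt.
by apply: eq_bigr => i _; rewrite mxE exprMn.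
Qed.

Lemma enormN v : enorm (- v) = enorm v.
Proof. by rewrite -scaleN1r enormZ normrN1 mul1r. Qed.

Lemma enormBC v w : enorm (v - w) = enorm (w - v).
Proof. by rewrite -enormN opprB. Qed.

Lemma dotprod_le v w : \sum_i v 0 i * w 0 i <= enorm v * enorm w.
Proof.
have [/enorm_eq0 ->|v0] := eqVneq (enorm v) 0.
  by rewrite enorm0 mul0r big1// => i _; rewrite mxE mul0r.
have [/enorm_eq0 ->|w0] := eqVneq (enorm w) 0.
  by rewrite enorm0 mulr0 big1// => i _; rewrite mxE mulr0.
have vp : 0 < enorm v by rewrite lt_neqAle eq_sym v0 enorm_ge0.
have wp : 0 < enorm w by rewrite lt_neqAle eq_sym w0 enorm_ge0.
set a := enorm v in v0 vp *; set b := enorm w in w0 wp *.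
(* Young's inequality in each coordinate, with weights b/a and a/b for which both sums equal
   ab/2. *)
apply: (@le_trans _ _ (\sum_i (2^-1 * (b / a) * v 0 i ^+ 2 +
    2^-1 * (a / b) * w 0 i ^+ 2))).
  apply: ler_sum => i _; rewrite -subr_ge0.
  have -> : 2^-1 * (b / a) * v 0 i ^+ 2 + 2^-1 * (a / b) * w 0 i ^+ 2
      - v 0 i * w 0 i = (2 * a * b)^-1 * (b * v 0 i - a * w 0 i) ^+ 2.
    by field; rewrite w0 v0.
  by rewrite mulr_ge0 ?sqr_ge0// invr_ge0 !mulr_ge0// ltW.
rewrite big_split /= -!mulr_sumr -!enorm_sqr -/a -/b.
by rewrite le_eqVlt; apply/orP; left; apply/eqP; field; rewrite w0 v0.
Qed.

Lemma enormD v w : enorm (v + w) <= enorm v + enorm w.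
Proof.
rewrite -(@ler_pXn2r _ 2)// ?nnegrE ?addr_ge0 ?enorm_ge0//.
rewrite sqrrD !enorm_sqr.
under eq_bigr do rewrite mxE sqrrD.
rewrite !big_split /= lerD2r lerD2l -mulr2n lerMn2r /=.
exact: dotprod_le.
Qed.

Lemma enorm_triangle u v w : enorm (v - w) <= enorm (v - u) + enorm (u - w).
Proof. by rewrite (le_trans _ (enormD _ _))// addrA subrK. Qed.

Lemma enorm_le_sum v : enorm v <= \sum_i `|v 0 i|.
Proof.
rewrite [X in enorm X](row_sum_delta v).
elim/big_ind2: _ => [|a x b y ha hb|i _]; first by rewrite enorm0.
  by apply: le_trans (enormD _ _) _; exact: lerD.
rewrite enormZ ler_piMr//.
rewrite /enorm (bigD1 i)//= big1 => [|j ji]; rewrite !mxE eqxx/=.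
  by rewrite eqxx expr1n addr0 sqrtr1.
by rewrite (negbTE ji) expr0n.
Qed.

Lemma enorm_continuous : continuous (@enorm R n).
Proof.
move=> v; apply: (@continuous_comp _ _ _ (fun v : 'rV[R]_n => \sum_i v 0 i ^+ 2)).
  apply: smooth_continuous; apply: smooth_sum => i _.
  by apply: (@smoothM _ _ (fun v : 'rV[R]_n => v 0 i)); exact: smooth_coord.
exact: sqrt_continuous.
Qed.

End enorm_theory.

(** * Test functions and linear functionals on them *)

Section test_functions.
Variables (R : realType) (X Y : normedModType R).
Implicit Types (f g : X -> Y) (Om : set X).

Lemma test_function0 Om : test_function Om (fun _ : X => (0 : Y)).
Proof.
have [h1 h2] : compact (spt (fun _ : X => (0 : Y))) /\
    spt (fun _ : X => (0 : Y)) `<=` set0.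
  by apply: compact_spt_sub; [exact: compact0|move=> y; rewrite eqxx].
by split => //; [exact: smooth_cst|apply: subset_trans h2 (@sub0set _ _)].
Qed.

Lemma test_functionD Om f g : test_function Om f -> test_function Om g ->
  test_function Om (fun x => f x + g x).
Proof.
move=> [s1 c1 o1] [s2 c2 o2].
have [cs ss] : compact (spt (fun x => f x + g x)) /\
    spt (fun x => f x + g x) `<=` spt f `|` spt g.
  apply: compact_spt_sub; first exact: compactU.
  move=> x; apply: contra_neqP => /not_orP[h1 h2].
  by rewrite (spt_eq0 h1) (spt_eq0 h2) addr0.
by split => //; [exact: smoothD|apply: (subset_trans ss) => x [/o1|/o2]].
Qed.

Lemma spt_scale (a : X -> R) f : compact (spt f) ->
  compact (spt (fun x => a x *: f x)) /\ spt (fun x => a x *: f x) `<=` spt f.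
Proof.
move=> c; apply: compact_spt_sub => // x; apply: contra_neqP => h1.
by rewrite (spt_eq0 h1) scaler0.
Qed.

Lemma test_function_scale Om (a : X -> R) f : smooth a -> test_function Om f ->
  test_function Om (fun x => a x *: f x).
Proof.
move=> sa [s1 c1 o1]; have [cs ss] := spt_scale a c1.
by split => //; [exact: smooth_scale|exact: subset_trans ss o1].
Qed.

Lemma test_functionZ Om (a : R) f : test_function Om f ->
  test_function Om (fun x => a *: f x).
Proof. by move=> tf; apply: test_function_scale => //; exact: smooth_cst. Qed.

Lemma test_functionN Om f : test_function Om f ->
  test_function Om (fun x => - f x).
Proof.
move=> /(test_functionZ (-1)); under eq_fun do rewrite scaleN1r.
exact.
Qed.

Lemma test_functionB Om f g : test_function Om f -> test_function Om g ->
  test_function Om (fun x => f x - g x).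
Proof. by move=> tf tg; apply: test_functionD => //; exact: test_functionN. Qed.

Lemma test_function_sum Om (I : Type) (r : seq I) (P : pred I) (h : I -> X -> Y) :
  (forall i, P i -> test_function Om (h i)) ->
  test_function Om (fun x => \sum_(i <- r | P i) h i x).
Proof.
move=> hs; elim: r => [|i r IH].
  by under eq_fun do rewrite big_nil; exact: test_function0.
under eq_fun do rewrite big_cons.
case: (boolP (P i)) => Pi //; apply: test_functionD => //; exact: hs.
Qed.

End test_functions.

Definition linear_on (R : realType) (X Y : normedModType R) (Om : set X)
    (S : (X -> Y) -> R) := forall (a : R) (phi psi : X -> Y),
  test_function Om phi -> test_function Om psi ->
  S (fun x => a *: phi x + psi x) = a * S phi + S psi.

Section linear_on.
Variables (R : realType) (X Y : normedModType R) (Om : set X) (S : (X -> Y) -> R).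
Hypothesis linS : linear_on Om S.

Lemma linear_on0 : S (fun=> 0) = 0.
Proof.
have := linS 1 (test_function0 Y Om) (test_function0 Y Om).
under eq_fun do rewrite scale1r addr0.
by rewrite mul1r => /eqP; rewrite -subr_eq0 opprD addrA subrr sub0r oppr_eq0 => /eqP.
Qed.

Lemma linear_onD f g : test_function Om f -> test_function Om g ->
  S (fun x => f x + g x) = S f + S g.
Proof.
by move=> tf tg; have := linS 1 tf tg; under eq_fun do rewrite scale1r; rewrite mul1r.
Qed.

Lemma linear_onZ a f : test_function Om f -> S (fun x => a *: f x) = a * S f.
Proof.
move=> tf; have := linS a tf (test_function0 Y Om).
by under eq_fun do rewrite addr0; rewrite linear_on0 addr0.
Qed.

Lemma linear_onN f : test_function Om f -> S (fun x => - f x) = - S f.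
Proof.
move=> tf; have := linear_onZ (-1) tf.
by under eq_fun do rewrite scaleN1r; rewrite mulN1r.
Qed.

Lemma linear_onB f g : test_function Om f -> test_function Om g ->
  S (fun x => f x - g x) = S f - S g.
Proof.
move=> tf tg; rewrite linear_onD//; last exact: test_functionN.
by rewrite linear_onN.
Qed.

Lemma linear_on_sum (I : Type) (r : seq I) (P : pred I) (h : I -> X -> Y) :
  (forall i, P i -> test_function Om (h i)) ->
  S (fun x => \sum_(i <- r | P i) h i x) = \sum_(i <- r | P i) S (h i).
Proof.
move=> hs; elim: r => [|i r IH].
  by under eq_fun do rewrite big_nil; rewrite big_nil linear_on0.
under eq_fun do rewrite big_cons; rewrite big_cons.
case: (boolP (P i)) => Pi //; rewrite linear_onD ?IH//; first exact: hs.
exact: test_function_sum.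
Qed.

End linear_on.

Section borel_sets.
Variables (T : topologicalType).
Implicit Types A B : set T.

Lemma borel_open A : open A -> borel A.
Proof. by move=> oA; exact: sub_sigma_algebra. Qed.

Lemma borelC A : borel A -> borel (~` A).
Proof.
have [_ bC _] := @smallest_sigma_algebra T setT (@open T).
by move=> bA; rewrite -setTD; exact: bC.
Qed.

Lemma borel_bigcup (F : nat -> set T) : (forall k, borel (F k)) ->
  borel (\bigcup_k F k).
Proof.
have [_ _ bU] := @smallest_sigma_algebra T setT (@open T).
exact: bU.
Qed.

Lemma borelU A B : borel A -> borel B -> borel (A `|` B).
Proof.
move=> bA bB; rewrite -bigcup2E; apply: borel_bigcup => -[|[|k]] //=.
by apply: borel_open; exact: open0.
Qed.

End borel_sets.

(** * The variation measure *)

Section variation_theory.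
Variables (R : realType) (X : normedModType R) (n : nat) (Om : set X).
Variable S : (X -> 'rV[R]_n) -> R.
Hypotheses (bX : has_bumps X) (oOm : open Om) (linS : linear_on Om S).
Implicit Types (G H : set X) (theta : X -> 'rV[R]_n).
Local Open Scope ereal_scope.

Definition unit_field G : set (X -> 'rV[R]_n) := [set theta |
  [/\ test_function Om theta, spt theta `<=` G &
      forall x, (enorm (theta x) <= 1)%R]].

Definition osup G : \bar R := ereal_sup [set (S theta)%:E | theta in unit_field G].

Lemma osup_ub G theta : unit_field G theta -> (S theta)%:E <= osup G.
Proof. by move=> h; apply: ereal_sup_ubound; exists theta. Qed.

Lemma unit_field0 G : unit_field G (fun=> 0%R).
Proof.
split; [exact: test_function0| |by move=> x; rewrite enorm0].
by move=> x; rewrite /spt (_ : [set _ | _] = set0) ?closure0//;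
  apply/seteqP; split => // y /=; rewrite eqxx.
Qed.

Lemma osup_ge0 G : 0 <= osup G.
Proof. by have := osup_ub (unit_field0 G); rewrite (linear_on0 linS). Qed.

Lemma le_osup G H : G `&` Om `<=` H -> osup G <= osup H.
Proof.
move=> GH; apply: ge_ereal_sup => _ [theta [tt tG t1] <-]; apply: osup_ub.
by split => //; have [_ _ tO] := tt => x /[dup] /tG Gx /tO Ox; exact: GH.
Qed.

Lemma osup0 : osup set0 = 0.
Proof.
apply/eqP; rewrite eq_le osup_ge0 andbT; apply: ge_ereal_sup => _ [theta [tt tG t1] <-].
have -> : theta = (fun _ : X => (0%R : 'rV[R]_n)); last by rewrite (linear_on0 linS).
by apply: funext => x; apply: (@spt_eq0 _ _ _ theta) => /tG.
Qed.

Lemma spt_remainder (chi : X -> R) (W : set X) theta : open W ->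
  (forall x, W x -> chi x = 1%R) ->
  spt (fun x => (1 - chi x) *: theta x)%R `<=` spt theta `&` ~` W.
Proof.
move=> oW c1; apply: spt_sub.
  by apply: closedI; [exact: closed_spt|exact: open_closedC].
move=> x; apply: contra_neqP => /not_andP[h|/contrapT/c1 ->].
  by rewrite (spt_eq0 h) scaler0.
by rewrite subrr scale0r.
Qed.

Lemma smooth_onem (chi : X -> R) : smooth chi -> smooth (fun x => 1 - chi x)%R.
Proof. by move=> s; apply: smoothB => //; exact: smooth_cst. Qed.

Lemma onem_scale (a : R) (v : 'rV[R]_n) : (a *: v + (1 - a) *: v = v)%R.
Proof. by rewrite -scalerDl addrC subrK scale1r. Qed.

Lemma enorm_scale_le1 (a : R) (v : 'rV[R]_n) (b : R) :
  (0 <= a <= 1)%R -> (enorm v <= b)%R -> (enorm (a *: v) <= b)%R.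
Proof.
move=> /andP[a0 a1] v1; rewrite enormZ ger0_norm//.
apply: le_trans v1; exact: ler_piMl (enorm_ge0 _) a1.
Qed.

(** The part of spt theta outside the last set is compact in the union of the others. With chi equal
    to 1 near that part, chi theta lives in the union of the others and (1 - chi) theta in the last
    set. *)
Lemma osupU_fin (G : nat -> set X) theta N : (forall k, open (G k)) ->
  unit_field (\bigcup_(k < N) G k) theta ->
  (S theta)%:E <= \sum_(k < N) osup (G k).
Proof.
move=> oG; elim: N theta => [|N IH] theta uf.
  by rewrite big_ord0 -osup0; apply: osup_ub; rewrite bigcup_mkord big_ord0 in uf.
have [tt tG t1] := uf; have [st ct tO] := tt.
have oGN : open (\bigcup_(k < N) G k) by apply: bigcup_open.
have cK : compact (spt theta `&` ~` G N).
  by apply: compact_closedI => //; exact: open_closedC.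
have KG : spt theta `&` ~` G N `<=` \bigcup_(k < N) G k.
  move=> x [/tG[k /= kN Gk] nGN]; exists k => //=.
  by move: kN; rewrite ltnS leq_eqVlt => /orP[/eqP kN|//]; rewrite kN in Gk.
have [chi [W [oW KW [sc c01 c1 cc sO]]]] := bump_compact bX oGN cK KG.
have t1' : test_function Om (fun x => chi x *: theta x)%R.
  exact: test_function_scale.
have t2' : test_function Om (fun x => (1 - chi x) *: theta x)%R.
  by apply: test_function_scale => //; exact: smooth_onem.
rewrite (_ : theta = fun x => chi x *: theta x + (1 - chi x) *: theta x)%R; last first.
  by apply/funext => x; rewrite onem_scale.
rewrite (linear_onD linS)// EFinD big_ord_recr /=; apply: leeD.
  apply: IH; split => //.
    apply: subset_trans sO; apply: spt_sub; first exact: closed_spt.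
    by move=> x; apply: contra_neqP => h; rewrite (spt_eq0 h) scale0r.
  by move=> x; exact: enorm_scale_le1.
apply: osup_ub; split => //.
  apply: (subset_trans (spt_remainder oW c1)) => x [tx nWx].
  by apply: contrapT => nG; apply: nWx; apply: KW.
move=> x; apply: enorm_scale_le1 => //.
by have /andP[h1 h2] := c01 x; rewrite subr_ge0 h2 lerBlDr lerDl.
Qed.

Lemma compact_bigcup_nat (K : set X) (G : nat -> set X) : compact K ->
  (forall k, open (G k)) -> K `<=` \bigcup_k G k ->
  exists N, K `<=` \bigcup_(k < N) G k.
Proof.
move=> cK oG KG; move: cK; rewrite compact_cover => /(_ nat setT G).
case=> // D _ KD.
exists (\max_(i <- finmap.enum_fset D) i).+1 => x /KD[k /= kD Gk].
by exists k => //=; rewrite ltnS; apply: leq_bigmax_seq.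
Qed.

Lemma osupU (G : nat -> set X) : (forall k, open (G k)) ->
  osup (\bigcup_k G k) <= \sum_(k <oo) osup (G k).
Proof.
move=> oG; apply: ge_ereal_sup => _ [theta [tt tG t1] <-].
have [st ct tO] := tt.
have [N hN] := compact_bigcup_nat ct oG tG.
apply: le_trans (osupU_fin oG (theta := theta) (N := N) _) _; first by split.
rewrite -(big_mkord xpredT (fun k => osup (G k))).
by apply: nneseries_lim_ge => k _ _; exact: osup_ge0.
Qed.

(** Only the part of A inside [Om] has to be covered, which makes the complement of [Om] null, and
    the covering sets are open in the whole space. *)
Definition var (A : set X) : \bar R :=
  ereal_inf [set osup G | G in [set G | open G /\ A `&` Om `<=` G]].

Lemma var_le A G : open G -> A `&` Om `<=` G -> var A <= osup G.
Proof. by move=> oG AG; apply: ereal_inf_lbound; exists G. Qed.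

Lemma var_open G : open G -> var G = osup G.
Proof.
move=> oG; apply/eqP; rewrite eq_le; apply/andP; split.
  by apply: var_le => // x [].
by apply: le_ereal_inf_tmp => _ [H [oH GH] <-]; exact: le_osup.
Qed.

Lemma var_ge0 A : 0 <= var A.
Proof. by apply: le_ereal_inf_tmp => _ [G _ <-]; exact: osup_ge0. Qed.

Lemma var0 : var set0 = 0.
Proof. by rewrite var_open ?osup0//; exact: open0. Qed.

Lemma le_var : {homo var : A B / A `<=` B >-> A <= B}.
Proof.
move=> A B AB; apply/ereal_inf_le_tmp => x [G [oG BG] <-{x}].
by exists G => //; split => //; apply: subset_trans BG; exact: setSI.
Qed.

Lemma var_sigma_subadditive : sigma_subadditive var.
Proof.
move=> A; have [[i ioo]|] := pselect (exists i, var (A i) = +oo).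
  rewrite (eseries_pinfty _ _ ioo) ?leey// => k _.
  by rewrite -ltNye (lt_le_trans _ (var_ge0 _)).
rewrite -forallNE => Aoo.
apply/lee_addgt0Pr => e e0.
rewrite (le_trans _ (epsilon_trick _ _ (ltW e0)))//; last first.
  by move=> *; exact: var_ge0.
have H k : exists G, [/\ open G, A k `&` Om `<=` G &
    osup G <= var (A k) + (e / (2 ^ k.+1)%:R)%:E].
  have fin : var (A k) \is a fin_num by rewrite ge0_fin_numE ?var_ge0// ltey; apply/eqP.
  have ek : (0 < e / (2 ^ k.+1)%:R)%R by rewrite divr_gt0// ltr0n expn_gt0.
  have [_ [G [oG AG] <-]] := lb_ereal_inf_adherent ek fin.
  by move=> /ltW h; exists G.
have /choice[G hG] := H.
apply: (@le_trans _ _ (osup (\bigcup_k G k))).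
  apply: var_le; first by apply: bigcup_open => k _; have [] := hG k.
  by move=> x [[k _ Ak] Ox]; exists k => //; have [_ + _] := hG k; apply.
apply: le_trans (osupU _) _; first by move=> k; have [] := hG k.
apply: lee_nneseries => k *; first exact: osup_ge0.
by have [] := hG k.
Qed.

Definition var_outer : {outer_measure set X -> \bar R} :=
  HB.pack var (isOuterMeasure.Build R X var var0 var_ge0 le_var var_sigma_subadditive).

(** Let W be open and contain A inside [Om]. If theta is nearly optimal in W \cap G, then W \ spt
    theta is open and contains A \ G. A field psi supported there never meets theta, so theta + psi
    still has norm at most 1 and competes for W. *)
Lemma var_caratheodory_open G : open G -> var_outer.-caratheodory G.
Proof.
move=> oG; apply: le_caratheodory_measurable => A.
change (var (A `&` G) + var (A `&` ~` G) <= var A).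
apply: le_ereal_inf_tmp => _ [W [oW AW] <-].
have [->|Woo] := eqVneq (osup W) +oo; first exact: leey.
have fW : osup W \is a fin_num by rewrite ge0_fin_numE ?osup_ge0// ltey.
have mono B : B `&` Om `<=` W -> var B \is a fin_num.
  move=> BW; rewrite ge0_fin_numE ?var_ge0//; apply: le_lt_trans (var_le oW BW) _.
  by rewrite ltey.
rewrite -leeBrDr; last by apply: mono => x [[Ax _] Ox]; exact: AW.
apply: (@le_trans _ _ (osup (W `&` G))).
  by apply: var_le; [exact: openI|move=> x [[Ax Gx] Ox]; split => //; exact: AW].
apply: ge_ereal_sup => _ [theta [tt tG t1] <-].
rewrite leeBrDr; last by apply: mono => x [[Ax _] Ox]; exact: AW.
have oH : open (W `&` ~` spt theta).
  by apply: openI => //; apply: closed_openC; exact: closed_spt.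
apply: (@le_trans _ _ ((S theta)%:E + osup (W `&` ~` spt theta))).
  rewrite leeD2l//; apply: var_le => // x [[Ax nGx] Ox]; split; first exact: AW.
  by move=> /tG[].
rewrite -leeBrDl//; apply: ge_ereal_sup => _ [psi [pt pG p1] <-].
rewrite leeBrDl// -EFinD -(linear_onD linS)//; apply: osup_ub.
have disj x : theta x = 0%R \/ psi x = 0%R.
  have [px|/spt_eq0 ->] := pselect (spt psi x); last by right.
  by left; apply: spt_eq0; have [] := pG _ px.
split; first exact: test_functionD.
  have -> : W = closure (spt theta `|` spt psi) `|` W.
    apply/seteqP; split => x; first by right.
    move=> [|//]; rewrite closureU -!(closure_id _).1; try exact: closed_spt.
    by move=> [/tG[]|/pG[]].
  move=> x h; left; apply: closureS h => y /=.
  case: (disj y) => ->; rewrite ?add0r ?addr0 => h; [right|left]; exact: spt_neq0.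
by move=> x; case: (disj x) => ->; rewrite ?add0r ?addr0.
Qed.

Lemma var_measurable_borel B : borel B -> var_outer.-caratheodory B.
Proof.
move=> bB; apply: (bB [set A | var_outer.-caratheodory A]); split.
  split => [|A hA|A hA].
  - exact: caratheodory_measurable_set0.
  - by rewrite setTD; exact: caratheodory_measurable_setC.
  - exact: caratheodory_measurable_bigcup.
exact: var_caratheodory_open.
Qed.

Lemma var_measure_over : var (~` Om) = 0.
Proof.
apply/eqP; rewrite eq_le var_ge0 andbT -osup0; apply: var_le; first exact: open0.
by move=> x [].
Qed.

Lemma var_hull A : exists B, [/\ borel B, A `<=` B & var B = var A].
Proof.
have [Aoo|Aoo] := eqVneq (var A) +oo.
  exists setT; split => //; first by apply: borel_open; exact: openT.
  by apply/eqP; rewrite eq_le {1}Aoo leey le_var.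
have fA : var A \is a fin_num by rewrite ge0_fin_numE ?var_ge0// ltey.
have H k : exists G, [/\ open G, A `&` Om `<=` G & osup G <= var A + (k.+1%:R^-1)%:E].
  have k0 : (0 < k.+1%:R^-1 :> R)%R by rewrite invr_gt0.
  have [_ [G [oG AG] <-]] := lb_ereal_inf_adherent k0 fA.
  by move=> /ltW h; exists G.
have /choice[G hG] := H.
(* The complement of [Om] is added because the sets [G k] cover A only inside [Om]; it is null, so
   the measure does not change. *)
pose B := \bigcap_k (G k `|` ~` Om).
exists B; split.
- rewrite -[B]setCK setC_bigcap; apply: borelC; apply: borel_bigcup => k.
  apply: borelC; apply: borelU; first by apply: borel_open; have [] := hG k.
  by apply: borelC; exact: borel_open.
- move=> x Ax k _; have [Ox|] := pselect (Om x); last by right.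
  by left; have [_ + _] := hG k; apply.
- apply/eqP; rewrite eq_le; apply/andP; split; last first.
    apply: le_var => x Ax k _; have [Ox|] := pselect (Om x); last by right.
    by left; have [_ + _] := hG k; apply.
  apply/lee_addgt0Pr => e e0.
  have [k hk] : exists k, (k.+1%:R^-1 <= e)%R.
    by have [k] := ltr_add_invr e0; rewrite add0r => /ltW hk; exists k.
  apply: (@le_trans _ _ (osup (G k))).
    apply: var_le; first by have [] := hG k.
    by move=> x [/(_ k I)[]].
  have [_ _ /le_trans] := hG k; apply.
  by rewrite leeD2l// lee_fin.
Qed.

(** Maximality: every candidate agrees with [osup] on the open subsets of [Om] and is monotone, so
    it is bounded by the infimum over open coverings. *)
Lemma var_is_variation : is_variation Om S var_outer.
Proof.
split; first split.
- exact: var_measure_over.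
- split; [exact: var_measurable_borel|exact: var_hull].
- by move=> G oG _; exact: var_open.
move=> nu [nO _ nG] A; apply: (@le_trans _ _ (nu (A `&` Om))).
  rewrite -[leLHS](_ : nu ((A `&` Om) `|` (A `&` ~` Om)) = _); last first.
    by rewrite -setIUr setUv setIT.
  apply: le_trans (outer_measureU2 _ _ _) _.
  rewrite -[leRHS]adde0 leeD2l// -nO; apply: le_outer_measure.
  exact: subIsetr.
apply: le_ereal_inf_tmp => _ [G [oG AG] <-].
apply: (@le_trans _ _ (nu (G `&` Om))).
  by apply: le_outer_measure => x [Ax Ox]; split => //; exact: AG.
rewrite nG; [|exact: openI|by move=> x []].
by apply: le_osup => x [[]].
Qed.

(** Two largest candidates bound each other, so the arbitrary choice in the definition has only one
    outcome. *)
Lemma variation_measureE A : variation_measure Om S A = var A.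
Proof.
rewrite /variation_measure; case: pselect => [h|nh]; last first.
  by exfalso; apply: nh; exists var_outer; exact: var_is_variation.
case: (cid h) => mu /= [mc mmax]; have [vc vmax] := var_is_variation.
by apply/eqP; rewrite eq_le (vmax _ mc) (mmax _ vc).
Qed.

End variation_theory.

(** * Caratheodory measurability and Radon measures *)

Section omeasurable_theory.
Variables (R : realType) (X : pointedType) (mu : {outer_measure set X -> \bar R}).
Implicit Types (A B : set X).

Lemma cara_null A : mu A = 0%E -> mu.-caratheodory A.
Proof.
move=> A0; apply: le_caratheodory_measurable => B.
have -> : mu (B `&` A) = 0%E.
  by apply/eqP; rewrite eq_le outer_measure_ge0 andbT -A0 le_outer_measure//; exact: subIsetr.
by rewrite add0e le_outer_measure//; exact: subIsetl.
Qed.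

Lemma omeasurable_comp (Y Z : topologicalType) (D : set X) (f : X -> Y) (h : Y -> Z) :
  continuous h -> omeasurable mu D f -> omeasurable mu D (fun x => h (f x)).
Proof.
move=> ch mf G oG; rewrite (_ : _ @^-1` G = f @^-1` (h @^-1` G))//; apply: mf.
by apply: open_comp => // y _; exact: ch.
Qed.

Lemma omeasurable_dom (Y : topologicalType) (D : set X) (f : X -> Y) :
  omeasurable mu D f -> mu.-caratheodory D.
Proof. by move=> /(_ setT openT); rewrite preimage_setT setIT. Qed.

Lemma omeasurable_measurable (D : set X) (f : X -> R) : omeasurable mu D f ->
  measurable_fun (D : set (caratheodory_type mu)) (f : caratheodory_type mu -> R).
Proof.
move=> mf; have mD := omeasurable_dom mf.
move=> _; apply: (measurability _ (RGenOInfty.measurableE R)) => //.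
by move=> _ /= [_ [r ->] <-]; apply: mf; exact: interval_open.
Qed.

Lemma omeasurable_emeasurable (D : set X) (f : X -> \bar R) : omeasurable mu D f ->
  measurable_fun (D : set (caratheodory_type mu)) (f : caratheodory_type mu -> \bar R).
Proof.
move=> mf; have mD := omeasurable_dom mf.
move=> _; apply: (measurability _ (ErealGenOInfty.measurableE R)) => //.
move=> _ /= [_ [r ->] <-].
have -> : `]r%:E, +oo[%classic = [set x | r%:E < x]%E by rewrite set_itvoy.
apply: mf.
exact: open_ereal_gt_ereal.
Qed.

Lemma open_emeasurable (G : set \bar R) : open G -> measurable G.
Proof.
move=> oG.
have -> : G = EFin @` (EFin @^-1` G) `|` ((G `&` [set +oo%E]) `|` (G `&` [set -oo%E])).
  apply/seteqP; split => [[r| |] Gx|x].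
  - by left; exists r.
  - by right; left.
  - by right; right.
  - by move=> [[r Gr <-//]|[[]|[]]].
have ms (x : \bar R) : measurable (G `&` [set x]).
  have [Gx|nGx] := pselect (G x).
    rewrite (_ : G `&` _ = [set x]); first exact: emeasurable_set1.
    by apply/seteqP; split => [y []|y ->].
  rewrite (_ : G `&` _ = set0)//; apply/seteqP; split => [y [Gy yx]|//].
  by rewrite yx in Gy.
apply: measurableU; last exact: measurableU.
apply: measurable_image_EFin; apply: open_measurable.
by apply: open_comp => // x _ A nA; exact: nA.
Qed.

Lemma emeasurable_omeasurable (D : set X) (f : X -> \bar R) : mu.-caratheodory D ->
  measurable_fun (D : set (caratheodory_type mu)) (f : caratheodory_type mu -> \bar R) -> omeasurable mu D f.
Proof. by move=> mD mf G oG; apply: mf => //; exact: open_emeasurable. Qed.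

Lemma cara_complete : measure_is_complete (cara mu).
Proof. exact: measure_is_complete_caratheodory. Qed.

End omeasurable_theory.

Section radon_theory.
Variables (R : realType) (X : normedModType R) (Om : set X).
Variable mu : {outer_measure set X -> \bar R}.
Implicit Types (A B G : set X).
Local Open Scope ereal_scope.

Lemma measure_over_setI A : measure_over Om mu -> mu (A `&` Om) = mu A.
Proof.
move=> h; apply/eqP; rewrite eq_le le_outer_measure/=; last exact: subIsetl.
rewrite -[leLHS](_ : mu ((A `&` Om) `|` (A `&` ~` Om)) = _); last first.
  by rewrite -setIUr setUv setIT.
apply: le_trans (outer_measureU2 _ _ _) _.
by rewrite -[leRHS]adde0 leeD2l// -h; apply: le_outer_measure; exact: subIsetr.
Qed.

Hypothesis rmu : radon Om mu.

Lemma radon_setI A : mu (A `&` Om) = mu A.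
Proof. by case: rmu => h *; exact: measure_over_setI. Qed.

Lemma radon_open_cara G : open G -> mu.-caratheodory G.
Proof.
move=> oG; rewrite (_ : G = (G `&` Om) `|` (G `&` ~` Om)); last first.
  by rewrite -setIUr setUv setIT.
apply: caratheodory_measurable_setU; first by case: rmu => _ _ + _ _; exact.
apply: cara_null; apply/eqP; rewrite eq_le outer_measure_ge0 andbT.
by case: rmu => <- _ _ _ _; apply: le_outer_measure; exact: subIsetr.
Qed.

Lemma radon_closed_cara A : closed A -> mu.-caratheodory A.
Proof.
move=> cA; rewrite -[A]setCK; apply: caratheodory_measurable_setC.
by apply: radon_open_cara; exact: closed_openC.
Qed.

Lemma radon_dom_cara : mu.-caratheodory Om.
Proof. by rewrite -[Om]setTI; case: rmu => _ _ + _ _; apply; exact: openT. Qed.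

Lemma radon_outer A (e : R) : (0 < e)%R -> mu A < +oo ->
  exists G, [/\ open G, A `&` Om `<=` G & mu G <= mu A + e%:E].
Proof.
move=> e0 Aoo; case: rmu => _ _ _ _ /(_ (A `&` Om) (@subIsetr _ _ _)).
rewrite radon_setI => h.
have fA : mu A \is a fin_num by rewrite ge0_fin_numE// outer_measure_ge0.
rewrite h in fA; have [_ [G [oG AG] <-]] := lb_ereal_inf_adherent e0 fA.
by rewrite -h radon_setI => /ltW ?; exists G.
Qed.

Lemma radon_inner G (e : R) : (0 < e)%R -> open G -> mu G < +oo ->
  exists K, [/\ compact K, K `<=` G `&` Om & mu G <= mu K + e%:E].
Proof.
move=> e0 oG Goo; case: rmu => _ _ _ /(_ G oG) h _.
rewrite radon_setI in h.
have fG : mu G \is a fin_num by rewrite ge0_fin_numE// outer_measure_ge0.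
rewrite h in fG; have [_ [K [cK KG] <-]] := ub_ereal_sup_adherent e0 fG.
rewrite -h => /ltW hK; exists K; split => //.
by rewrite -leeBlDr.
Qed.

Lemma radon_continuous (Y : topologicalType) (f : X -> Y) : continuous f ->
  omeasurable mu setT f.
Proof.
move=> cf G oG; rewrite setTI; apply: radon_open_cara.
by apply: open_comp => // x _; exact: cf.
Qed.

Lemma radon_compact_lty K : compact K -> K `<=` Om -> mu K < +oo.
Proof. by case: rmu => _ h _ _ _; exact: h. Qed.

End radon_theory.

Lemma smooth_coord_comp (R : realType) (X : normedModType R) n
    (f : X -> 'rV[R]_n) i : smooth f -> smooth (fun x => f x 0 i).
Proof.
move=> /csmoothP cf; apply/csmoothP => k; move: (cf k) => {cf}.
pose c (v : 'rV[R]_n) : R := v 0 i.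
have dc v : differentiable c v by exact: differentiable_coord.
elim: k f => [|k IH] f cf; split => //;
  do ?[by move=> x; apply: (@differentiable_comp _ _ _ _ f c) => //; exact: csmooth_diff cf].
move=> v; rewrite (_ : 'D_v _ = fun x => 'D_v f x 0 i).
  by apply: IH; exact: csmooth_derive.
apply/funext => x; have df := csmooth_diff x cf.
rewrite !deriveE //; last by apply: (@differentiable_comp _ _ _ _ f c).
have -> : 'd (fun x0 => f x0 0 i) x = 'd (c \o f) x :> (X -> R) by [].
rewrite (diff_comp df (dc (f x))) [LHS]/= -(deriveE _ (dc (f x))).
exact: derive_coord.
Qed.

Lemma smooth_enorm_sqr (R : realType) (X : normedModType R) n (f : X -> 'rV[R]_n) :
  smooth f -> smooth (fun x => enorm (f x) ^+ 2).
Proof.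
move=> sf; rewrite (_ : (fun _ => _) = fun x => \sum_i f x 0 i * f x 0 i); last first.
  by apply/funext => x; rewrite enorm_sqr; apply: eq_bigr => i _; rewrite expr2.
by apply: smooth_sum => i _; apply: smoothM; exact: smooth_coord_comp.
Qed.

(** * Estimates of a functional by its variation *)

Section variation_bound.
Variables (R : realType) (X : normedModType R) (n : nat) (Om : set X).
Variable S : (X -> 'rV[R]_n) -> R.
Hypotheses (bX : has_bumps X) (oOm : open Om) (linS : linear_on Om S).
Local Notation mu := (variation_measure Om S).
Implicit Types (G H : set X) (theta : X -> 'rV[R]_n).
Local Open Scope ereal_scope.

Lemma variation_fun : (mu : set X -> \bar R) = var Om S.
Proof. by apply/funext => A; exact: variation_measureE. Qed.

Lemma variation_open G : open G -> mu G = osup Om S G.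
Proof. by move=> oG; rewrite variation_measureE// var_open. Qed.

(** Outer regularity is built into [var]. Inner regularity of an open set holds because S(theta) is
    at most the measure of the compact set spt theta when |theta| <= 1. *)
Lemma variation_radon : (forall K, compact K -> K `<=` Om -> mu K < +oo) ->
  radon Om mu.
Proof.
have mo : measure_over Om mu by rewrite /measure_over variation_fun; exact: var_measure_over.
move=> fK; split => //.
- move=> G oG; rewrite variation_fun; have oGO : open (G `&` Om) by exact: openI.
  exact: (var_caratheodory_open bX linS oGO).
- move=> G oG; have oGO : open (G `&` Om) by exact: openI.
  apply/eqP; rewrite eq_le; apply/andP; split; last first.
    by apply: ge_ereal_sup => _ [K [cK KG] <-]; exact: le_outer_measure.
  rewrite variation_open//; apply: ge_ereal_sup => _ [theta [tt tG t1] <-].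
  apply: (@le_trans _ _ (mu (spt theta))).
    rewrite variation_measureE//; apply: le_ereal_inf_tmp => _ [H [oH tH] <-].
    apply: osup_ub; split => //; have [_ _ tO] := tt => x tx.
    by apply: tH; split => //; exact: tO.
  by apply: ereal_sup_ubound; exists (spt theta) => //; split => //; case: tt.
- move=> A AO; rewrite variation_measureE//; congr ereal_inf; apply/seteqP; split => x.
    move=> [G [oG AG] <-]; exists (G `|` (A `\` Om)).
      split; last first.
        by move=> y Ay; left; apply: AG; split => //; exact: AO.
      rewrite (_ : A `\` Om = set0) ?setU0//.
      by apply/seteqP; split => // y [/AO].
    rewrite (_ : A `\` Om = set0) ?setU0; last by apply/seteqP; split => // y [/AO].
    by rewrite measure_over_setI// variation_open.
  move=> [G [oG AG] <-]; exists G; first by split => //; move=> y [/AG].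
  by rewrite measure_over_setI// variation_open.
Qed.

Lemma variation_sup_bound theta (M : R) : (0 <= M)%R -> test_function Om theta ->
  (forall x, enorm (theta x) <= M)%R -> (S theta)%:E <= M%:E * mu (spt theta).
Proof.
move=> M0 tt tM; have [Mz|Mn0] := eqVneq M 0%R.
  have -> : theta = (fun _ : X => (0%R : 'rV[R]_n)).
    apply: funext => x; apply: enorm_eq0; apply/eqP; rewrite eq_le enorm_ge0 andbT.
    by have := tM x; rewrite Mz.
  by rewrite (linear_on0 linS) Mz mul0e.
have Mp : (0 < M)%R by rewrite lt_neqAle eq_sym Mn0.
rewrite -lee_pdivrMl//; rewrite variation_measureE//.
apply: le_ereal_inf_tmp => _ [H [oH tH] <-].
rewrite -EFinM -(linear_onZ linS)//; apply: osup_ub; split.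
- exact: test_functionZ.
- have [_ ct tO] := tt; have [_ ss] := spt_scale (fun=> M^-1%R) ct.
  by move=> x /ss tx; apply: tH; split => //; exact: tO.
- by move=> x; rewrite enormZ ger0_norm ?invr_ge0// ler_pdivrMl// mulr1.
Qed.

(* A cut-off removes the top dyadic level of |theta| at each step. *)
Lemma variation_levels (e : R) j theta : (0 < e)%R -> test_function Om theta ->
  (forall x, enorm (theta x) <= e * 2 ^+ j)%R ->
  (S theta)%:E <= \sum_(i < j) (e * 2 ^+ i.+1)%:E *
      mu [set x | e * 2 ^+ i.+1 / 4 <= enorm (theta x)]%R + e%:E * mu (spt theta).
Proof.
move=> e0; elim: j theta => [|j IH] theta tt tM.
  rewrite big_ord0 add0e; apply: variation_sup_bound => //; first exact: ltW.
  by move=> x; have := tM x; rewrite expr0 mulr1.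
have [st ct tO] := tt.
pose M : R := (e * 2 ^+ j.+1)%R.
have M0 : (0 < M)%R by rewrite mulr_gt0// exprn_gt0.
(* Built from |theta|^2, since |theta| is not smooth at its zeros. It is 0 where |theta| = M/4 and 1
   where |theta| = M/2, so that a theta lives where |theta| >= M/4 and (1 - a) theta is bounded by
   M/2. *)
pose u (x : X) : R := (((4 / M) ^+ 2 * enorm (theta x) ^+ 2 - 1) / 3)%R.
have su : smooth u.
  apply: smoothM; last exact: smooth_cst.
  apply: smoothB; last exact: smooth_cst.
  by apply: smoothM; [exact: smooth_cst|exact: smooth_enorm_sqr].
pose a (x : X) : R := step (u x).
have sa : smooth a by apply: smooth_comp1 => //; exact: smooth_step.
have a0 x : (enorm (theta x) <= M / 4 -> a x = 0)%R.
  move=> h; apply: step0; rewrite /u pmulr_lle0 ?invr_gt0// subr_le0 -exprMn.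
  rewrite exprn_ile1//; first by rewrite mulr_ge0 ?enorm_ge0// divr_ge0// ltW.
  by rewrite mulrC -ler_pdivlMr ?divr_gt0// mul1r invf_div.
have a1 x : (M / 2 <= enorm (theta x) -> a x = 1)%R.
  move=> h; apply: step1; rewrite /u ler_pdivlMr// mul1r lerBrDr -exprMn.
  have h2 : (2 <= 4 / M * enorm (theta x))%R.
    by rewrite mulrAC ler_pdivlMr//; move: h; rewrite ler_pdivrMr//; lra.
  have : (2 ^+ 2 <= (4 / M * enorm (theta x)) ^+ 2)%R by rewrite lerXn2r// nnegrE; lra.
  by rewrite expr2; lra.
have a01 x : (0 <= a x <= 1)%R by rewrite step_ge0 step_le1.
have b01 x : (0 <= 1 - a x <= 1)%R.
  by have /andP[h1 h2] := a01 x; rewrite subr_ge0 h2 lerBlDr lerDl.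
have t1 : test_function Om (fun x => a x *: theta x)%R by exact: test_function_scale.
have sb : smooth (fun x => 1 - a x)%R by exact: smooth_onem.
have t2 : test_function Om (fun x => (1 - a x) *: theta x)%R.
  exact: test_function_scale.
rewrite (_ : S theta = S (fun x => a x *: theta x)%R + S (fun x => (1 - a x) *: theta x)%R)%R;
  last first.
  rewrite -(linear_onD linS)//; congr S; apply: funext => x.
  by rewrite onem_scale.
have le2 x : (enorm ((1 - a x) *: theta x) <= enorm (theta x))%R.
  exact: enorm_scale_le1.
rewrite big_ord_recr /= addeAC EFinD addeC; apply: leeD.
  apply: le_trans (IH _ t2 _) _.
    move=> x; have [h|h] := lerP (M / 2) (enorm (theta x)).
      by rewrite a1// subrr scale0r enorm0 mulr_ge0 ?exprn_ge0// ltW.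
    apply: le_trans (le2 x) _; apply: le_trans (ltW h) _.
    by rewrite /M exprSr mulrA mulfK.
  apply: leeD.
    apply: lee_sum => i _; apply: lee_wpmul2l.
      by rewrite lee_fin mulr_ge0 ?exprn_ge0// ltW.
    by apply: le_outer_measure => x /= h; exact: le_trans h (le2 x).
  apply: lee_wpmul2l; first by rewrite lee_fin ltW.
  by apply: le_outer_measure; have [] := spt_scale (fun x => 1 - a x)%R ct.
apply: le_trans (variation_sup_bound _ t1 (M := M) _) _; first exact: ltW.
  by move=> x; exact: enorm_scale_le1.
apply: lee_wpmul2l; first by rewrite lee_fin ltW.
apply: le_outer_measure; apply: spt_sub.
  rewrite (_ : mkset _ = (fun x => enorm (theta x)) @^-1` [set t | M / 4 <= t]%R)//.
  apply: closed_comp; last exact: closed_ge.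
  move=> x _; apply: continuous_comp; last exact: enorm_continuous.
  exact: smooth_continuous.
move=> x; apply: contra_neqP => /negP; rewrite -ltNge => /ltW/a0 ->.
by rewrite scale0r.
Qed.

End variation_bound.

(** * Measurable vector fields *)

Section measurable_tools.
Variables (R : realType) (d : measure_display) (T : measurableType d).
Variable mu : {measure set T -> \bar R}.
Local Open Scope ereal_scope.

(** The coordinatewise form is the one that passes through sums and scalings; for Caratheodory
    measurable sets it is equivalent to [omeasurable] on the whole space. *)
Definition comp_measurable n (f : T -> 'rV[R]_n) :=
  forall i, measurable_fun setT (fun x => f x 0%R i).

Lemma comp_measurableB n (f g : T -> 'rV[R]_n) :
  comp_measurable f -> comp_measurable g -> comp_measurable (fun x => f x - g x)%R.
Proof.
move=> mf mg i; rewrite (_ : (fun _ => _) = (fun x => f x 0%R i - g x 0%R i)%R).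
  exact: measurable_funB.
by apply/funext => x; rewrite !mxE.
Qed.

Lemma comp_measurableD n (f g : T -> 'rV[R]_n) :
  comp_measurable f -> comp_measurable g -> comp_measurable (fun x => f x + g x)%R.
Proof.
move=> mf mg i; rewrite (_ : (fun _ => _) = (fun x => f x 0%R i + g x 0%R i)%R).
  exact: measurable_funD.
by apply/funext => x; rewrite !mxE.
Qed.

Lemma comp_measurable_scale n (a : T -> R) (f : T -> 'rV[R]_n) :
  measurable_fun setT a -> comp_measurable f -> comp_measurable (fun x => a x *: f x)%R.
Proof.
move=> ma mf i; rewrite (_ : (fun _ => _) = (fun x => a x * f x 0%R i)%R).
  exact: measurable_funM.
by apply/funext => x; rewrite !mxE.
Qed.

Lemma measurable_enorm n (f : T -> 'rV[R]_n) : comp_measurable f ->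
  measurable_fun setT (fun x => (enorm (f x))%:E).
Proof.
move=> mf; apply/measurable_EFinP.
apply: (@measurableT_comp _ _ _ _ _ _ (@Num.sqrt R)).
  by apply: continuous_measurable_fun; exact: sqrt_continuous.
by apply: measurable_sum => i; exact: measurable_funX.
Qed.

Lemma measurable_normB (f g : T -> R) : measurable_fun setT f -> measurable_fun setT g ->
  measurable_fun setT (fun x => `|f x - g x|%:E).
Proof.
move=> mf mg; apply/measurable_EFinP.
by apply: measurableT_comp => //; exact: measurable_funB.
Qed.

Lemma integral_enorm_triangle n (f g h : T -> 'rV[R]_n) :
  comp_measurable f -> comp_measurable g -> comp_measurable h ->
  \int[mu]_x (enorm (f x - h x))%:E <=
  \int[mu]_x (enorm (f x - g x))%:E + \int[mu]_x (enorm (g x - h x))%:E.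
Proof.
move=> mf mg mh.
have m1 := measurable_enorm (comp_measurableB mf mg).
have m2 := measurable_enorm (comp_measurableB mg mh).
have m3 := measurable_enorm (comp_measurableB mf mh).
rewrite -ge0_integralD//; try by move=> x _; rewrite lee_fin enorm_ge0.
apply: ge0_le_integral => //.
- by move=> x _; rewrite lee_fin enorm_ge0.
- exact: emeasurable_funD.
- by move=> x _; rewrite -EFinD lee_fin enorm_triangle.
Qed.

Lemma integral_norm_triangle (f g h : T -> R) :
  measurable_fun setT f -> measurable_fun setT g -> measurable_fun setT h ->
  \int[mu]_x `|f x - h x|%:E <=
  \int[mu]_x `|f x - g x|%:E + \int[mu]_x `|g x - h x|%:E.
Proof.
move=> mf mg mh.
have m1 := measurable_normB mf mg.
have m2 := measurable_normB mg mh.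
have m3 := measurable_normB mf mh.
rewrite -ge0_integralD//.
apply: ge0_le_integral => //.
- exact: emeasurable_funD.
- by move=> x _; rewrite -EFinD lee_fin ler_distD.
Qed.

End measurable_tools.

(** * Extension to integrable fields *)

Section L1_density.
Import HBSimple.
Variables (R : realType) (X : normedModType R) (Om : set X).
Variable mu : {outer_measure set X -> \bar R}.
Hypotheses (bX : has_bumps X) (oOm : open Om) (rmu : radon Om mu).
Local Open Scope ereal_scope.
Local Notation TX := (caratheodory_type mu).

Lemma omeasurable_comp_measurable n (f : X -> 'rV[R]_n) : omeasurable mu setT f ->
  comp_measurable (f : TX -> _).
Proof.
move=> mf i; apply: (@omeasurable_measurable _ _ mu setT).
by apply: (@omeasurable_comp _ _ mu _ _ setT f (fun v => v 0%R i)) => //; exact: coord_continuous.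
Qed.

Lemma smooth_measurable (f : X -> R) : smooth f ->
  measurable_fun [set: TX] (f : TX -> R).
Proof.
move=> sf; apply: (@omeasurable_measurable _ _ mu setT).
by apply: (radon_continuous rmu); exact: smooth_continuous.
Qed.

Lemma smooth_comp_measurable n (f : X -> 'rV[R]_n) : smooth f ->
  comp_measurable (f : TX -> _).
Proof.
move=> sf; apply: omeasurable_comp_measurable.
by apply: (radon_continuous rmu); exact: smooth_continuous.
Qed.

Definition approximable (g : X -> R) := forall e : R, (0 < e)%R ->
  exists chi : X -> R, test_function Om chi /\
    \int[cara mu]_x (`|chi x - g x|)%:E <= e%:E.

Lemma approximable_lim (g : X -> R) : measurable_fun [set: TX] (g : TX -> R) ->
  (forall e : R, (0 < e)%R -> exists h : X -> R, [/\ measurable_fun [set: TX] (h : TX -> R),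
     approximable h & \int[cara mu]_x (`|h x - g x|)%:E <= e%:E]) -> approximable g.
Proof.
move=> mg H e e0; have e2 : (0 < e / 2)%R by rewrite divr_gt0.
have [h [mh ah hg]] := H _ e2; have [chi [tc ch]] := ah _ e2.
exists chi; split => //.
have mc : measurable_fun [set: TX] (chi : TX -> R) by apply: smooth_measurable; case: tc.
apply: le_trans (integral_norm_triangle (cara mu) mc mh mg) _.
by rewrite [in leRHS](splitr e) EFinD leeD.
Qed.

Lemma approximableD (g h : X -> R) : measurable_fun [set: TX] (g : TX -> R) ->
  measurable_fun [set: TX] (h : TX -> R) -> approximable g -> approximable h ->
  approximable (fun x => g x + h x)%R.
Proof.
move=> mg mh ag ah e e0; have e2 : (0 < e / 2)%R by rewrite divr_gt0.
have [a [ta hag]] := ag _ e2; have [b [tb hbh]] := ah _ e2.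
exists (fun x => a x + b x)%R; split; first exact: test_functionD.
have ma : measurable_fun [set: TX] (a : TX -> R) by apply: smooth_measurable; case: ta.
have mb : measurable_fun [set: TX] (b : TX -> R) by apply: smooth_measurable; case: tb.
have m1 := measurable_normB ma mg. have m2 := measurable_normB mb mh.
have m3 := measurable_normB (measurable_funD ma mb) (measurable_funD mg mh).
apply: (@le_trans _ _ (\int[cara mu]_x (`|a x - g x|%:E + `|b x - h x|%:E))).
  apply: ge0_le_integral => //; first exact: emeasurable_funD.
  by move=> x _; rewrite -EFinD lee_fin /= opprD addrACA ler_normD.
by rewrite ge0_integralD// [in leRHS](splitr e) EFinD leeD.
Qed.

Lemma approximableZ (c : R) (g : X -> R) : measurable_fun [set: TX] (g : TX -> R) ->
  approximable g -> approximable (fun x => c * g x)%R.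
Proof.
move=> mg ag e e0; have c0 : (0 < `|c| + 1)%R by rewrite ltr_wpDl.
have [a [ta hag]] := ag (e / (`|c| + 1))%R (divr_gt0 e0 c0).
exists (fun x => c * a x)%R; split; first exact: (test_functionZ c).
have ma : measurable_fun [set: TX] (a : TX -> R) by apply: smooth_measurable; case: ta.
have m1 := measurable_normB ma mg.
under eq_integral do rewrite -mulrBr normrM EFinM.
rewrite ge0_integralZl//.
apply: (@le_trans _ _ (`|c|%:E * (e / (`|c| + 1))%:E)).
  by apply: lee_wpmul2l => //; rewrite lee_fin.
rewrite -EFinM lee_fin mulrA ler_pdivrMr// mulrDr mulr1 mulrC lerDl.
exact: ltW.
Qed.

Lemma approximable0 : approximable (fun=> 0%R).
Proof.
move=> e e0; exists (fun=> 0%R); split; first exact: test_function0.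
under eq_integral do rewrite subr0 normr0.
by rewrite integral0 lee_fin ltW.
Qed.

(** Inner regularity is available for open sets only, so the compact K is chosen in an open set G
    around A and need not lie in A. A cut-off that is 1 near K and supported in G differs from the
    indicator of A only on G \ A, on G \ K, and on A \ G, which lies outside [Om]. *)
Lemma approximable_indic (A : set X) : mu.-caratheodory A -> mu A < +oo ->
  approximable (\1_A : X -> R).
Proof.
move=> mA Aoo e e0; have e2 : (0 < e / 2)%R by rewrite divr_gt0.
have [G [oG AG GA]] := radon_outer rmu e2 Aoo.
have fA : mu A \is a fin_num by rewrite ge0_fin_numE// outer_measure_ge0.
have Goo : mu G < +oo.
  by apply: le_lt_trans GA _; rewrite -(fineK fA) -EFinD ltry.
have [K [cK KG GK]] := radon_inner rmu e2 oG Goo.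
have fG : mu G \is a fin_num by rewrite ge0_fin_numE// outer_measure_ge0.
have fK : mu K \is a fin_num.
  rewrite ge0_fin_numE ?outer_measure_ge0//; apply: le_lt_trans Goo.
  by apply: le_outer_measure => x /KG[].
have mG : mu.-caratheodory G by exact: (radon_open_cara rmu).
have mK : mu.-caratheodory K.
  by apply: (radon_closed_cara rmu); apply: compact_closed => //; exact: norm_hausdorff.
have hGA : mu (G `\` A) <= (e / 2)%:E.
  have fGA : mu A \is a fin_num by [].
  rewrite -(@leeD2lE _ (mu A))//; apply: le_trans GA; rewrite (mA G) setDE leeD2r//.
  rewrite -(radon_setI rmu); apply: le_outer_measure => x [Ax Ox].
  by split => //; exact: AG.
have hGK : mu (G `\` K) <= (e / 2)%:E.
  rewrite -(@leeD2lE _ (mu K))//; apply: le_trans GK; rewrite (mK G) setDE leeD2r//.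
  by apply: le_outer_measure => x Kx; split => //; have [] := KG _ Kx.
have hAG : mu (A `\` G) = 0.
  apply/eqP; rewrite eq_le outer_measure_ge0 andbT.
  case: rmu => <- _ _ _ _; apply: le_outer_measure => x [Ax nG] Ox.
  by apply: nG; exact: AG.
have [chi [W [oW KW [sc c01 c1 cc sO]]]] := bump_compact bX (openI oG oOm) cK KG.
exists chi; split; first by split => // x /sO[].
pose B := (G `\` A) `|` (G `\` K) `|` (A `\` G).
have mB : mu.-caratheodory B.
  by apply: caratheodory_measurable_setU; [apply: caratheodory_measurable_setU|];
    exact: caratheodory_measurable_setD.
apply: (@le_trans _ _ (\int[cara mu]_x (\1_B x)%:E)).
  apply: ge0_le_integral => //.
  - by apply: measurable_normB; [exact: smooth_measurable|exact: measurable_indic].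
  - by apply/measurable_EFinP; exact: measurable_indic.
  move=> x _; rewrite lee_fin !indicE.
  have [xB|nB] := boolP (x \in B).
    have /andP[h1 h2] := c01 x; rewrite ler_norml; case: (x \in A) => /=; lra.
  rewrite notin_setE /B in nB.
  have [Ax|Ax] := boolP (x \in A); rewrite ?(inE, notin_setE) in Ax.
    have Gx : G x by apply: contrapT => h; apply: nB; right.
    have Kx : K x by apply: contrapT => h; apply: nB; left; right.
    by rewrite c1 ?subrr ?normr0//; exact: KW.
  have nGx : ~ G x by move=> h; apply: nB; left; left.
  by rewrite spt_eq0 ?subrr ?normr0// => /sO[].
rewrite integral_indic// setIT.
apply: le_trans (outer_measureU2 _ _ _) _; rewrite hAG adde0.
apply: le_trans (outer_measureU2 _ _ _) _.
by rewrite [in leRHS](splitr e) EFinD leeD.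
Qed.

Lemma approximable_sfun (f : {sfun TX >-> R}) :
  (cara mu).-integrable setT (EFin \o f) -> approximable f.
Proof.
move=> intf.
rewrite (_ : (f : X -> R) = fun x => \sum_(y <- finmap.enum_fset (fset_set (range f)))
    y * \1_(f @^-1` [set y]) x)%R; last first.
  by apply/funext => x; rewrite fimfunE fsbig_finite//=; exact: fimfunP.
have mf y : measurable (f @^-1` [set y]) by apply: measurable_funPTI.
have ms y : measurable_fun [set: TX] (fun x : TX => (y * \1_(f @^-1` [set y]) x)%R).
  by apply: measurable_funM => //; exact: measurable_indic.
elim: (finmap.enum_fset _) => [|y s IH].
  by under [X in approximable X]eq_fun do rewrite big_nil; exact: approximable0.
under [X in approximable X]eq_fun do rewrite big_cons.
apply: approximableD => //.
  by apply: measurable_sum => i.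
(* The level set of the value 0 may have infinite measure, but its term vanishes; the other level
   sets have finite measure by Chebyshev's inequality. *)
have [->|y0] := eqVneq y 0%R.
  by under [X in approximable X]eq_fun do rewrite mul0r; exact: approximable0.
apply: approximableZ; first exact: measurable_indic.
apply: approximable_indic; first exact: mf.
have /integrableP[mF iF] := intf.
have y0' : (0 < `|y|)%R by rewrite normr_gt0.
have := le_integral_abse (cara mu) measurableT mF y0'.
move=> /le_lt_trans/(_ iF); rewrite setTI => h.
have {}h : mu [set x | `|y|%:E <= `|(EFin \o f) x|] < +oo.
  rewrite ltey; apply/eqP => hoo; move: h.
  rewrite (_ : cara mu _ = +oo)//.
  by rewrite mulry gtr0_sg// mul1e ltxx.
apply: le_lt_trans h; apply: le_outer_measure => x /= ->.
by rewrite lexx.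
Qed.

Lemma approximable_integrable (g : X -> R) :
  (cara mu).-integrable [set: TX] (EFin \o (g : TX -> R)) -> approximable g.
Proof.
move=> ig; have [mg _] := integrableP _ _ _ ig.
have {}mg : measurable_fun [set: TX] (g : TX -> R) by apply/measurable_EFinP.
apply: approximable_lim => // e e0.
have [h [ih _ hcvg]] := approximation_sfun_integrable (@measurableT _ TX) ig.
move/fine_cvgP : hcvg => [hfin /cvgr0Pnorm_le /(_ _ e0) hn].
near \oo => k.
exists (h k); split.
- exact: measurable_funPT.
- exact: approximable_sfun (ih k).
- have fk : \int[cara mu]_z `|(EFin \o g) z - (h k z)%:E| \is a fin_num by near: k.
  have : (`|fine (\int[cara mu]_z `|(EFin \o g) z - (h k z)%:E|)| <= e)%R by near: k.
  rewrite -lee_fin ger0_norm; last by apply: fine_ge0; exact: integral_ge0.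
  rewrite fineK//; apply: le_trans; rewrite le_eqVlt; apply/orP; left; apply/eqP.
  by apply: eq_integral => x _ /=; rewrite distrC.
Unshelve. all: by end_near. Qed.

Lemma L1_dense n (theta : X -> 'rV[R]_n) (e : R) : L1 mu theta -> (0 < e)%R ->
  exists psi, test_function Om psi /\
    \int[cara mu]_x (enorm (psi x - theta x))%:E < e%:E.
Proof.
move=> [mt it] e0.
have mc := omeasurable_comp_measurable mt.
(* Division by n + 1 gives a strict inequality for the sum of the n coordinate errors, also when n =
   0. *)
have e1 : (0 < e / n.+1%:R)%R by rewrite divr_gt0.
have H i : exists chi : X -> R, test_function Om chi /\
    \int[cara mu]_x (`|chi x - theta x 0%R i|)%:E <= (e / n.+1%:R)%:E.
  apply: approximable_integrable => //; apply/integrableP; split.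
    by apply/measurable_EFinP; exact: mc.
  apply: le_lt_trans it; apply: ge0_le_integral => //.
  - by apply: measurableT_comp => //; apply/measurable_EFinP; exact: mc.
  - exact: measurable_enorm.
  - by move=> x _ /=; rewrite lee_fin coord_le_enorm.
have [chi hchi] := choice H.
pose psi (x : X) : 'rV[R]_n := (\sum_i chi i x *: delta_mx 0 i)%R.
have tpsi : test_function Om psi.
  apply: test_function_sum => i _; have [[s c o] _] := hchi i.
  have [c' s'] : compact (spt (fun x => chi i x *: delta_mx 0 i : 'rV[R]_n)%R) /\
      spt (fun x => chi i x *: delta_mx 0 i : 'rV[R]_n)%R `<=` spt (chi i).
    apply: compact_spt_sub => // x; apply: contra_neqP => h.
    by rewrite (spt_eq0 h) scale0r.
  split => //; last exact: subset_trans s' o.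
  by apply: smooth_scale => //; exact: smooth_cst.
have psiE x i : psi x 0%R i = chi i x.
  rewrite /psi summxE (bigD1 i)//= big1 ?addr0 => [|j ji]; rewrite !mxE eqxx/=.
    by rewrite eqxx mulr1.
  by rewrite eq_sym (negbTE ji) mulr0.
exists psi; split => //.
have mpsi : comp_measurable (psi : TX -> _) by apply: smooth_comp_measurable; case: tpsi.
have mi i : measurable_fun [set: TX] (fun x : TX => `|chi i x - theta x 0%R i|%:E).
  apply: measurable_normB; last exact: mc.
  by apply: smooth_measurable; have [[]] := hchi i.
apply: (@le_lt_trans _ _ (\int[cara mu]_x (\sum_(i < n) `|chi i x - theta x 0%R i|%:E))).
  apply: ge0_le_integral => //.
  - by move=> x _; rewrite lee_fin enorm_ge0.
  - by apply: measurable_enorm; exact: comp_measurableB.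
  - exact: emeasurable_sum.
  - move=> x _; rewrite sumEFin lee_fin; apply: le_trans (enorm_le_sum _) _.
    by apply: ler_sum => i _; rewrite !mxE psiE.
rewrite ge0_integral_sum//.
apply: (@le_lt_trans _ _ (\sum_(i < n) (e / n.+1%:R)%:E)).
  by apply: lee_sum => i _; have [] := hchi i.
rewrite sumEFin lte_fin sumr_const card_ord -[(_ *+ n)%R]mulr_natr mulrAC ltr_pdivrMr//.
by rewrite ltr_pM2l// ltr_nat.
Qed.

End L1_density.

Lemma test_function_bounded (R : realType) (X : normedModType R) n (Om : set X)
    (theta : X -> 'rV[R]_n) : test_function Om theta ->
  exists M, 0 <= M /\ forall x, enorm (theta x) <= M.
Proof.
move=> [st ct _].
have ce : continuous (fun x => enorm (theta x)).
  move=> x; apply: continuous_comp; last exact: enorm_continuous.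
  exact: smooth_continuous.
have [ne|/set0P ne] := eqVneq (spt theta) set0.
  exists 1; split => // x; rewrite spt_eq0 ?enorm0// ne; exact.
have [c _ hc] := compact_EVT_max ne ct (continuous_subspaceT ce).
exists (enorm (theta c)); split; first exact: enorm_ge0.
move=> x; have [sx|nsx] := pselect (spt theta x); first by apply: hc; rewrite inE.
by rewrite (spt_eq0 nsx) enorm0 enorm_ge0.
Qed.

Section L1_extension.
Variables (R : realType) (X : normedModType R) (n : nat) (Om : set X).
Variable S : (X -> 'rV[R]_n) -> R.
Hypotheses (bX : has_bumps X) (oOm : open Om) (linS : linear_on Om S).
Hypothesis rS : representable Om S.
Local Notation mu := (variation_measure Om S).
Local Notation TX := (caratheodory_type mu).
Implicit Types (theta psi : X -> 'rV[R]_n).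
Local Open Scope ereal_scope.

(** The terms double with i and the largest nonzero one is at most 4t, which bounds the sum by 8t.
    The induction also carries the bound of the sum by the next power. *)
Lemma levels_le (e t : R) j : (0 < e)%R -> (0 <= t)%R ->
  (\sum_(i < j) e * 2 ^+ i.+1 * (e * 2 ^+ i.+1 / 4 <= t)%R%:R <= 8 * t)%R.
Proof.
move=> e0 t0; suff : (\sum_(i < j) e * 2 ^+ i.+1 * (e * 2 ^+ i.+1 / 4 <= t)%R%:R <= 8 * t)%R /\
  (\sum_(i < j) e * 2 ^+ i.+1 * (e * 2 ^+ i.+1 / 4 <= t)%R%:R <= e * 2 ^+ j.+1)%R by case.
elim: j => [|j [IH1 IH2]].
  rewrite big_ord0; split; first by rewrite mulr_ge0.
  by rewrite mulr_ge0 ?exprn_ge0// ltW.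
rewrite big_ord_recr /=; case: (leP (e * 2 ^+ j.+1 / 4)%R t) => /= h.
  rewrite mulr1; set c := (e * 2 ^+ j.+1)%R in IH2 h *.
  have -> : (e * 2 ^+ j.+2 = c + c)%R by rewrite /c exprS; ring.
  by split; [move: h; rewrite ler_pdivrMr//; lra|lra].
rewrite mulr0 addr0; split => //; apply: le_trans IH2 _.
by rewrite ler_pM2l// [leRHS]exprS ler_peMl ?exprn_ge0// ler1n.
Qed.

Lemma integral_enorm_lty theta : test_function Om theta ->
  \int[cara mu]_x (enorm (theta x))%:E < +oo.
Proof.
move=> tt; have [M [M0 hM]] := test_function_bounded tt.
have [st ct tO] := tt.
have mt := measurable_enorm (smooth_comp_measurable rS st).
have mK : mu.-caratheodory (spt theta) by apply: (radon_closed_cara rS); exact: closed_spt.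
apply: (@le_lt_trans _ _ (\int[cara mu]_x (M%:E * (\1_(spt theta) x)%:E))).
  apply: ge0_le_integral => //.
  - by move=> x _; rewrite lee_fin enorm_ge0.
  - apply: measurable_funeM; apply/measurable_EFinP; exact: measurable_indic.
  move=> x _; rewrite -EFinM lee_fin indicE.
  have [tx|ntx] := boolP (x \in spt theta); first by rewrite mulr1.
  by rewrite notin_setE in ntx; rewrite (spt_eq0 ntx) enorm0 mulr0.
rewrite ge0_integralZl//; last first.
  by apply/measurable_EFinP; exact: measurable_indic.
rewrite integral_indic// setIT; apply: lte_mul_pinfty => //.
exact: (radon_compact_lty rS).
Qed.

(* The constant 8, instead of the sharp constant 1, is what summation over dyadic
   levels of |theta| gives; any constant will do for the extension to L_1. *)
Lemma S_le_integral theta : test_function Om theta ->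
  (S theta)%:E <= 8%:E * \int[cara mu]_x (enorm (theta x))%:E.
Proof.
move=> tt; have [M [M0 hM]] := test_function_bounded tt.
have [st ct tO] := tt.
have mt := measurable_enorm (smooth_comp_measurable rS st).
have Kfin : mu (spt theta) \is a fin_num.
  by rewrite ge0_fin_numE ?outer_measure_ge0//; exact: (radon_compact_lty rS).
apply/lee_addgt0Pr => d d0.
(* Makes the remainder, e times the measure of spt theta, at most d; the summand 1 covers the case
   of a null support. *)
pose e := (d / (fine (mu (spt theta)) + 1))%R.
have k0 : (0 <= fine (mu (spt theta)))%R by apply: fine_ge0; exact: outer_measure_ge0.
have e0 : (0 < e)%R by rewrite divr_gt0// ltr_wpDl.
have [j hj] : exists j, (M <= e * 2 ^+ j)%R.
  exists (Num.bound (M / e)%R).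
  rewrite mulrC -ler_pdivrMr//; apply: (@le_trans _ _ (Num.bound (M / e))%:R%R).
    by apply: ltW; apply: archi_boundP; rewrite divr_ge0// ltW.
  by rewrite -natrX ler_nat ltnW// ltn_expl.
have := variation_levels bX oOm linS e0 tt (fun x => le_trans (hM x) hj).
move=> /le_trans; apply; apply: leeD; last first.
  rewrite -(fineK Kfin) -EFinM lee_fin /e mulrAC ler_pdivrMr ?ltr_wpDl//.
  by rewrite ler_pM2l// lerDl.
pose A i := [set x | e * 2 ^+ i.+1 / 4 <= enorm (theta x)]%R.
have mA i : mu.-caratheodory (A i).
  apply: (radon_closed_cara rS).
  rewrite (_ : A i = (fun x => enorm (theta x)) @^-1` [set t | e * 2 ^+ i.+1 / 4 <= t]%R)//.
  apply: closed_comp; last exact: closed_ge.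
  move=> x _; apply: continuous_comp; last exact: enorm_continuous.
  exact: smooth_continuous.
have mf i : measurable_fun [set: TX] (fun x : TX => ((e * 2 ^+ i.+1)%:E * (\1_(A i) x)%:E)).
  by apply: measurable_funeM; apply/measurable_EFinP; apply: measurable_indic; exact: mA.
have c0 i : (0 <= e * 2 ^+ i.+1)%R by rewrite mulr_ge0 ?exprn_ge0// ltW.
apply: (@le_trans _ _ (\int[cara mu]_x (\sum_(i < j) (e * 2 ^+ i.+1)%:E * (\1_(A i) x)%:E))).
  rewrite ge0_integral_sum//; last first.
    by move=> i x _; rewrite -EFinM lee_fin mulr_ge0.
  apply: lee_sum => i _; rewrite ge0_integralZl//; last 2 first.
    by apply/measurable_EFinP; apply: measurable_indic; exact: mA.
    by rewrite lee_fin.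
  by rewrite integral_indic ?setIT//; exact: mA.
rewrite -ge0_integralZl//; last by move=> x _; rewrite lee_fin enorm_ge0.
apply: ge0_le_integral => //.
- by move=> x _; apply: sume_ge0 => i _; rewrite -EFinM lee_fin mulr_ge0.
- exact: emeasurable_sum.
- exact: measurable_funeM.
move=> x _; under eq_bigr do rewrite -EFinM.
rewrite sumEFin -EFinM lee_fin; apply: le_trans (levels_le j e0 (enorm_ge0 (theta x))).
by apply: ler_sum => i _; rewrite indicE mem_setE /A /=.
Qed.

Lemma S_diff_le psi psi' theta : comp_measurable (theta : TX -> _) ->
  test_function Om psi -> test_function Om psi' ->
  (`|S psi - S psi'|)%:E <= 8%:E * (\int[cara mu]_x (enorm (psi x - theta x))%:E +
    \int[cara mu]_x (enorm (psi' x - theta x))%:E).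
Proof.
move=> mt.
have H p p' : test_function Om p -> test_function Om p' ->
  (S p - S p')%:E <= 8%:E * (\int[cara mu]_x (enorm (p x - theta x))%:E +
    \int[cara mu]_x (enorm (p' x - theta x))%:E).
  move=> tp tp'; rewrite -(linear_onB linS)//.
  apply: le_trans (S_le_integral (test_functionB tp tp')) _.
  apply: lee_wpmul2l => //.
  have mp := smooth_comp_measurable rS (let: And3 s _ _ := tp in s).
  have mp' := smooth_comp_measurable rS (let: And3 s _ _ := tp' in s).
  apply: le_trans (integral_enorm_triangle (cara mu) mp mt mp') _.
  rewrite leeD2l//.
  by under eq_integral do rewrite enormBC.
move=> tp tp'; case: (ger0P (S psi - S psi')%R) => _; first exact: H.
by rewrite opprB addeC; exact: H.
Qed.

Lemma L1_nbhs_filter theta : L1 mu theta -> ProperFilter (L1_nbhs Om S theta).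
Proof.
move=> lt; apply: filter_from_proper.
  apply: filter_from_filter; first by exists 1%R => /=.
  move=> i j /= i0 j0; exists (Num.min i j); first by rewrite lt_min i0.
  by move=> psi [tp]; rewrite EFin_min lt_min => /andP[h1 h2].
move=> e /= e0; have [psi [tp hp]] := L1_dense bX oOm rS lt e0.
by exists psi.
Qed.

Lemma L1_cvg theta : L1 mu theta -> cvg (S @ L1_nbhs Om S theta).
Proof.
move=> lt; have mt := omeasurable_comp_measurable lt.1.
have PF := L1_nbhs_filter lt.
apply/cauchy_cvgP; apply: cauchy_exP => e e0.
(* Two fields at distance at most e/17 from theta have values that differ by at most 16 e / 17 <
   e. *)
have e1 : (0 < e / 17)%R by rewrite divr_gt0.
have [psi [tp hp]] := L1_dense bX oOm rS lt e1.
exists (S psi); exists (e / 17)%R => // f [tf hf].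
rewrite /ball /= -lte_fin; apply: le_lt_trans (S_diff_le mt tp tf) _.
apply: (@le_lt_trans _ _ (8%:E * (e / 17 + e / 17)%:E)).
  by apply: lee_wpmul2l => //; rewrite EFinD leeD// ltW.
by rewrite -EFinM lte_fin; lra.
Qed.

(** Obtained from [S_diff_le] by letting one of the fields tend to theta. It replaces the limit in
    the definition of [L1_ext] by an estimate. *)
Lemma L1_ext_spec theta psi : L1 mu theta -> test_function Om psi ->
  (`|S psi - L1_ext Om S theta|)%:E <= 8%:E * \int[cara mu]_x (enorm (psi x - theta x))%:E.
Proof.
move=> lt tp; have mt := omeasurable_comp_measurable lt.1.
have PF := L1_nbhs_filter lt.
have cv := L1_cvg lt.
apply/lee_addgt0Pr => e e0.
(* The errors are 8 e / 9 from [S_diff_le] and e / 9 from the limit. *)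
have e1 : (0 < e / 9)%R by rewrite divr_gt0.
have [f [[tf hf] hS]] : exists f, (test_function Om f /\
    \int[cara mu]_x (enorm (f x - theta x))%:E < (e / 9)%:E) /\
    (`|L1_ext Om S theta - S f| < e / 9)%R.
  have H1 : L1_nbhs Om S theta (fun f => test_function Om f /\
    \int[cara mu]_x (enorm (f x - theta x))%:E < (e / 9)%:E) by exists (e / 9)%R.
  have H2 : \forall f \near L1_nbhs Om S theta, (`|L1_ext Om S theta - S f| < e / 9)%R.
    by have := cv => /cvgrPdist_lt /(_ _ e1).
  by have [f [a b]] := filter_ex (filterI H1 H2); exists f.
apply: (@le_trans _ _ ((`|S psi - S f|)%:E + (`|S f - L1_ext Om S theta|)%:E)).
  by rewrite -EFinD lee_fin ler_distD.
apply: (@le_trans _ _ (8%:E * (\int[cara mu]_x (enorm (psi x - theta x))%:E +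
    (e / 9)%:E) + (e / 9)%:E)).
  apply: leeD; last by rewrite lee_fin distrC ltW.
  apply: le_trans (S_diff_le mt tp tf) _.
  by apply: lee_wpmul2l => //; rewrite leeD2l// ltW.
rewrite muleDr//; last first.
  by apply: ge0_adde_def; rewrite inE; [apply: integral_ge0 => x _; rewrite lee_fin enorm_ge0|rewrite lee_fin ltW].
rewrite -addeA leeD2l// -EFinM -EFinD lee_fin; lra.
Qed.

Lemma L1_ext_unique theta (L : R) : L1 mu theta ->
  (forall e : R, (0 < e)%R -> exists psi, [/\ test_function Om psi,
    \int[cara mu]_x (enorm (psi x - theta x))%:E <= e%:E & (`|S psi - L| <= e)%R]) ->
  L1_ext Om S theta = L.
Proof.
move=> lt H; apply/eqP; rewrite -subr_eq0 -normr_le0; apply/ler_addgt0Pr => e e0.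
have e1 : (0 < e / 9)%R by rewrite divr_gt0.
have [psi [tp h1 h2]] := H _ e1.
have := L1_ext_spec lt tp.
move=> /le_trans/(_ (lee_wpmul2l _ h1)); rewrite lee_fin => /(_ (ler0n _ _)).
rewrite -EFinM lee_fin => h3.
apply: le_trans (ler_distD (S psi) _ _) _; rewrite add0r distrC.
have -> : e = (8 * (e / 9) + e / 9)%R by field.
exact: lerD.
Qed.

Lemma L1_ext_linear (a : R) theta theta' : L1 mu theta -> L1 mu theta' ->
  L1 mu (fun x => a *: theta x + theta' x)%R ->
  L1_ext Om S (fun x => a *: theta x + theta' x)%R =
  (a * L1_ext Om S theta + L1_ext Om S theta')%R.
Proof.
move=> lt lt' lt2; apply: L1_ext_unique => // e e0.
(* The error is at most (|a| + 1) d in the norm of L_1 and 8 (|a| + 1) d in the values; both are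
   below e. *)
pose d := (e / (9 * (`|a| + 1)))%R.
have a1 : (0 < `|a| + 1)%R by rewrite ltr_wpDl.
have d0 : (0 < d)%R by rewrite divr_gt0// mulr_gt0.
have da : (`|a| * (9 * d) + 9 * d = e)%R.
  by rewrite /d; field; rewrite gt_eqF.
have [f [tf hf]] := L1_dense bX oOm rS lt d0.
have [g [tg hg]] := L1_dense bX oOm rS lt' d0.
have h8 : 0%R <= 8%:E :> \bar R by [].
have Sf := le_trans (L1_ext_spec lt tf) (lee_wpmul2l h8 (ltW hf)).
have Sg := le_trans (L1_ext_spec lt' tg) (lee_wpmul2l h8 (ltW hg)).
exists (fun x => a *: f x + g x)%R; split.
- by apply: test_functionD => //; exact: test_functionZ.
- have mf := smooth_comp_measurable rS (let: And3 s _ _ := tf in s).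
  have mg := smooth_comp_measurable rS (let: And3 s _ _ := tg in s).
  have mt := omeasurable_comp_measurable lt.1.
  have mt' := omeasurable_comp_measurable lt'.1.
  have mft := measurable_enorm (comp_measurableB mf mt).
  have mgt := measurable_enorm (comp_measurableB mg mt').
  have mall : measurable_fun [set: TX] (fun x : TX =>
      (enorm (a *: f x + g x - (a *: theta x + theta' x)))%:E).
    apply: measurable_enorm; apply: comp_measurableB; apply: comp_measurableD => //;
    by apply: comp_measurable_scale => //; exact: measurable_cst.
  apply: (@le_trans _ _ (\int[cara mu]_x (`|a|%:E * (enorm (f x - theta x))%:E +
      (enorm (g x - theta' x))%:E))).
    apply: ge0_le_integral => //.
    + by move=> x _; rewrite lee_fin enorm_ge0.
    + by apply: emeasurable_funD => //; exact: measurable_funeM.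
    + move=> x _; rewrite -EFinM -EFinD lee_fin -enormZ.
      rewrite opprD addrACA -scalerBr; exact: enormD.
  rewrite ge0_integralD//; first last.
  + by move=> x _; rewrite lee_fin enorm_ge0.
  + exact: measurable_funeM.
  + by move=> x _; rewrite -EFinM lee_fin mulr_ge0// enorm_ge0.
  rewrite ge0_integralZl//; last by move=> x _; rewrite lee_fin enorm_ge0.
  apply: (@le_trans _ _ (`|a|%:E * d%:E + d%:E)).
    by apply: leeD; [apply: lee_wpmul2l => //; exact: ltW|exact: ltW].
  have d9 : (d <= 9 * d)%R by rewrite ler_peMl ?ltW// ltr1n.
  by rewrite -EFinM -EFinD lee_fin -da lerD// ler_wpM2l.
- rewrite -EFinM lee_fin in Sf; rewrite -EFinM lee_fin in Sg.
  rewrite linS//.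
  rewrite opprD addrACA -mulrBr; apply: le_trans (ler_normD _ _) _.
  have d9 : (8 * d <= 9 * d)%R by rewrite ler_pM2r// ler_nat.
  rewrite normrM -da lerD//; last exact: le_trans Sg d9.
  by rewrite ler_wpM2l//; exact: le_trans Sf d9.
Qed.

Lemma L1_ext_bound theta : L1 mu theta ->
  (`|L1_ext Om S theta|)%:E <= 8%:E * \int[cara mu]_x (enorm (theta x))%:E.
Proof.
move=> lt; have := L1_ext_spec lt (test_function0 _ Om).
rewrite (linear_on0 linS) sub0r normrN => /le_trans; apply.
by under eq_integral do rewrite sub0r enormN.
Qed.

End L1_extension.

(** * Integration in the level variable *)

Section lebesgue_tools.
Variable R : realType.
Local Notation lam := (cara (@leb1 R)).
Local Notation TR := (caratheodory_type (@leb1 R)).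
Local Open Scope ereal_scope.

Lemma leb1_borel_cara (A : set (measurableTypeR R)) : measurable A -> leb1.-caratheodory A.
Proof. exact: (caratheodory_measurable_mu_ext (@lebesgue_measure R)). Qed.

Lemma leb1_borelE (A : set (measurableTypeR R)) : measurable A ->
  leb1 A = lebesgue_measure A.
Proof. exact: measurable_mu_extE. Qed.

Lemma leb1_itv (i : interval R) : leb1.-caratheodory ([set` i] : set (measurableTypeR R)).
Proof. by apply: leb1_borel_cara; exact: measurable_itv. Qed.

Lemma leb1_itvE (i : interval R) : leb1 ([set` i] : set (measurableTypeR R)) =
  (if i.1 < i.2 then (i.2 : \bar R) - i.1 else 0).
Proof. by rewrite leb1_borelE ?lebesgue_measure_itv//; exact: measurable_itv. Qed.

Lemma borel_lam_measurable d (Y : measurableType d) (f : measurableTypeR R -> Y) :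
  measurable_fun setT f -> measurable_fun [set: TR] (f : TR -> Y).
Proof.
move=> mf _ B mB; rewrite setTI; apply: leb1_borel_cara.
by rewrite -[X in measurable X]setTI; exact: mf.
Qed.

Lemma continuous_lam_measurable (f : R -> R) : continuous f ->
  measurable_fun [set: TR] (f : TR -> R).
Proof. by move=> cf; apply: borel_lam_measurable; exact: continuous_measurable_fun. Qed.

End lebesgue_tools.

Section interval_integrals.
Variable R : realType.
Local Notation lam := (cara (@leb1 R)).
Local Notation TR := (caratheodory_type (@leb1 R)).

Lemma integrable_lam_itv b (c d M : R) : lam.-integrable setT
  (EFin \o (fun y : TR => M * \1_([set` Interval (BSide b c) (BLeft d)]) y)).
Proof.
have mI : measurable ([set` Interval (BSide b c) (BLeft d)] : set TR) by exact: leb1_itv.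
rewrite (_ : _ \o _ = fun y => (M%:E * (\1_([set` Interval (BSide b c) (BLeft d)]) y)%:E)%E)//.
apply: integrableZl => //; apply/integrableP; split.
  by apply/measurable_EFinP; exact: measurable_indic.
under eq_integral do rewrite gee0_abs ?lee_fin//.
rewrite integral_indic// setIT.
rewrite [X in (X < _)%E](_ : _ = leb1 ([set` Interval (BSide b c) (BLeft d)] : set (measurableTypeR R)))//.
by rewrite leb1_itvE /=; case: ifPn => // _; rewrite -EFinB ltry.
Qed.

Lemma Rintegral_lam_itv b (c d r : R) : c < d ->
  \int[lam]_y (r * \1_([set` Interval (BSide b c) (BLeft d)]) y) = r * (d - c).
Proof.
move=> cd; have mI : measurable ([set` Interval (BSide b c) (BLeft d)] : set TR) by exact: leb1_itv.
rewrite RintegralZl//; last first.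
  have := integrable_lam_itv b c d 1; apply: eq_integrable => // y _ /=.
  by rewrite mul1r.
congr (_ * _); rewrite /Rintegral integral_indic// setIT.
rewrite [X in fine X](_ : _ = leb1 ([set` Interval (BSide b c) (BLeft d)] : set (measurableTypeR R)))//.
by rewrite leb1_itvE /= lte_fin cd -EFinB.
Qed.

End interval_integrals.

Section grid.
Variables (R : realType) (a b : R).
Hypothesis ab : a < b.
Local Notation lam := (cara (@leb1 R)).
Local Notation TR := (caratheodory_type (@leb1 R)).

(** The interval from a to b is cut into k + 1 cells, so that the length makes sense for k = 0. *)
Definition mesh (k : nat) : R := (b - a) / k.+1%:R.

Lemma mesh_gt0 k : 0 < mesh k.
Proof. by rewrite divr_gt0// subr_gt0. Qed.

Lemma mesh_cvg e : 0 < e -> \forall k \near \oo, mesh k < e.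
Proof.
move=> e0; near=> k; rewrite /mesh ltr_pdivrMr// mulrC -ltr_pdivrMr//.
apply: lt_trans (unstable.ltr_bound _) _; rewrite ltr_nat ltnS.
near: k; exact: nbhs_infty_ge.
Unshelve. all: by end_near. Qed.

Definition node (k j : nat) : R := a + j%:R * mesh k.

Lemma nodeS k j : node k j.+1 = node k j + mesh k.
Proof. by rewrite /node -natr1 mulrDl mul1r addrA. Qed.

Lemma node0 k : node k 0 = a.
Proof. by rewrite /node mul0r addr0. Qed.

Lemma node_last k : node k k.+1 = b.
Proof. by rewrite /node /mesh mulrC divfK// addrC subrK. Qed.

Lemma node_lt k i j : (i < j)%N -> node k i < node k j.
Proof. by move=> ij; rewrite /node ltrD2l ltr_pM2r ?mesh_gt0// ltr_nat. Qed.

Lemma node_le k i j : (i <= j)%N -> node k i <= node k j.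
Proof. by rewrite leq_eqVlt => /predU1P[->//|/node_lt/ltW]. Qed.

Definition cell k j : set R := `[node k j, node k j.+1[%classic.

Lemma cellP k j y : cell k j y <-> node k j <= y < node k j.+1.
Proof. by rewrite /cell /= in_itv. Qed.

Lemma cell_exists k y : a <= y < b -> exists2 j, (j <= k)%N & cell k j y.
Proof.
move=> /andP[ay yb]; have m0 := mesh_gt0 k.
have q0 : 0 <= (y - a) / mesh k by rewrite divr_ge0 ?subr_ge0// ltW.
have /andP[h1 h2] := truncn_itv q0.
set j := Num.trunc _ in h1 h2.
have Hj : cell k j y.
  apply/cellP; rewrite /node; move: h1 h2; rewrite ler_pdivlMr// ltr_pdivrMr// => h1 h2.
  by rewrite addrC -lerBrDr h1 /= addrC -ltrBlDr.
exists j => //; rewrite -ltnS; apply: contraTT yb; rewrite -leqNgt -leNgt => kj.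
have /cellP/andP[+ _] := Hj; apply: le_trans.
by rewrite -(node_last k); exact: node_le.
Qed.

Lemma cell_inj k i j y : cell k i y -> cell k j y -> i = j.
Proof.
move=> /cellP/andP[h1 h2] /cellP/andP[h3 h4].
by case: (ltngtP i j) => // ij; exfalso; have := node_le k ij; lra.
Qed.

(** The number N of cells in use is separate from k: some sums are built by induction on N, and the
    last cell is left out when the value on a cell is taken from the following one. *)
Definition gridfun (k N : nat) (c : nat -> R) (y : R) : R :=
  \sum_(j < N) c j * \1_(cell k j) y.

Lemma gridfunE k N c j y : cell k j y -> gridfun k N c y = if (j < N)%N then c j else 0.
Proof.
move=> cj; rewrite /gridfun; case: ifPn => jN.
  rewrite (bigD1 (Ordinal jN))//= indicE mem_set// mulr1 big1 ?addr0// => i ij.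
  rewrite indicE memNset ?mulr0// => ci; move/eqP: ij; apply.
  by apply/val_inj => /=; exact: cell_inj ci cj.
rewrite big1// => i _; rewrite indicE memNset ?mulr0// => ci.
by move/negP: jN; apply; rewrite -(cell_inj ci cj).
Qed.

Lemma gridfun_out k N c y : (N <= k.+1)%N -> ~~ (a <= y < b) -> gridfun k N c y = 0.
Proof.
move=> Nk yab; rewrite /gridfun big1// => j _; rewrite indicE memNset ?mulr0//.
move=> /cellP/andP[h1 h2]; move/negP: yab; apply.
rewrite (le_trans _ h1)/=; last by rewrite -(node0 k); exact: node_le.
rewrite (lt_le_trans h2)// -(node_last k); apply: node_le.
by rewrite (leq_trans (ltn_ord j)).
Qed.

Lemma measurable_cell k j : measurable (cell k j : set TR).
Proof. exact: leb1_itv. Qed.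

Lemma measurable_gridfun k N c : measurable_fun [set: TR] (gridfun k N c : TR -> R).
Proof.
apply: measurable_sum => i; apply: measurable_funM; first exact: measurable_cst.
by apply: measurable_indic; exact: measurable_cell.
Qed.

Lemma leb1_cell k j : leb1 (cell k j : set (measurableTypeR R)) = (mesh k)%:E.
Proof.
rewrite leb1_itvE /= lte_fin node_lt// nodeS -EFinB; congr EFin.
by rewrite addrAC subrr add0r.
Qed.

Lemma integral_gridfun k N c : (forall j, 0 <= c j) ->
  (\int[lam]_y (gridfun k N c y)%:E = (\sum_(j < N) c j * mesh k)%:E)%E.
Proof.
move=> c0; rewrite /gridfun.
under eq_integral do rewrite -sumEFin.
have mi (j : nat) : measurable_fun [set: TR] (fun y : TR => (c j * \1_(cell k j) y)%:E).
  apply/measurable_EFinP; apply: measurable_funM; first exact: measurable_cst.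
  by apply: measurable_indic; exact: measurable_cell.
rewrite (@ge0_integral_sum _ _ _ lam _ (@measurableT _ TR) _
  (fun (j : 'I_N) y => (c j * \1_(cell k j) y)%:E))//; last first.
  by move=> j y _; rewrite lee_fin mulr_ge0.
rewrite -sumEFin; apply: eq_bigr => j _.
under eq_integral do rewrite EFinM.
rewrite ge0_integralZl ?lee_fin//; last first.
  by apply/measurable_EFinP; apply: measurable_indic; exact: measurable_cell.
rewrite integral_indic//; last exact: measurable_cell.
by rewrite setIT EFinM; congr (_ * _)%E; exact: leb1_cell.
Qed.

End grid.

(** * Lower limits and dominated convergence *)

Section limn_einf_tools.
Variable R : realType.
Local Open Scope ereal_scope.

Lemma limn_einf_ge (u : nat -> \bar R) (x : \bar R) :
  (\forall k \near \oo, x <= u k) -> x <= limn_einf u.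
Proof.
move=> [N _ hN]; rewrite limn_einf_lim; apply: lime_ge; first exact: is_cvg_einfs.
near=> k; apply: le_ereal_inf_tmp => _ [j /= kj <-]; apply: hN => /=.
apply: leq_trans kj; near: k; exact: nbhs_infty_ge.
Unshelve. all: by end_near. Qed.

Lemma limn_einf_le (u : nat -> \bar R) (x : \bar R) :
  (forall k, u k <= x) -> limn_einf u <= x.
Proof.
move=> ux; rewrite limn_einf_lim; apply: lime_le; first exact: is_cvg_einfs.
by apply: nearW => k; apply: le_trans (ux k); apply: ereal_inf_lbound; exists k => /=.
Qed.

Lemma limn_einf_cvg_le (u v : nat -> \bar R) (x : \bar R) :
  (forall k, u k <= v k) -> v k @[k --> \oo] --> x -> limn_einf u <= x.
Proof.
move=> uv vx; have [<- _] := cvg_limn_einf_sup vx; rewrite !limn_einf_lim.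
apply: lee_lim; [exact: is_cvg_einfs|exact: is_cvg_einfs|apply: nearW => k].
apply: le_ereal_inf_tmp => _ [j /= kj <-]; apply: le_trans (uv j).
by apply: ereal_inf_lbound; exists j.
Qed.

Lemma measurable_limn_einf d (T : measurableType d) (D : set T) (f : nat -> T -> \bar R) :
  (forall k, measurable_fun D (f k)) ->
  measurable_fun D (fun x => limn_einf (f ^~ x)).
Proof.
move=> mf; rewrite /limn_einf; apply: measurableT_comp => //.
apply: (@measurable_fun_limn_esup _ _ _ _ (fun k x => - f k x)) => k.
by apply: measurableT_comp => //; exact: mf.
Qed.

End limn_einf_tools.

Section integral_tools.
Variables (R : realType) (d : measure_display) (T : measurableType d).
Variable mu : {measure set T -> \bar R}.

Lemma Rintegral_dominated_cvg (D : set T) (f_ : nat -> T -> R) (f g : T -> R) :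
  measurable D -> (forall k, measurable_fun D (f_ k)) ->
  (forall x, D x -> f_ k x @[k --> \oo] --> f x) ->
  mu.-integrable D (EFin \o g) -> (forall k x, D x -> `|f_ k x| <= g x) ->
  \int[mu]_(x in D) f_ k x @[k --> \oo] --> \int[mu]_(x in D) f x.
Proof.
move=> mD mf ff ig fg.
have mF k : measurable_fun D (EFin \o f_ k) by apply/measurable_EFinP.
have iF k : mu.-integrable D (EFin \o f_ k).
  apply: le_integrable ig => // x Dx /=; rewrite lee_fin.
  by rewrite (le_trans (fg k x Dx))// ler_norm.
have FF x : D x -> (EFin \o f_ k) x @[k --> \oo] --> (EFin \o f) x.
  by move=> Dx; apply: cvg_EFin; [exact: nearW|exact: ff].
have bF k x : D x -> (`|(EFin \o f_ k) x| <= (EFin \o g) x)%E.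
  by move=> Dx; rewrite lee_fin; exact: fg.
have := @dominated_cvg _ _ _ mu D mD _ _ (EFin \o g) mF FF (fun x _ => erefl) ig bF.
have iF0 : mu.-integrable D (EFin \o f).
  have mf0 : measurable_fun D (EFin \o f) by apply: emeasurable_fun_cvg FF.
  apply: le_integrable ig => // x Dx /=; rewrite lee_fin.
  rewrite (@le_trans _ _ (g x)) ?ler_norm//.
  have /(@cvg_norm _ _ _ _ _ _ _) h := ff x Dx.
  by apply: (cvgr_to_le h); apply: nearW => k; exact: fg.
have fi0 := integrable_fin_num mD iF0.
rewrite -[X in _ --> X](fineK fi0) => /fine_cvgP[_ h].
exact: h.
Qed.

End integral_tools.

(** * Equality almost everywhere from equality of integrals *)

Section ae_lemmas.
Context d (T : measurableType d) (R : realType) (mu : {measure set T -> \bar R}).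
Local Open Scope ereal_scope.
Implicit Types f g h q u v a b : T -> \bar R.

Lemma ae_eq_ge_integral f g : measurable_fun setT f -> measurable_fun setT g ->
  (forall x, 0 <= f x) -> (forall x, f x <= g x) ->
  \int[mu]_x g x <= \int[mu]_x f x -> \int[mu]_x f x < +oo ->
  {ae mu, forall x, f x = g x /\ g x \is a fin_num}.
Proof.
move=> mf mg f0 fg gf foo.
have g0 x : 0 <= g x by exact: le_trans (fg x).
have intf : mu.-integrable setT f.
  by apply/integrableP; split => //; under eq_integral do rewrite gee0_abs//.
have intg : mu.-integrable setT g.
  apply/integrableP; split => //; under eq_integral do rewrite gee0_abs//.
  exact: le_lt_trans foo.
have intgf : mu.-integrable setT (g \- f) by exact: integrableB.
have fg_ae := integrable_ae measurableT intf.
have gg_ae := integrable_ae measurableT intg.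
have H : ae_eq mu setT (g \- f) (cst 0).
  apply/(ae_eq_integral_abs mu measurableT (measurable_int _ intgf)).
  transitivity (\int[mu]_x (g x - f x)).
    apply: ae_eq_integral => //.
    - by apply: measurableT_comp => //; exact: measurable_int intgf.
    - exact: measurable_int intgf.
    apply: filterS2 fg_ae gg_ae => x /(_ I) h1 /(_ I) h2 _ /=.
    by rewrite gee0_abs// sube_ge0 ?h2 ?orbT.
  rewrite integralB//; apply/eqP; rewrite eq_le; apply/andP; split.
    by rewrite sube_le0.
  rewrite sube_ge0; last by rewrite ge0_fin_numE ?foo ?integral_ge0// orbT.
  exact: ge0_le_integral.
apply: filterS3 fg_ae gg_ae H => x /(_ I) h1 /(_ I) h2 /(_ I) /= /eqP.
by rewrite sube_eq ?fin_num_adde_defr// add0e => /eqP ->.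
Qed.

(** Here [q] is an arbitrary function, squeezed between [h] and the supremum of the positive parts
    of the [p m]. Both of these are measurable and have integral t. *)
Lemma ae_eq_le_approx (p : nat -> T -> R) q h (t : R) : measurable_fun setT h ->
  (forall m, mu.-integrable setT (EFin \o p m)) ->
  (forall m x, (p m x)%:E <= q x) -> (forall x, 0 <= q x) -> (forall x, q x <= h x) ->
  \int[mu]_x h x <= t%:E ->
  (forall m, (t - m.+1%:R^-1)%:E <= \int[mu]_x (p m x)%:E) ->
  {ae mu, forall x, h x = q x} /\ \int[mu]_x h x = t%:E.
Proof.
move=> mh ip pq q0 qh ht tp.
have mp m : measurable_fun setT (fun x => (Num.max 0 (p m x))%:E).
  apply/measurable_EFinP; apply: measurable_maxr => //.
  by apply/measurable_EFinP; exact: measurable_int (ip m).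
pose f x := esups (fun m => (Num.max 0 (p m x))%:E) 0%N.
have mf : measurable_fun setT f by exact: measurable_fun_esups.
have lef m x : (Num.max 0 (p m x))%:E <= f x by apply: ereal_sup_ubound; exists m.
have f0 x : 0 <= f x by apply: le_trans (lef 0%N x); rewrite lee_fin le_max lexx.
have fq x : f x <= q x.
  by apply: ge_ereal_sup => _ [m _ <-]; rewrite EFin_max ge_max q0 pq.
have fh x : f x <= h x by exact: le_trans (fq x) (qh x).
have h0 x : 0 <= h x by exact: le_trans (f0 x) (fh x).
have tf : t%:E <= \int[mu]_x f x.
  apply/lee_addgt0Pr => e e0.
  near \oo => m.
  have me : (m.+1%:R^-1 < e)%R by near: m; exact: (near_infty_natSinv_lt (PosNum e0)).
  rewrite -leeBlDr//; apply: (@le_trans _ _ (t - m.+1%:R^-1)%:E).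
    by rewrite -EFinB lee_fin lerD2l lerN2 ltW.
  apply: le_trans (tp m) _.
  have mpm : measurable_fun setT (EFin \o p m) by exact: measurable_int (ip m).
  apply: (@le_trans _ _ (\int[mu]_x (Num.max 0 (p m x))%:E)).
    apply: le_integral => //; last by move=> x _; rewrite lee_fin le_max lexx orbT.
      exact: ip.
    apply: le_integrable (ip m) => // x _ /=; rewrite lee_fin ger0_norm ?le_max ?lexx//.
    by rewrite ge_max normr_ge0 ler_norm.
  apply: ge0_le_integral => //.
  by move=> x _; rewrite lee_fin le_max lexx.
have hf : \int[mu]_x h x <= \int[mu]_x f x by exact: le_trans tf.
have fh' : \int[mu]_x f x <= \int[mu]_x h x by exact: ge0_le_integral.
split.
  apply: filterS (ae_eq_ge_integral mf mh f0 fh hf _).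
    by move=> x [fhx _]; apply/eqP; rewrite eq_le qh -fhx fq.
  by apply: le_lt_trans fh' _; apply: le_lt_trans ht _; exact: ltry.
by apply/eqP; rewrite eq_le ht (le_trans tf).
Unshelve. all: by end_near. Qed.

(** The functions [a] and [b] are arbitrary. Since g <= a + b <= u + v and the outer terms have the
    same finite integral, equality holds almost everywhere, and a <= u, b <= v then leave no room at
    points where g is finite. *)
Lemma ae_eq_split u v g a b (s t : R) :
  measurable_fun setT u -> measurable_fun setT v -> measurable_fun setT g ->
  (forall x, 0 <= a x) -> (forall x, 0 <= b x) -> (forall x, 0 <= g x) ->
  (forall x, a x <= u x) -> (forall x, b x <= v x) -> (forall x, g x <= a x + b x) ->
  \int[mu]_x u x <= s%:E -> \int[mu]_x v x <= t%:E -> \int[mu]_x g x = (s + t)%:E ->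
  {ae mu, forall x, [/\ a x = u x, a x + b x = g x & g x \is a fin_num]} /\
  \int[mu]_x u x = s%:E.
Proof.
move=> mu' mv mg a0 b0 g0 au bv gab us vt gst.
have u0 x : 0 <= u x by exact: le_trans (au x).
have v0 x : 0 <= v x by exact: le_trans (bv x).
have guv x : g x <= u x + v x by apply: le_trans (gab x) _; exact: leeD.
have Iuv : \int[mu]_x (u x + v x) = \int[mu]_x u x + \int[mu]_x v x.
  exact: ge0_integralD.
split.
  have := ae_eq_ge_integral mg (emeasurable_funD mu' mv) g0 guv.
  rewrite Iuv gst => /(_ (leeD us vt) (ltry _)).
  apply: filterS => x [guvx].
  have := guvx; have := gab x; have := au x; have := bv x; have := a0 x; have := b0 x.
  have := u0 x; have := v0 x; have := g0 x.
  case: (u x) (v x) (a x) (b x) (g x) => [u'||] [v'||] [a'||] [b'||] [g'||] //=.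
  rewrite -!EFinD !lee_fin => ? ? ? ? ? ? ? ? [gE] _; split => //; congr EFin; lra.
have : (s + t)%:E <= \int[mu]_x u x + \int[mu]_x v x.
  by rewrite -gst -Iuv; apply: ge0_le_integral => //; exact: emeasurable_funD.
have := integral_ge0 (D := setT) mu (fun x _ => u0 x).
have := integral_ge0 (D := setT) mu (fun x _ => v0 x).
move: us vt; case: (\int[mu]_x u x) (\int[mu]_x v x) => [r||] [r'||] //=.
by rewrite -EFinD !lee_fin => *; congr EFin; lra.
Qed.

End ae_lemmas.

(** Additivity on a single set w of finite measure suffices when A has a measurable hull B of the
    same measure: it forces (w \ A) \cap B to be null, and A is w \cap B up to this null set. *)
Lemma cara_of_additive (R : realType) (X : pointedType) (mu : {outer_measure set X -> \bar R})
  (w A B : set X) : mu.-caratheodory w -> mu.-caratheodory B ->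
  A `<=` B -> A `<=` w -> mu B = mu A ->
  (mu A + mu (w `\` A) = mu w)%E -> (mu w < +oo)%E -> mu.-caratheodory A.
Proof.
move=> cw cB AB Aw BA AwA woo.
have h1 : mu (w `\` A) = (mu ((w `\` A) `&` B) + mu (w `&` ~` B))%E.
  rewrite (cB (w `\` A)); congr (_ + mu _)%E; apply/seteqP; split => x /=; first by move=> [[]].
  by move=> [wx Bx]; split => //; split => // /AB.
have h2 : (mu (w `&` B) <= mu A)%E by rewrite -BA; apply: le_outer_measure => x [].
have h3 := cB w.
have N0 : mu ((w `\` A) `&` B) = 0%E.
  have fin C : C `<=` w -> mu C \is a fin_num.
    move=> Cw; rewrite ge0_fin_numE ?outer_measure_ge0//.
    by apply: le_lt_trans woo; exact: le_outer_measure.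
  have f1 := fin _ Aw.
  have f2 : mu ((w `\` A) `&` B) \is a fin_num by apply: fin => x [[]].
  have f3 : mu (w `&` ~` B) \is a fin_num by apply: fin => x [].
  have f4 : mu (w `&` B) \is a fin_num by apply: fin => x [].
  have := outer_measure_ge0 mu ((w `\` A) `&` B).
  move: AwA h2; rewrite h3 h1 -(fineK f1) -(fineK f2) -(fineK f3) -(fineK f4).
  rewrite -!EFinD !lee_fin => -[e1] e2 e3; congr EFin; lra.
have -> : A = (w `&` B) `\` ((w `\` A) `&` B).
  apply/seteqP; split => x; first by move=> Ax; split; [split; [exact: Aw|exact: AB]|move=> [[]]].
  by move=> [[wx Bx] nx]; apply: contrapT => nAx; apply: nx.
apply: caratheodory_measurable_setD; last exact: cara_null.
exact: caratheodory_measurable_setI.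
Qed.

Definition right_continuous (R : realType) (f : R -> R) := forall y e : R, 0 < e ->
  exists2 d, 0 < d & forall z, y < z < y + d -> `|f z - f y| <= e.

Section right_continuous_theory.
Variable R : realType.
Local Notation TR := (caratheodory_type (@leb1 R)).

(** The value is taken at the right end of the cell of y. The cells contain their left ends only, so
    this node lies strictly to the right of y and within one mesh. *)
Lemma gridfun_right_cvg (a b : R) (f : R -> R) (y : R) : a < b -> right_continuous f ->
  a <= y < b ->
  gridfun a b k k.+1 (fun j => f (node a b k j.+1)) y @[k --> \oo] --> f y.
Proof.
move=> ab rf yab; apply/cvgrPdist_le => e e0.
have [d d0 hd] := rf y e e0.
near=> k.
have [j jk cj] := cell_exists ab k yab.
rewrite (gridfunE ab _ _ cj) ltnS jk distrC; apply: hd.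
have /cellP/andP[h1 h2] := cj; rewrite h2/= nodeS.
have : mesh a b k < d by near: k; exact: mesh_cvg.
lra.
Unshelve. all: by end_near. Qed.

Lemma right_continuous_measurable (f : R -> R) : right_continuous f ->
  measurable_fun [set: TR] (f : TR -> R).
Proof.
move=> rf.
have ab N : - N.+1%:R < N.+1%:R :> R by rewrite gtrN.
pose fN N (y : TR) : R := if (- N.+1%:R <= y < N.+1%:R) then f y else 0.
have mN N : measurable_fun [set: TR] (fN N : TR -> R).
  pose g (k : nat) : TR -> R :=
    gridfun (- N.+1%:R) N.+1%:R k k.+1 (fun j => f (node (- N.+1%:R) N.+1%:R k j.+1)).
  apply: (@measurable_fun_cvg _ _ _ _ g).
    by move=> k; exact: measurable_gridfun.
  move=> y _; rewrite /fN; case: ifPn => yN; first exact: gridfun_right_cvg.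
  apply: cvg_near_cst; apply: nearW => k.
  by rewrite /g (gridfun_out (ab N)).
apply: (@measurable_fun_cvg _ _ _ _ fN) => // y _.
apply: cvg_near_cst; near=> N; rewrite /fN ifT//.
suff : `|y| < N.+1%:R by rewrite ltr_norml => /andP[/ltW -> ->].
apply: lt_le_trans (unstable.ltr_norm_bound y) _; rewrite ler_nat leqW//.
near: N; exact: nbhs_infty_ge.
Unshelve. all: by end_near. Qed.

End right_continuous_theory.

Lemma test_function_real_bounded (R : realType) (X : normedModType R) (Om : set X) (om : X -> R) :
  test_function Om om -> exists2 B : R, 0 <= B & forall y, `|om y| <= B.
Proof.
move=> [so co _]; have [ne|/set0P ne] := eqVneq (spt om) set0.
  by exists 0 => // y; rewrite spt_eq0 ?normr0// ne.
have cn : continuous (fun y => `|om y|).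
  by move=> y; apply: continuous_comp; [exact: smooth_continuous|exact: norm_continuous].
have [c _ hc] := compact_EVT_max ne co (continuous_subspaceT cn).
exists `|om c| => // y; have [sy|nsy] := pselect (spt om y); first by apply: hc; rewrite inE.
by rewrite (spt_eq0 nsy) normr0.
Qed.

(** * The coarea formula for a family of functionals *)

Section coarea.
Variables (R : realType) (n : nat) (U : set 'rV[R]_n).
Variables (T : ('rV[R]_n * R -> 'rV[R]_n) -> R) (S : R -> ('rV[R]_n -> 'rV[R]_n) -> R).
Local Notation Om := (U `*` [set: R]).
Local Notation lam := (cara (@leb1 R)).
Local Notation TR := (caratheodory_type (@leb1 R)).
Local Notation nT := (variation_measure Om T).
Local Notation nS y := (variation_measure U (S y)).
Hypotheses (oU : open U) (linT : linear_on Om T) (rT : representable Om T).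
Hypothesis linS : forall y, linear_on U (S y).
Hypothesis rcS : forall theta, test_function U theta -> right_continuous (fun y => S y theta).
Hypothesis bS : forall theta, test_function U theta -> exists M : R, forall y, `|S y theta| <= M.
Hypothesis TS : forall (om : R -> R) theta, test_function setT om -> test_function U theta ->
  T (fun p => om p.2 *: theta p.1) = \int[lam]_y (om y * S y theta).

Let bX : has_bumps 'rV[R]_n := @has_bumps_row R n.
Let bXR : has_bumps ('rV[R]_n * R)%type := has_bumps_prod (@has_bumps_row R n) (@has_bumps_real R).

Let oOm : open Om. Proof. by apply: open_setX => //; exact: openT. Qed.

Lemma measurable_S theta : test_function U theta ->
  measurable_fun [set: TR] ((fun y => S y theta) : TR -> R).
Proof. by move=> tt; apply: right_continuous_measurable; exact: rcS. Qed.

Definition slice (W : set ('rV[R]_n * R)) (y : R) : set 'rV[R]_n := [set x | W (x, y)].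

Lemma slice_continuous (y : R) : continuous (fun x : 'rV[R]_n => (x, y)).
Proof. exact: smooth_continuous (smooth_slice y (@smooth_id R _)). Qed.

Lemma open_slice W y : open W -> open (slice W y).
Proof. by move=> oW; apply: open_comp => // x _; exact: slice_continuous. Qed.

Lemma test_function_tensor (om : R -> R) (theta : 'rV[R]_n -> 'rV[R]_n) : test_function setT om ->
  test_function U theta -> test_function Om (fun p => om p.2 *: theta p.1) /\
  spt (fun p => om p.2 *: theta p.1) `<=` spt theta `*` spt om.
Proof.
move=> [so co _] [st ct tU].
have [c s] : compact (spt (fun p : 'rV[R]_n * R => om p.2 *: theta p.1)) /\
    spt (fun p : 'rV[R]_n * R => om p.2 *: theta p.1) `<=` spt theta `*` spt om.
  apply: compact_spt_sub; first exact: compact_setX.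
  move=> [x y] /=; rewrite scaler_eq0 negb_or => /andP[h1 h2].
  by split; exact: spt_neq0.
split => //; split => //; first by apply: smooth_scale; [exact: smooth_snd|exact: smooth_fst].
by apply: (subset_trans s) => p [/tU h _].
Qed.

(** The indicator of ]c,d[ is a bounded pointwise limit of cut-offs supported in ]c,d[. Each product
    of such a cut-off with theta competes for ||T||, and the hypothesis [TS] evaluates T on it. *)
Lemma average_le W (c d : R) theta : open W -> c < d -> test_function U theta ->
  (forall x, enorm (theta x) <= 1) ->
  (forall x y, spt theta x -> c <= y <= d -> W (x, y)) ->
  ((\int[lam]_y (\1_(`]c, d[%classic) y * S y theta))%:E <=
    nT (W `&` (setT `*` `]c, d[%classic)))%E.
Proof.
move=> oW cd tt t1 tW.
have oI : open (`]c, d[%classic : set R) by exact: interval_open.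
have oWI : open (W `&` (setT `*` `]c, d[%classic)).
  by apply: openI => //; apply: open_setX => //; exact: openT.
pose K (m : nat) : set R := `[c + m.+1%:R^-1, d - m.+1%:R^-1]%classic.
have H m : exists om : R -> R, bump `]c, d[%classic (K m) om.
  have m0 : 0 < m.+1%:R^-1 :> R by rewrite invr_gt0.
  have [||om [W' [_ KW' [b1 b2 b3 b4 b5]]]] := bump_compact (@has_bumps_real R) oI (K := K m).
  - exact: segment_compact.
  - by move=> y; rewrite /K /= !in_itv /=; move: m0; move: (m.+1%:R^-1) => i; lra.
  - by exists om; split => // y /KW'; exact: b3.
have [om hom] := choice H.
have tom m : test_function setT (om m) by have [] := hom m.
have [M hM] := bS tt.
have M0 : 0 <= M by apply: le_trans (normr_ge0 _) (hM 0).
have cv : \int[lam]_y (om m y * S y theta) @[m --> \oo] -->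
    \int[lam]_y (\1_(`]c, d[%classic) y * S y theta).
  apply: (@Rintegral_dominated_cvg _ _ _ lam setT _ _ (fun y => M * \1_(`]c, d[%classic) y) measurableT).
  - move=> m; apply: measurable_funM; last exact: measurable_S.
    by apply: continuous_lam_measurable; apply: smooth_continuous; have [] := tom m.
  - move=> y _; apply: cvgMr_tmp; rewrite indicE.
    have [yI|yI] := boolP (y \in `]c, d[%classic); last first.
      apply: cvg_near_cst; apply: nearW => m; apply: spt_eq0.
      by have [_ _ _ _ h] := hom m => /h yI'; move/negP: yI; apply; rewrite inE.
    rewrite inE /= in_itv /= in yI; move/andP: yI => [cy yd].
    have cy0 : 0 < y - c by rewrite subr_gt0.
    have yd0 : 0 < d - y by rewrite subr_gt0.
    apply: cvg_near_cst; near=> m; have [_ _ h _ _] := hom m; apply: h.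
    have h1 : m.+1%:R^-1 < y - c.
      by near: m; exact: (near_infty_natSinv_lt (PosNum cy0)).
    have h2 : m.+1%:R^-1 < d - y.
      by near: m; exact: (near_infty_natSinv_lt (PosNum yd0)).
    by rewrite /K /= in_itv /=; move: h1 h2; move: (m.+1%:R^-1) => i; lra.
  - exact: integrable_lam_itv.
  - move=> m y _; rewrite normrM mulrC indicE.
    have [yI|yI] := boolP (y \in `]c, d[%classic).
      rewrite mulr1; have [_ o12 _ _ _] := hom m; have /andP[om0 om1] := o12 y.
      rewrite (ger0_norm om0); apply: le_trans (hM y); exact: ler_piMr.
    rewrite (_ : om m y = 0) ?normr0 ?mulr0//; apply: spt_eq0.
    by have [_ _ _ _ h] := hom m => /h yI'; move/negP: yI; apply; rewrite inE.
have cE : (\int[lam]_y (om m y * S y theta))%:E @[m --> \oo] -->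
    (\int[lam]_y (\1_(`]c, d[%classic) y * S y theta))%:E.
  by apply: cvg_EFin; [exact: nearW|exact: cv].
apply: (cvge_to_le cE); apply: nearW => m /=; rewrite -TS//.
rewrite (variation_open bXR oOm linT)//.
have [tf sf] := test_function_tensor (tom m) tt.
apply: osup_ub; split => //.
  have [_ _ _ _ h] := hom m.
  move=> [x y] /sf[/= tx /h /= yI]; split; last by [].
  by apply: tW => //; move: yI; rewrite in_itv /= => /andP[/ltW -> /ltW ->].
move=> [x y] /=; apply: enorm_scale_le1 => //.
by have [_ + _ _ _] := hom m; apply.
Unshelve. all: by end_near. Qed.

Lemma nT_open W : open W -> nT.-caratheodory W.
Proof. exact: (radon_open_cara rT). Qed.

Lemma tube (K : set 'rV[R]_n) (W : set ('rV[R]_n * R)) (y : R) : compact K -> open W -> (forall x, K x -> W (x, y)) ->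
  exists2 d : R, 0 < d & forall x z, K x -> `|z - y| < d -> W (x, z).
Proof.
move=> cK oW KW; move/compact_near_coveringP: cK => /(_ _ (nbhs y) (fun z x => W (x, z))).
case=> [x Kx|].
  have : nbhs (x, y) W by apply: open_nbhs_nbhs; split => //; exact: KW.
  by case=> -[A B] /= [nA nB] AB; exists (A, B) => //= -[u v] [/= Au Bv]; exact: AB.
move=> d /= d0 hd; exists d => // x z Kx zd; apply: hd => //.
by rewrite /ball /= distrC.
Qed.

(** The strips are disjoint. One strip at a time is split off by the open half space below it, which
    is ||T|| measurable; the lines over the nodes are lost, but an inequality is enough. *)
Lemma sum_strips_le W (a b : R) k N : a < b -> open W ->
  (\sum_(j < N) nT (W `&` (setT `*` `]node a b k j.+1, node a b k j.+2[%classic)) <= nT W)%E.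
Proof.
move=> ab oW.
pose H (N : nat) : set ('rV[R]_n * R) := setT `*` [set y | y < node a b k N.+1].
have oH M : open (H M) by apply: open_setX; [exact: openT|exact: open_lt].
suff : (\sum_(j < N) nT (W `&` (setT `*` `]node a b k j.+1, node a b k j.+2[%classic)) <=
   nT (W `&` H N))%E.
  by move=> /le_trans; apply; apply: le_outer_measure; exact: subIsetl.
elim: N => [|M IH]; first by rewrite big_ord0 outer_measure_ge0.
rewrite big_ord_recr /= [leRHS](nT_open (oH M)); apply: leeD.
  apply: le_trans IH _; apply: le_outer_measure => -[x y] [Wxy [_ /= yM]].
  by split; split => //; split => //=; apply: lt_le_trans yM _; exact: node_le.
apply: le_outer_measure => -[x y] [Wxy [_ /=]]; rewrite in_itv /= => /andP[h1 h2].
by split; [split|move=> [_ /= h]; rewrite ltNge (ltW h1) in h].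
Qed.

(* S_y(theta) is approximated by averages over the cell that follows the one of
   y; they are at most ||T|| of the strip over that cell divided by the mesh. The
   function h is the lower limit of these bounds, and Fatou's lemma applies. *)
Lemma coarea_upper W (a b : R) : a < b -> open W -> W `<=` U `*` `]a, b[%classic ->
  (nT W < +oo)%E ->
  exists h : R -> \bar R, [/\ measurable_fun [set: TR] (h : TR -> \bar R),
    (forall y, 0 <= h y)%E, (\int[lam]_y h y <= nT W)%E &
    forall y, (nS y (slice W y) <= h y)%E].
Proof.
move=> ab oW WU Woo.
pose strip k j : set ('rV[R]_n * R) := setT `*` `]node a b k j.+1, node a b k j.+2[%classic.
pose tau k j := nT (W `&` strip k j).
have tau_fin k j : tau k j \is a fin_num.
  rewrite ge0_fin_numE ?outer_measure_ge0//; apply: le_lt_trans Woo.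
  by apply: le_outer_measure; exact: subIsetl.
pose c k j := fine (tau k j) / mesh a b k.
have c0 k j : 0 <= c k j.
  by rewrite divr_ge0 ?fine_ge0 ?outer_measure_ge0// ltW// mesh_gt0.
pose hk k y := (gridfun a b k k (c k) y)%:E.
have hk0 k y : (0 <= hk k y)%E.
  by rewrite lee_fin; apply: sumr_ge0 => j _; rewrite mulr_ge0.
have mhk k : measurable_fun [set: TR] (hk k : TR -> \bar R).
  by apply/measurable_EFinP; exact: measurable_gridfun.
have ihk k : (\int[lam]_y hk k y <= nT W)%E.
  rewrite integral_gridfun//; apply: le_trans (sum_strips_le k k ab oW).
  rewrite -sumEFin; apply: lee_sum => j _; rewrite divfK ?gt_eqF ?mesh_gt0//.
  by rewrite fineK.
exists (fun y => limn_einf (hk ^~ y)); split.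
- by apply: measurable_limn_einf.
- by move=> y; apply: limn_einf_ge; exact: nearW.
- apply: le_trans (fatou lam measurableT mhk _) _ => //.
  exact: limn_einf_le.
- move=> y; have [yab|nyab] := pselect (a < y < b); last first.
    rewrite (_ : slice W y = set0) ?outer_measure0; last first.
      by apply/seteqP; split => // x /WU[_ /=]; rewrite in_itv /=.
    by apply: limn_einf_ge; exact: nearW.
  have /andP[ay yb] := yab.
  rewrite (variation_open bX oU (linS y)); last exact: open_slice.
  apply: ge_ereal_sup => _ [theta [tt tW t1] <-].
  apply/lee_addgt0Pr => e e0; have [d d0 hd] := rcS tt y e0.
  have [st ct tU] := tt.
  have [d' d'0 hd'] := tube ct oW tW.
  rewrite -leeBlDr//.
  have H : \forall k \near \oo, ((S y theta)%:E - e%:E <= hk k y)%E.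
    near=> k.
    (* The next cell lies within two meshes of y, whence the halves of d and d'. *)
    have m1 : mesh a b k < d / 2 by near: k; apply: mesh_cvg; rewrite divr_gt0.
    have m2 : mesh a b k < d' / 2 by near: k; apply: mesh_cvg; rewrite divr_gt0.
    have m3 : mesh a b k < b - y by near: k; apply: mesh_cvg; rewrite subr_gt0.
    have yab' : a <= y < b by rewrite (ltW ay).
    have m0 := mesh_gt0 ab k.
    have [j jk cj] := cell_exists ab k yab'.
    have /cellP/andP[h1 h2] := cj.
    (* As y stays more than a mesh away from b, its cell is not the last one and the next cell
       exists. *)
    have jk' : (j < k)%N.
      rewrite ltn_neqAle jk andbT; apply/negP => /eqP jk2.
      by move: h1 m3; rewrite jk2; have := nodeS a b k k; rewrite node_last; lra.
    rewrite /hk (gridfunE ab _ _ cj) jk' /c.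
    rewrite EFinM fineK// lee_pdivlMr//.
    have n12 : node a b k j.+1 < node a b k j.+2 by exact: node_lt.
    have n2 := nodeS a b k j.+1. have n1 := nodeS a b k j.
    apply: (@le_trans _ _ (\int[lam]_z (\1_(`]node a b k j.+1, node a b k j.+2[%classic) z
        * S z theta))%:E); last first.
      apply: average_le => // x z tx zI; apply: hd' => //.
      by rewrite ltr_norml; lra.
    rewrite -EFinB.
    rewrite -EFinM lee_fin.
    have -> : mesh a b k = node a b k j.+2 - node a b k j.+1.
      by rewrite n2 addrAC subrr add0r.
    rewrite -(Rintegral_lam_itv false)//; apply: le_Rintegral => //.
    - exact: integrable_lam_itv.
    - have [M hM] := bS tt; have M0 : 0 <= M by apply: le_trans (normr_ge0 _) (hM 0).
      apply: (le_integrable measurableT _ _ (integrable_lam_itv false (node a b k j.+1) (node a b k j.+2) M)).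
        apply/measurable_EFinP; apply: measurable_funM; last exact: measurable_S.
        by apply: measurable_indic; exact: leb1_itv.
      move=> z _ /=; rewrite lee_fin !normrM mulrC; apply: ler_wpM2r => //.
      rewrite (ger0_norm M0); exact: hM.
    - move=> z _; rewrite indicE; have [zI|zI] := boolP (z \in _); last first.
        by rewrite mulr0 mul0r.
      rewrite mulr1 mul1r lerBlDr -lerBlDl.
      rewrite inE /= in_itv /= in zI.
      have := hd z; rewrite ler_norml => /(_ _)/andP[|+ _]; [lra|lra].
  exact: limn_einf_ge.
Unshelve. all: by end_near. Qed.



Lemma spt_slice (phi : 'rV[R]_n * R -> 'rV[R]_n) y : compact (spt phi) ->
  compact (spt (fun x => phi (x, y))) /\ spt (fun x => phi (x, y)) `<=` slice (spt phi) y.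
Proof.
move=> ck.
have h : spt (fun x => phi (x, y)) `<=` slice (spt phi) y.
  apply: spt_sub; last by move=> x h; exact: spt_neq0.
  apply: closed_comp; last exact: closed_spt.
  by move=> x _; exact: slice_continuous.
split => //.
apply: (@subclosed_compact _ _ (fst @` spt phi)); first exact: closed_spt.
  apply: continuous_compact => //; apply: continuous_subspaceT.
  by move=> p; exact: cvg_fst.
by move=> x /h hx; exists (x, y).
Qed.

Lemma test_function_slice (phi : 'rV[R]_n * R -> 'rV[R]_n) y : test_function Om phi ->
  test_function U (fun x => phi (x, y)).
Proof.
move=> [sp cp oOp]; have [c s] := spt_slice y cp; split => //.
- exact: smooth_slice.
- by apply: (subset_trans s) => x /oOp[].
Qed.

Lemma test_function_uniform (phi : 'rV[R]_n * R -> 'rV[R]_n) (e : R) :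
  test_function Om phi -> 0 < e ->
  exists2 d : R, 0 < d & forall x y z, `|y - z| < d -> enorm (phi (x, y) - phi (x, z)) <= e.
Proof.
move=> [sp cp _] e0.
have cphi := smooth_continuous sp.
have e2 : 0 < e / 2 by rewrite divr_gt0.
pose P (d : R) (p : 'rV[R]_n * R) :=
  forall z, `|p.2 - z| < d -> enorm (phi (p.1, p.2) - phi (p.1, z)) <= e.
have H p : spt phi p -> \forall p' \near p & d \near (0 : R)^'+, P d p'.
  move=> _.
  have : \forall q \near p, enorm (phi q - phi p) < e / 2.
    have cd : (fun q => enorm (phi q - phi p)) @ p --> enorm (phi p - phi p).
      apply: continuous_comp; last exact: enorm_continuous.
      by apply: cvgB; [exact: cphi|exact: cvg_cst].
    rewrite subrr enorm0 in cd.
    by apply: (cvgr_lt 0 cd).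
  move=> /nbhs_ballP[r /= r0 hr].
  have r2 : 0 < r / 2 by rewrite divr_gt0.
  exists (ball p (r / 2), [set d | d < r / 2]) => /=.
    split; first exact: nbhsx_ballx.
    exact: nbhs_right_lt.
  move=> [p' d] [/= pp' dr] z zd.
  apply: le_trans (enorm_triangle (phi p) _ _) _.
  rewrite [leRHS]splitr; apply: lerD.
    apply: ltW; apply: hr; case: pp' => h1 h2; split.
      by apply: le_ball h1; rewrite ler_pdivrMr// mulr2n mulrDr mulr1 lerDl ltW.
    by apply: le_ball h2; rewrite ler_pdivrMr// mulr2n mulrDr mulr1 lerDl ltW.
  rewrite enormBC; apply: ltW; apply: hr; case: pp' => h1 h2; split => /=.
    by apply: le_ball h1; rewrite ler_pdivrMr// mulr2n mulrDr mulr1 lerDl ltW.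
  apply: (@ball_split _ _ p'.2); first by [].
  by rewrite /ball /=; exact: lt_trans zd dr.
have : \forall d \near (0 : R)^'+, forall p, spt phi p -> P d p.
  by move/compact_near_coveringP: cp => /(_ _ _ P); apply.
move=> [d0 /= d00 hd].
have d2 : 0 < d0 / 2 by rewrite divr_gt0.
have PK : forall p, spt phi p -> P (d0 / 2) p.
  apply: hd => //=; rewrite /ball /= sub0r normrN gtr0_norm//.
  by rewrite ltr_pdivrMr// mulr2n mulrDr mulr1 ltrDl.
exists (d0 / 2) => // x y z yz.
have [sy|nsy] := pselect (spt phi (x, y)); first exact: (PK _ sy).
have [sz|nsz] := pselect (spt phi (x, z)).
  by rewrite enormBC; apply: (PK _ sz) => /=; rewrite distrC.
by rewrite (spt_eq0 nsy) (spt_eq0 nsz) subrr enorm0 ltW.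
Qed.

(** * A partition of unity in the level variable *)

Section partition.
Variables (a b : R) (ab : a < b).

(** A difference of two translates of [step] by one mesh: the sum over i telescopes, and the i-th
    function vanishes at distance at least one mesh from node i. *)
Definition pou k i (y : R) : R :=
  step ((y - a) / mesh a b k - i%:R + 1) - step ((y - a) / mesh a b k - i%:R).

Lemma pou_ge0 k i y : 0 <= pou k i y.
Proof.
rewrite /pou; set u := _ - i%:R; have [u0|u0] := lerP u 0.
  by rewrite [step u]step0// subr0 step_ge0.
by rewrite [step (u + 1)]step1 ?subr_ge0 ?step_le1// lerDr ltW.
Qed.

Lemma pou_neq0 k i y : pou k i y != 0 -> `|y - node a b k i| < mesh a b k.
Proof.
have m0 := mesh_gt0 ab k; rewrite /pou; set u := _ - i%:R => h.
have u1 : -1 < u < 1.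
  apply/andP; split; rewrite ltNge; apply: contra_neqN h => h.
    by rewrite !step0 ?subrr//; lra.
  by rewrite !step1 ?subrr//; lra.
have -> : y - node a b k i = u * mesh a b k.
  by rewrite /u /node mulrBl divfK ?gt_eqF//; ring.
by rewrite normrM (gtr0_norm m0) gtr_pMl// ltr_norml.
Qed.

Lemma sum_pou k N y : \sum_(i < N) pou k i y =
  step ((y - a) / mesh a b k + 1) - step ((y - a) / mesh a b k - N%:R + 1).
Proof.
elim: N => [|N IH]; first by rewrite big_ord0 subr0 subrr.
rewrite big_ord_recr /= IH /pou.
rewrite (_ : (y - a) / mesh a b k - N.+1%:R + 1 = (y - a) / mesh a b k - N%:R); first ring.
by rewrite -natr1; ring.
Qed.

Lemma sum_pou_le1 k N y : \sum_(i < N) pou k i y <= 1.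
Proof.
rewrite sum_pou lerBlDr; apply: (le_trans (step_le1 _)).
by rewrite lerDl step_ge0.
Qed.

(** There are k + 2 functions because the k + 1 cells have k + 2 nodes. *)
Lemma sum_pou1 k y : a <= y <= b -> \sum_(i < k.+2) pou k i y = 1.
Proof.
move=> /andP[ay yb]; have m0 := mesh_gt0 ab k.
rewrite sum_pou step1; last by rewrite lerDr divr_ge0 ?subr_ge0// ltW.
rewrite step0 ?subr0// -natr1 opprD addrA subrK subr_le0 ler_pdivrMr//.
by rewrite /mesh mulrC divfK// lerD2r.
Qed.

Lemma test_pou k i : test_function setT (pou k i) /\
  spt (pou k i) `<=` `[node a b k i - mesh a b k, node a b k i + mesh a b k]%classic.
Proof.
have [c s] : compact (spt (pou k i)) /\
    spt (pou k i) `<=` `[node a b k i - mesh a b k, node a b k i + mesh a b k]%classic.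
  apply: compact_spt_sub; first exact: segment_compact.
  by move=> y /pou_neq0; rewrite /= in_itv /= ltr_norml; lra.
split => //; split => //.
have sl (q : R) : smooth (fun y : R => (y - a) / mesh a b k - i%:R + q).
  apply: smoothD; last exact: smooth_cst.
  apply: smoothB; last exact: smooth_cst.
  apply: smoothM; last exact: smooth_cst.
  by apply: smoothB; [exact: smooth_id|exact: smooth_cst].
apply: smoothB; first by apply: smooth_comp1 => //; exact: smooth_step.
apply: smooth_comp1; first exact: smooth_step.
by have := sl 0; under eq_fun do rewrite addr0.
Qed.

End partition.

Lemma test_bounded_integrable (om u : R -> R) (M : R) : test_function setT om ->
  measurable_fun [set: TR] (u : TR -> R) -> (forall y, `|u y| <= M) ->
  lam.-integrable setT (EFin \o (fun y : TR => om y * u y)).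
Proof.
move=> tom mu hM; have [so co _] := tom.
have M0 : 0 <= M by apply: le_trans (normr_ge0 _) (hM 0).
have [B B0 hB] := test_function_real_bounded tom.
have [A hA] : exists A : R, forall y, spt om y -> `|y| < A.
  have := compact_bounded co; rewrite /bounded_set /bounded_near => -[A [_ hA]].
  exists (A + 2) => y sy; apply: (@le_lt_trans _ _ (A + 1)); last by rewrite ltrD2l ltr1n.
  by apply: (hA (A + 1)) => //; rewrite ltrDl.
have mI : measurable_fun [set: TR] (fun y : TR => om y * u y).
  by apply: measurable_funM; [exact: (continuous_lam_measurable (smooth_continuous so))|exact: mu].
apply: (le_integrable measurableT _ _ (integrable_lam_itv false (- A) A (B * M))).
  by apply/measurable_EFinP.
move=> y _ /=; rewrite lee_fin normrM [leRHS]ger0_norm ?mulr_ge0// indicE.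
have [yI|yI] := boolP (y \in _); first by rewrite mulr1; apply: ler_pM.
rewrite (spt_eq0 (x := y)) ?normr0 ?mul0r ?mulr0// => /hA.
by rewrite ltr_norml => h; move/negP: yI; apply; rewrite inE /= in_itv.
Qed.

Lemma tensor_integrable (om : R -> R) theta : test_function setT om ->
  test_function U theta -> lam.-integrable setT (EFin \o (fun y : TR => om y * S y theta)).
Proof.
move=> tom tt; have [M hM] := bS tt.
exact: (test_bounded_integrable tom (measurable_S tt) hM).
Qed.

Lemma Rintegral_sum_tensor N (om : nat -> R -> R) (theta : nat -> 'rV[R]_n -> 'rV[R]_n) :
  (forall i, test_function setT (om i)) -> (forall i, test_function U (theta i)) ->
  lam.-integrable setT (EFin \o (fun y : TR => \sum_(i < N) om i y * S y (theta i))) /\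
  \int[lam]_y (\sum_(i < N) om i y * S y (theta i)) =
  T (fun p => \sum_(i < N) om i p.2 *: theta i p.1).
Proof.
move=> tom tth; elim: N => [|N [IH1 IH2]].
  split.
    apply: (eq_integrable measurableT (cst 0%E)); last exact: integrable0.
    by move=> y _ /=; rewrite big_ord0.
  rewrite (_ : (fun p : 'rV[R]_n * R => _) = fun=> 0); last first.
    by apply: funext => p; rewrite big_ord0.
  rewrite (linear_on0 linT); under eq_Rintegral do rewrite big_ord0.
  by rewrite Rintegral_cst// mul0r.
have i1 := tensor_integrable (tom N) (tth N).
split.
  pose F (y : TR) : R := \sum_(i < N) om i y * S y (theta i).
  pose G (y : TR) : R := om N y * S y (theta N).
  apply: (eq_integrable measurableT ((EFin \o F) \+ (EFin \o G))%E);
    last exact: integrableD.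
  by move=> y _ /=; rewrite big_ord_recr.
under eq_Rintegral do rewrite big_ord_recr /=.
rewrite RintegralD// IH2 -TS// -(linear_onD linT).
- by congr T; apply: funext => p; rewrite big_ord_recr.
- by apply: test_function_sum => i _; have [] := test_function_tensor (tom i) (tth i).
- by have [] := test_function_tensor (tom N) (tth N).
Qed.

Lemma nS_bound (y e : R) (K : set 'rV[R]_n) (theta : 'rV[R]_n -> 'rV[R]_n) : 0 <= e ->
  test_function U theta -> spt theta `<=` K -> (forall x, enorm (theta x) <= e) ->
  (`|S y theta|%:E <= e%:E * nS y K)%E.
Proof.
move=> e0 tt tK te.
have H psi : test_function U psi -> spt psi `<=` K -> (forall x, enorm (psi x) <= e) ->
    ((S y psi)%:E <= e%:E * nS y K)%E.
  move=> tp pK pe; apply: le_trans (variation_sup_bound bX oU (linS y) e0 tp pe) _.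
  by apply: lee_wpmul2l; [rewrite lee_fin|exact: le_outer_measure].
case: (ger0P (S y theta)) => _; first exact: H.
rewrite -(linear_onN (linS y))//; apply: H; first exact: test_functionN.
  apply: subset_trans tK; apply: spt_sub; first exact: closed_spt.
  by move=> x; rewrite oppr_eq0 => h; exact: spt_neq0.
by move=> x; rewrite enormN.
Qed.

Lemma nT_bound (e : R) (K : set ('rV[R]_n * R)) (phi : 'rV[R]_n * R -> 'rV[R]_n) : 0 <= e ->
  test_function Om phi -> spt phi `<=` K -> (forall x, enorm (phi x) <= e) ->
  (`|T phi|%:E <= e%:E * nT K)%E.
Proof.
move=> e0 tt tK te.
have H psi : test_function Om psi -> spt psi `<=` K -> (forall x, enorm (psi x) <= e) ->
    ((T psi)%:E <= e%:E * nT K)%E.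
  move=> tp pK pe; apply: le_trans (variation_sup_bound bXR oOm linT e0 tp pe) _.
  by apply: lee_wpmul2l; [rewrite lee_fin|exact: le_outer_measure].
case: (ger0P (T phi)) => _; first exact: H.
rewrite -(linear_onN linT)//; apply: H; first exact: test_functionN.
  apply: subset_trans tK; apply: spt_sub; first exact: closed_spt.
  by move=> x; rewrite oppr_eq0 => h; exact: spt_neq0.
by move=> x; rewrite enormN.
Qed.

Lemma compact_interval (K : set R) : compact K -> exists2 A : R, 0 < A &
  forall y, K y -> - A < y < A.
Proof.
move=> co; have := compact_bounded co; rewrite /bounded_set /bounded_near => -[A [_ hA]].
exists (`|A| + 2) => [|y sy]; first by rewrite ltr_wpDl.
rewrite -ltr_norml; apply: (@le_lt_trans _ _ (`|A| + 1)); last by rewrite ltrD2l ltr1n.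
by apply: (hA (`|A| + 1)) => //; rewrite (le_lt_trans (ler_norm A))// ltrDl.
Qed.


(** The field phi is approximated uniformly by the fields [psi k] that interpolate its slices at the
    nodes; for these the formula is a finite sum of instances of [TS]. On the side of S the error at
    y is at most e ||S_y||(W_y) <= e h(y), with the integrable h of [coarea_upper]; ||S_y||(W_y)
    itself is not yet known to be measurable in y. *)
Lemma T_slices (phi : 'rV[R]_n * R -> 'rV[R]_n) : test_function Om phi ->
  lam.-integrable setT (EFin \o (fun y : TR => S y (fun x => phi (x, y)))) /\
  T phi = \int[lam]_y S y (fun x => phi (x, y)).
Proof.
move=> tphi; have [sp cp pO] := tphi.
pose K1 : set 'rV[R]_n := fst @` spt phi.
have cK1 : compact K1.
  apply: continuous_compact => //; apply: continuous_subspaceT.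
  by move=> p; exact: cvg_fst.
have cK2 : compact (snd @` spt phi).
  apply: continuous_compact => //; apply: continuous_subspaceT.
  by move=> p; exact: cvg_snd.
have [A A0 hA] := compact_interval cK2.
have ab : - A < A by rewrite gtrN.
(* The support of phi lies over ]-A,A[ and a mesh is at most 2A, so all [psi k] are supported over
   [-3A,3A]. The open set W reaches slightly further, to 4A. *)
pose C : set ('rV[R]_n * R) := K1 `*` `[- (3 * A), 3 * A]%classic.
have cC : compact C by apply: compact_setX => //; exact: segment_compact.
have CO : C `<=` Om.
  by move=> [x y] [/= [p sp' <-] _]; split => //; have [] := pO _ sp'.
have [W0 [oW0 CW0 W0oo]] := radon_outer rT ltr01 (radon_compact_lty rT cC CO).
pose a' := - (4 * A); pose b' := 4 * A.
have ab' : a' < b' by rewrite /a' /b'; lra.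
pose W := W0 `&` (U `*` `]a', b'[%classic).
have oW : open W by apply: openI => //; apply: open_setX => //; exact: interval_open.
have WU : W `<=` U `*` `]a', b'[%classic by move=> p [].
have Woo : (nT W < +oo)%E.
  apply: (@le_lt_trans _ _ (nT W0)).
    by apply: le_outer_measure => p [].
  apply: le_lt_trans W0oo _; have := radon_compact_lty rT cC CO.
  by case: (nT C) => // r _; rewrite -EFinD ltry.
have CW : C `<=` W.
  move=> [x y] Cxy; split; first by apply: CW0; split => //; exact: CO.
  split; first by have [] := CO _ Cxy.
  by case: Cxy => _ /=; rewrite !in_itv /= /a' /b'; lra.
have [h [mh h0 ih hS]] := coarea_upper ab' oW WU Woo.
pose psi k (p : 'rV[R]_n * R) : 'rV[R]_n :=
  \sum_(i < k.+2) pou (- A) A k i p.2 *: phi (p.1, node (- A) A k i).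
have tom k i : test_function setT (pou (- A) A k i) by have [] := test_pou ab k i.
have tth k i : test_function U (fun x => phi (x, node (- A) A k i)).
  exact: test_function_slice.
have tpsi k : test_function Om (psi k).
  by apply: test_function_sum => i _; have [] := test_function_tensor (tom k i) (tth k i).
pose s k (y : R) := S y (fun x => psi k (x, y)).
pose s0 (y : R) := S y (fun x => phi (x, y)).
have sE k y : s k y = \sum_(i < k.+2) pou (- A) A k i y * S y (fun x => phi (x, node (- A) A k i)).
  rewrite /s /psi /= (linear_on_sum (linS y)); last first.
    by move=> i _; exact: test_functionZ.
  by apply: eq_bigr => i _; rewrite (linear_onZ (linS y)).
have Tpsi k : lam.-integrable setT (EFin \o (s k : TR -> R)) /\ \int[lam]_y s k y = T (psi k).
  have [h1 h2] := Rintegral_sum_tensor k.+2 (tom k) (tth k); split.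
    apply: eq_integrable h1 => // y _ /=; by rewrite sE.
  by rewrite -h2; apply: eq_Rintegral => y _; rewrite sE.
have close e : 0 < e -> \forall k \near \oo, forall p, enorm (psi k p - phi p) <= e.
  move=> e0; have [d d0 hd] := test_function_uniform tphi e0.
  near=> k; move=> [x y].
  have mk : mesh (- A) A k < d by near: k; exact: mesh_cvg.
  have -> : psi k (x, y) - phi (x, y) = \sum_(i < k.+2) pou (- A) A k i y *:
      (phi (x, node (- A) A k i) - phi (x, y)).
    under eq_bigr do rewrite scalerBr.
    rewrite sumrB -scaler_suml; congr (_ - _).
    have [yA|nyA] := pselect (- A <= y <= A); first by rewrite sum_pou1// scale1r.
    rewrite (spt_eq0 (x := (x, y))) ?scaler0// => sxy.
    by have /andP[/ltW h1 /ltW h2] := hA y (ex_intro2 _ _ (x, y) sxy erefl); apply: nyA; rewrite h1.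
  apply: (@le_trans _ _ (\sum_(i < k.+2) pou (- A) A k i y * e)); last first.
    by rewrite -mulr_suml ler_piMl ?sum_pou_le1// ltW.
  elim/big_ind2: _ => [|u1 v1 u2 v2 h1 h2|i _]; first by rewrite enorm0.
    by apply: le_trans (enormD _ _) _; exact: lerD.
  rewrite enormZ ger0_norm ?pou_ge0//.
  have [->|/pou_neq0 hp] := eqVneq (pou (- A) A k i y) 0; first by rewrite !mul0r.
  apply: ler_wpM2l; first exact: pou_ge0.
  rewrite enormBC; apply: hd; apply: lt_trans mk; exact: hp.
have spsi k : spt (psi k) `<=` C.
  apply: spt_sub; first by apply: compact_closed => //; exact: norm_hausdorff.
  move=> [x y] hne.
  have [i hi] : exists i : 'I_k.+2, pou (- A) A k i y *: phi (x, node (- A) A k i) != 0.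
    apply: contrapT => hno; move/eqP: hne; apply; rewrite /psi big1// => i _.
    by apply/eqP; apply: contrapT => hi; apply: hno; exists i; apply/negP.
  move: hi; rewrite scaler_eq0 negb_or => /andP[h1 h2].
  split; first by exists (x, node (- A) A k i) => //; exact: spt_neq0.
  have := pou_neq0 ab h1; have := hA _ (ex_intro2 _ _ _ (spt_neq0 h2) erefl).
  have : mesh (- A) A k <= 2 * A.
    rewrite /mesh opprK ler_pdivrMr// -mulr2n mulr_natl -[leLHS]mulr1.
    by apply: ler_wpM2l; rewrite ?mulrn_wge0 ?(ltW A0)// ler1n.
  by rewrite /= in_itv /= ltr_norml; move: (mesh _ _ _) (node _ _ _ _) => u v; lra.
have sphi : spt phi `<=` C.
  move=> [x y] sxy; split; first by exists (x, y).
  have := hA y (ex_intro2 _ _ (x, y) sxy erefl); rewrite /= in_itv /=; lra.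
have sclose e : 0 < e -> \forall k \near \oo, forall y, (`|s k y - s0 y|%:E <= e%:E * h y)%E.
  move=> e0; near=> k; move=> y.
  have ck : forall p, enorm (psi k p - phi p) <= e by near: k; exact: close.
  rewrite /s /s0 -(linear_onB (linS y)); last 2 first.
    exact: test_function_slice.
    exact: test_function_slice.
  have tdiff : test_function U (fun x => psi k (x, y) - phi (x, y)).
    by apply: test_functionB; exact: test_function_slice.
  apply: le_trans (nS_bound y (K := slice W y) (ltW e0) tdiff _ _) _.
  - apply: (@subset_trans _ (slice C y)); last by move=> x; exact: CW.
    apply: spt_sub.
      apply: closed_comp; first by move=> x _; exact: slice_continuous.
      by apply: compact_closed => //; exact: norm_hausdorff.
    move=> x hx; have [sx|nsx] := pselect (spt (psi k) (x, y)); first exact: (spsi _ _ sx).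
    apply: (sphi (x, y)); apply: spt_neq0; apply: contra_neq hx => ->.
    by rewrite (spt_eq0 nsx) subrr.
  - by move=> x; exact: ck.
  - by apply: lee_wpmul2l; [rewrite lee_fin ltW|exact: hS].
have ih' : (\int[lam]_y h y < +oo)%E by apply: le_lt_trans Woo.
have inth : lam.-integrable setT (h : TR -> \bar R).
  by apply/integrableP; split => //; under eq_integral do rewrite gee0_abs//.
(* The convergence of [s k y] is known only where h is finite. Replacing the values by 0 elsewhere
   gives convergence everywhere, and completeness carries the measurability of the limit over to
   [s0]. *)
pose fk k (y : TR) : R := if h y == +oo%E then 0 else s k y.
pose f0 (y : TR) : R := if h y == +oo%E then 0 else s0 y.
have mh1 : measurable [set y : TR | h y == +oo%E].
  rewrite (_ : [set _ | _] = setT `&` h @^-1` [set +oo%E]); last first.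
    by rewrite setTI; apply/seteqP; split => y /= /eqP.
  by apply: mh.
have mf0 : measurable_fun [set: TR] f0.
  apply: (@measurable_fun_cvg _ _ _ _ fk).
    move=> k; apply: measurable_fun_ifT; last 2 first.
    - exact: measurable_cst.
    - by have [/measurable_int/measurable_EFinP] := Tpsi k.
      by apply: (measurable_fun_bool true); rewrite setTI.
  move=> y' _; rewrite /fk /f0; have [_|hy] := eqVneq (h y') +oo%E; first exact: cvg_cst.
  apply/cvgrPdist_le => e e0.
  have hf : h y' \is a fin_num by rewrite ge0_fin_numE// ltey.
  have H0 : 0 <= fine (h y') by exact: fine_ge0.
  have e1 : 0 < e / (fine (h y') + 1) by rewrite divr_gt0// ltr_wpDl.
  near=> k.
  have : forall y, (`|s k y - s0 y|%:E <= (e / (fine (h y') + 1))%:E * h y)%E.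
    by near: k; exact: sclose.
  move=> /(_ y'); rewrite distrC -{2}(fineK hf) -EFinM lee_fin => /le_trans; apply.
  rewrite mulrAC ler_pdivrMr ?ltr_wpDl//; apply: ler_wpM2l; first exact: ltW.
  by rewrite lerDl.
have ms0 : measurable_fun [set: TR] (s0 : TR -> R).
  apply/measurable_EFinP; apply: (ae_measurable_fun (mu := lam) (cara_complete (mu := @leb1 R)) (f := EFin \o f0)).
    have := integrable_ae measurableT inth; apply: filterS => y hy _ /=.
    rewrite /f0; case: eqP => // hoo; move: (hy I); by rewrite hoo.
  by apply/measurable_EFinP.
have ints0 : lam.-integrable setT (EFin \o (s0 : TR -> R)).
  (* A single approximation with error 1 yields the integrable majorant |s_k0| + h. *)
  have [k0 _ hk0] := sclose 1 ltr01.
  have hk := hk0 k0 (leqnn _).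
  have [isk _] := Tpsi k0.
  have i2 : lam.-integrable setT ((fun y : TR => `|s k0 y|%:E) \+ h)%E.
    by apply: integrableD => //; exact: integrable_abse isk.
  apply: (le_integrable measurableT _ _ i2); first by apply/measurable_EFinP.
  move=> y _ /=; rewrite [leRHS]gee0_abs ?adde_ge0//.
  have -> : s0 y = s k0 y - (s k0 y - s0 y) by ring.
  apply: (@le_trans _ _ (`|s k0 y| + `|s k0 y - s0 y|)%:E).
    by rewrite lee_fin; exact: ler_normB.
  by rewrite EFinD; apply: leeD => //; apply: le_trans (hk y) _; rewrite mul1e.
split => //.
apply/eqP; rewrite -subr_eq0 -normr_le0; apply/ler_addgt0Pr => e e0; rewrite add0r.
set t := fine (nT W).
have t0 : 0 <= t by exact: fine_ge0 (outer_measure_ge0 _ _).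
have tW : nT W = t%:E by rewrite fineK// ge0_fin_numE ?outer_measure_ge0.
(* The errors on the two sides are each at most this number times t; the summand 1 covers t = 0. *)
have e1 : 0 < e / (2 * (t + 1)) by rewrite divr_gt0// mulr_gt0// ltr_wpDl.
near \oo => k.
have ck : forall p, enorm (psi k p - phi p) <= e / (2 * (t + 1)) by near: k; exact: close.
have sk : forall y, (`|s k y - s0 y|%:E <= (e / (2 * (t + 1)))%:E * h y)%E by near: k; exact: sclose.
have [isk Isk] := Tpsi k.
have h1 : `|T (psi k) - T phi| <= e / (2 * (t + 1)) * t.
  rewrite -(linear_onB linT)// -lee_fin EFinM -tW.
  apply: nT_bound (ltW e1) _ _ ck; first exact: test_functionB.
  apply: (@subset_trans _ C) => //; apply: spt_sub.
    by apply: compact_closed => //; exact: norm_hausdorff.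
  move=> p hx; have [sx|nsx] := pselect (spt (psi k) p); first exact: spsi sx.
  apply: sphi; apply: spt_neq0; apply: contra_neq hx => ->.
  by rewrite (spt_eq0 nsx) subrr.
have isks : lam.-integrable setT (EFin \o (fun y : TR => s k y - s0 y)).
  pose F (y : TR) : R := s k y.
  pose G (y : TR) : R := s0 y.
  by apply: (eq_integrable measurableT ((EFin \o F) \- (EFin \o G))%E);
    last exact: integrableB.
have h2 : `|T (psi k) - \int[lam]_y s0 y| <= e / (2 * (t + 1)) * t.
  rewrite -Isk -RintegralB//.
  apply: le_trans (le_normr_Rintegral _ _ ) _ => //.
  rewrite -lee_fin /Rintegral fineK; last first.
    have := isks => /integrableP[_]; rewrite ge0_fin_numE//.
    by apply: integral_ge0.
  apply: (@le_trans _ _ (\int[lam]_y ((e / (2 * (t + 1)))%:E * h y))%E).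
    apply: (@ge0_le_integral _ _ _ lam setT measurableT).
    - by move=> y _; rewrite lee_fin.
    - exact: measurable_int (integrable_abse isks).
    - exact: measurable_funeM.
    - by move=> y _; exact: sk.
  rewrite ge0_integralZl//; last by rewrite lee_fin ltW.
  by rewrite [leRHS]EFinM; apply: lee_wpmul2l; [rewrite lee_fin ltW|rewrite -tW].
apply: (@le_trans _ _ (e / (2 * (t + 1)) * t + e / (2 * (t + 1)) * t)).
  apply: le_trans (lerD h1 h2); rewrite [X in _ <= X + _]distrC.
  apply: le_trans (ler_normD _ _); rewrite le_eqVlt; apply/orP; left; apply/eqP; congr `|_|; ring.
have -> : e / (2 * (t + 1)) * t + e / (2 * (t + 1)) * t = e * (t / (t + 1)).
  by field; rewrite gt_eqF// ltr_wpDl.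
apply: ler_piMr; first exact: ltW.
by rewrite ler_pdivrMr ?ltr_wpDl// mul1r lerDl.
Unshelve. all: by end_near. Qed.

(** * The coarea formula for sets *)

Definition coarea_set (A : set ('rV[R]_n * R)) :=
  measurable_fun [set: TR] ((fun y => nS y (slice A y)) : TR -> \bar R) /\
  (\int[lam]_y nS y (slice A y) = nT A)%E.

(** Lebesgue measure is complete on its Caratheodory measurable sets, so a measurable h that agrees
    almost everywhere with y |-> ||S_y||(A_y) transfers both the measurability and the integral. *)
Lemma coarea_set_ae (A : set ('rV[R]_n * R)) (h : R -> \bar R) :
  measurable_fun [set: TR] (h : TR -> \bar R) ->
  {ae lam, forall y, h y = nS y (slice A y)} -> (\int[lam]_y h y = nT A)%E -> coarea_set A.
Proof.
move=> mh hA ih; have H : ae_eq lam setT h (fun y => nS y (slice A y)).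
  have F : Filter (nbhs (almost_everywhere lam)) by typeclasses eauto.
  by apply: (@filterS _ _ F) hA => y.
have mA : measurable_fun [set: TR] ((fun y => nS y (slice A y)) : TR -> \bar R).
  exact: (ae_measurable_fun (mu := lam) (cara_complete (mu := @leb1 R)) H mh).
by split => //; rewrite -ih; apply: ae_eq_integral measurableT mA mh _; exact: ae_eq_sym.
Qed.

(* The integral of h is at most ||T||(W), whereas T(phi) comes close to ||T||(W)
   for some phi, and S_y(phi(.,y)) <= ||S_y||(W_y) <= h(y). *)
Lemma coarea_open W (a b : R) : a < b -> open W -> W `<=` U `*` `]a, b[%classic ->
  (nT W < +oo)%E -> coarea_set W.
Proof.
move=> ab oW WU Woo.
have [h [mh h0 ih hS]] := coarea_upper ab oW WU Woo.
set t := fine (nT W).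
have fW : nT W \is a fin_num by rewrite ge0_fin_numE ?outer_measure_ge0.
have tW : nT W = t%:E by rewrite fineK.
have H m : exists phi : 'rV[R]_n * R -> 'rV[R]_n, [/\ test_function Om phi, spt phi `<=` W,
    forall x, enorm (phi x) <= 1 & t - m.+1%:R^-1 <= T phi].
  have m0 : 0 < m.+1%:R^-1 :> R by rewrite invr_gt0.
  have := tW; rewrite (variation_open bXR oOm linT oW) => tE.
  have [|x [phi [tp pW p1] <-]] := @ub_ereal_sup_adherent _
    [set (T theta)%:E | theta in [set theta | unit_field Om W theta]] _ m0.
    by rewrite -/(osup Om T W) tE.
  rewrite -/(osup Om T W) tE -EFinB lte_fin => /ltW tp1.
  by exists phi.
have [phi hphi] := choice H.
pose p m (y : TR) : R := S y (fun x => phi m (x, y)).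
have ip m : lam.-integrable setT (EFin \o p m).
  by have [tp _ _ _] := hphi m; have [] := T_slices tp.
have pn m y : ((p m y)%:E <= nS y (slice W y))%E.
  have [tp pW p1 _] := hphi m.
  rewrite (variation_open bX oU (linS y)); last exact: open_slice.
  apply: osup_ub; split => //; first exact: test_function_slice.
  by have [_ cp _] := tp; have [_ s] := spt_slice y cp => x /s /pW.
have [|||hae htE] := @ae_eq_le_approx _ _ _ lam p (fun y => nS y (slice W y)) h t mh ip pn _ hS.
- by move=> y; exact: outer_measure_ge0.
- by rewrite -tW.
- move=> m; have [tp _ _ tT] := hphi m; have [_ TE] := T_slices tp.
  rewrite -(fineK (integrable_fin_num measurableT (ip m))) lee_fin.
  by rewrite (le_trans tT)// TE.
by apply: coarea_set_ae mh hae _; rewrite htE tW.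
Qed.

(** Open sets around A whose ||T|| measure tends to that of A; the bound u is the lower limit of
    their slice measures, and Fatou's lemma controls its integral. *)
Lemma coarea_outer W (a b : R) A : a < b -> open W -> W `<=` U `*` `]a, b[%classic ->
  (nT W < +oo)%E -> A `<=` W -> exists u : R -> \bar R,
  [/\ measurable_fun [set: TR] (u : TR -> \bar R),
    forall y, (nS y (slice A y) <= u y)%E & (\int[lam]_y u y <= nT A)%E].
Proof.
move=> ab oW WU Woo AW.
have Aoo : (nT A < +oo)%E by apply: le_lt_trans Woo; exact: le_outer_measure.
have H m : exists G, [/\ open G, A `<=` G, G `<=` W & (nT G <= nT A + (m.+1%:R^-1)%:E)%E].
  have m0 : 0 < m.+1%:R^-1 :> R by rewrite invr_gt0.
  have [G [oG AG GA]] := radon_outer rT m0 Aoo.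
  exists (G `&` W); split => //; first exact: openI.
  - by move=> p Ap; split; [apply: AG; split => //; have [] := WU _ (AW _ Ap)|exact: AW].
  - by apply: le_trans GA; apply: le_outer_measure => p [].
have [G hG] := choice H.
have cG m : coarea_set (G m).
  have [oG _ GW _] := hG m; apply: (coarea_open ab oG).
    exact: subset_trans WU.
  by apply: le_lt_trans Woo; exact: le_outer_measure.
exists (fun y => limn_einf (fun m => nS y (slice (G m) y))); split.
- by apply: measurable_limn_einf => m; have [] := cG m.
- move=> y; apply: limn_einf_ge; apply: nearW => m; apply: le_outer_measure => x.
  by have [_ AG _ _] := hG m; exact: AG.
- apply: le_trans (fatou lam measurableT _ _) _.
  + by move=> m; have [] := cG m.
  + by move=> m y _; exact: outer_measure_ge0.
  apply: (@limn_einf_cvg_le _ _ (fun m => nT A + (m.+1%:R^-1)%:E)%E).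
    by move=> m; have [_ ->] := cG m; have [] := hG m.
  rewrite -[X in _ --> X]adde0; apply: cvgeD => //.
  - by rewrite fin_num_adde_defl.
  - exact: cvg_cst.
  - by apply: cvg_EFin; [exact: nearW|exact: cvg_harmonic].
Qed.

Lemma variation_hull y A : exists B, [/\ (nS y).-caratheodory B, A `<=` B & nS y B = nS y A].
Proof.
have [B [bB AB BA]] := var_hull oU (linS y) A.
exists B; split => //; last by rewrite !(variation_measureE bX oU (linS y)).
have := var_measurable_borel bX (linS y) bB.
by move=> h C; rewrite !(variation_measureE bX oU (linS y)); exact: (h C).
Qed.

Lemma variation_open_cara y G : open G -> (nS y).-caratheodory G.
Proof.
move=> oG C; rewrite !(variation_measureE bX oU (linS y)).
exact: (var_caratheodory_open bX (linS y) oG C).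
Qed.

(* The upper bounds u for A and v for W \ A have the same total integral as
   y |-> ||S_y||(W_y), so subadditivity forces equality for almost all y; this
   also makes the slices of A measurable. *)
Lemma coarea_bounded W (a b : R) A : a < b -> open W -> W `<=` U `*` `]a, b[%classic ->
  (nT W < +oo)%E -> A `<=` W -> nT.-caratheodory A ->
  coarea_set A /\ {ae lam, forall y, (nS y).-caratheodory (slice A y)}.
Proof.
move=> ab oW WU Woo AW cA.
have fin B : B `<=` W -> nT B \is a fin_num.
  move=> BW; rewrite ge0_fin_numE ?outer_measure_ge0//.
  by apply: le_lt_trans Woo; exact: le_outer_measure.
have DW : W `\` A `<=` W by move=> p [].
have [u [mu uA iu]] := coarea_outer ab oW WU Woo AW.
have [v [mv vA iv]] := coarea_outer ab oW WU Woo DW.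
have [mW iW] := coarea_open ab oW WU Woo.
have sW : nT W = (nT A + nT (W `\` A))%E.
  by rewrite (cA W) setIC (_ : A `&` W = A)//; apply/seteqP; split => [p []|p Ap] //; split => //; exact: AW.
have [||||hae ius] := @ae_eq_split _ _ _ lam u v (fun y => nS y (slice W y))
  (fun y => nS y (slice A y)) (fun y => nS y (slice (W `\` A) y))
  (fine (nT A)) (fine (nT (W `\` A))) mu mv mW
  (fun y => outer_measure_ge0 _ _) (fun y => outer_measure_ge0 _ _)
  (fun y => outer_measure_ge0 _ _) uA vA.
- move=> y; apply: le_trans (outer_measureU2 _ _ _); apply: le_outer_measure => x Wx.
  by have [Ax|nAx] := pselect (A (x, y)); [left|right].
- by rewrite fineK ?fin.
- by rewrite fineK ?fin.
- by rewrite iW sW EFinD !fineK ?fin.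
split.
  apply: (coarea_set_ae mu); first by apply: filterS hae => y [].
  by rewrite ius fineK ?fin.
apply: filterS hae => y [_ add gfin].
have [B [cB AB BA]] := variation_hull y (slice A y).
apply: (@cara_of_additive _ _ _ (slice W y) _ B) => //.
- by apply: variation_open_cara; exact: open_slice.
- by move=> x; exact: AW.
- by move: gfin; rewrite ge0_fin_numE// outer_measure_ge0.
Qed.

Lemma ae_imply (X : pointedType) (mu : {outer_measure set X -> \bar R}) (P Q : X -> Prop) :
  (forall x, P x -> Q x) -> {ae cara mu, forall x, P x} -> {ae cara mu, forall x, Q x}.
Proof.
move=> PQ; have F : Filter (nbhs (almost_everywhere (cara mu))) by typeclasses eauto.
exact: (@filterS _ _ F).
Qed.

Lemma ae_imply2 (X : pointedType) (mu : {outer_measure set X -> \bar R}) (P P' Q : X -> Prop) :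
  (forall x, P x -> P' x -> Q x) -> {ae cara mu, forall x, P x} -> {ae cara mu, forall x, P' x} ->
  {ae cara mu, forall x, Q x}.
Proof.
move=> PQ; have F : Filter (nbhs (almost_everywhere (cara mu))) by typeclasses eauto.
exact: (@filterS2 _ _ F).
Qed.

(** An exhaustion of U by open sets with compact hulls in U. It reduces statements about Radon
    measures to sets of finite measure. *)
Lemma exhaustion : exists G : nat -> set 'rV[R]_n,
  [/\ forall k, open (G k), forall k l, (k <= l)%N -> G k `<=` G l,
    forall k, exists K, [/\ compact K, K `<=` U & G k `<=` K] &
    forall K, compact K -> K `<=` U -> exists k, K `<=` G k].
Proof.
(* The strict bounds on the norm and on the radius make [G k] open. The same conditions with <= and
   with the radius exactly 1/(k+1) define a compact subset of U that contains it. *)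
pose G k : set 'rV[R]_n := [set x | `|x| < k.+1%:R /\
  exists2 r : R, k.+1%:R^-1 < r & ball x r `<=` U].
have oG k : open (G k).
  rewrite openE => x [xk [r kr xU]]; rewrite /interior.
  have r1 : 0 < k.+1%:R - `|x| by rewrite subr_gt0.
  have r2 : 0 < (r - k.+1%:R^-1) / 2 by rewrite divr_gt0 ?subr_gt0.
  near=> z; split.
    have : ball x (k.+1%:R - `|x|) z by near: z; exact: nbhsx_ballx.
    rewrite -ball_normE /= => h; rewrite -(subrK x z).
    by apply: le_lt_trans (ler_normD _ _) _; rewrite -ltrBrDr distrC.
  have zx : ball x ((r - k.+1%:R^-1) / 2) z by near: z; exact: nbhsx_ballx.
  exists (k.+1%:R^-1 + (r - k.+1%:R^-1) / 2); first by rewrite ltrDl.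
  move=> w zw; apply: xU.
  have := ball_triangle zx zw; apply: le_ball.
  by move: (k.+1%:R^-1) => i; lra.
have Gle k l : (k <= l)%N -> G k `<=` G l.
  move=> kl x [xk [r kr xU]]; split; first by apply: lt_le_trans xk _; rewrite ler_nat.
  exists r => //; apply: le_lt_trans kr; rewrite lef_pV2 ?posrE//.
  by rewrite ler_nat.
exists G; split => //.
- move=> k; exists [set x | `|x| <= k.+1%:R /\ ball x (k.+1%:R^-1) `<=` U]; split.
  + apply: bounded_closed_compact.
      exists k.+1%:R; split; first exact: num_real.
      by move=> M kM x [xk _]; apply: le_trans xk (ltW kM).
    apply: closedI.
      apply: (@closed_comp _ _ (fun x : 'rV[R]_n => `|x|) [set r | r <= k.+1%:R]).
        by move=> x _; exact: norm_continuous.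
      exact: closed_le.
    rewrite [X in closed X](_ : _ = \bigcap_(z in ~` U) ~` (ball z k.+1%:R^-1)); last first.
      apply/seteqP; split => [x /= xU z nUz /ball_sym /xU//|x /= h z xz].
      by apply: contrapT => nUz; apply: (h z nUz); exact: ball_sym.
    apply: closed_bigI => z _; apply: open_closedC; exact: ball_open.
  + by move=> x [_]; apply; apply: ballxx; rewrite invr_gt0.
  + move=> x [xk [r kr xU]]; split; first exact: ltW.
    by apply: subset_trans xU; apply: le_ball; exact: ltW.
- move=> K /compact_near_coveringP cK KU.
  have [|N _ hN] := cK _ (\oo) (fun k x => G k x); last first.
    by exists N => x Kx; exact: (hN N (leqnn N) x Kx).
  move=> x /KU Ux.
  have [r /= r0 xU] : exists2 r : R, 0 < r & ball x r `<=` U.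
    by have /nbhs_ballP[r /= r0 h] := open_nbhs_nbhs (conj oU Ux); exists r.
  have [k1 hk1] : exists k, G k x.
    near \oo => k; exists k; split.
      apply: (@lt_le_trans _ _ (Num.bound `|x|)%:R).
        by have := unstable.ltr_norm_bound `|x|; rewrite normr_id.
      rewrite ler_nat leqW//.
      by near: k; exact: nbhs_infty_ge.
    by exists r => //; near: k; exact: (near_infty_natSinv_lt (PosNum r0)).
  exists (G k1, [set k | (k1 <= k)%N]).
    by split => /=; [apply: open_nbhs_nbhs|exists k1].
  by move=> [z k] [/= Gz k1k]; exact: Gle Gz.
Unshelve. all: by end_near. Qed.

(** Since the complement of Y is null, A is the union of the [F k] up to a null set. So A inherits
    measurability from them, whether or not its measure is finite. *)
Lemma outer_cvg (X : pointedType) (mu : {outer_measure set X -> \bar R}) (Y A : set X)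
  (F : nat -> set X) : measure_over Y mu -> (forall k, mu.-caratheodory (F k)) ->
  (forall k l, (k <= l)%N -> F k `<=` F l) -> (forall k, F k `<=` A) ->
  A `&` Y `<=` \bigcup_k F k ->
  mu (F k) @[k --> \oo] --> mu A /\ mu.-caratheodory A.
Proof.
move=> muY cF Fle FA AF; set B := \bigcup_k F k.
have cB : mu.-caratheodory B.
  exact: (@bigcup_measurable _ (caratheodory_type mu) _ _ (fun k _ => cF k)).
have BA : B `<=` A by move=> x [k _ /FA].
have N0 : mu (A `\` B) = 0%E.
  apply/eqP; rewrite eq_le outer_measure_ge0 andbT -muY; apply: le_outer_measure => x [Ax nB] Yx.
  by apply: nB; exact: AF.
have AE : A = B `|` (A `\` B) by rewrite setDUK.
split; last by rewrite AE; apply: caratheodory_measurable_setU => //; exact: cara_null.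
have -> : mu A = mu B.
  apply/eqP; rewrite eq_le; apply/andP; split; last exact: le_outer_measure.
  rewrite {1}AE.
  by apply: le_trans (outer_measureU2 _ _ _) _; rewrite N0 adde0.
apply: (@nondecreasing_cvg_mu _ (caratheodory_type mu) _ (cara mu) F) => //.
by move=> k l kl; apply/subsetPset; exact: Fle.
Qed.

Lemma variation_over y : measure_over U (nS y).
Proof. by rewrite /measure_over (variation_measureE bX oU (linS y)) var_measure_over. Qed.

(** The bounded case applies to the intersections of A with the relatively compact boxes [W k]; they
    increase to A inside [Om], and monotone convergence holds both for ||T|| and, outside a
    countable union of null sets of levels, for the slices. *)
Lemma coarea_cara A : nT.-caratheodory A ->
  coarea_set A /\ {ae lam, forall y, (nS y).-caratheodory (slice A y)}.
Proof.
move=> cA; have [G [oG Gle GK KG]] := exhaustion.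
have nTO : measure_over Om nT by case: rT.
pose I (k : nat) : set R := `]- k.+1%:R, k.+1%:R[%classic.
pose W k := G k `*` I k.
have GU k : G k `<=` U by have [K [_ KU GKk]] := GK k; exact: subset_trans KU.
have WU k : W k `<=` U `*` `]- k.+1%:R, k.+1%:R[%classic by move=> [x y] [/= /GU].
have ab k : - k.+1%:R < k.+1%:R :> R by rewrite gtrN.
have oW k : open (W k) by apply: open_setX => //; exact: interval_open.
have Ile k l : (k <= l)%N -> I k `<=` I l.
  move=> kl y; rewrite /I /= !in_itv /= -!ltr_norml => /lt_le_trans; apply.
  by rewrite ler_nat.
have Wle k l : (k <= l)%N -> W k `<=` W l.
  by move=> kl [x y] [h1 h2]; split; [exact: Gle h1|exact: Ile h2].
have Woo k : (nT (W k) < +oo)%E.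
  have [K [cK KU GKk]] := GK k.
  apply: (@le_lt_trans _ _ (nT (K `*` `[- k.+1%:R, k.+1%:R]%classic))).
    apply: le_outer_measure => -[x y] [/= /GKk Kx]; rewrite /I /= in_itv /= => /andP[h1 h2].
    by split => //=; rewrite in_itv /= !ltW.
  apply: (radon_compact_lty rT).
    by apply: compact_setX => //; exact: segment_compact.
  by move=> [x y] [/= /KU].
have IE y : exists k, I k y.
  exists (Num.bound y); rewrite /I /= in_itv /= -ltr_norml.
  by apply: lt_le_trans (unstable.ltr_norm_bound y) _; rewrite ler_nat.
have GE x : U x -> exists k, G k x.
  move=> Ux; have [|_ ->|k hk] := KG [set x]; first exact: compact_set1.
    by [].
  by exists k; exact: hk.
pose F k := A `&` W k.
have cF k : nT.-caratheodory (F k).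
  by apply: caratheodory_measurable_setI => //; exact: nT_open.
have FW k : F k `<=` W k by move=> p [].
have FA k : F k `<=` A by move=> p [].
have Fle k l : (k <= l)%N -> F k `<=` F l.
  by move=> kl p [Ap Wp]; split => //; exact: Wle Wp.
have FE : A `&` Om `<=` \bigcup_k F k.
  move=> [x y] [Axy [/= Ux _]]; have [k1 h1] := GE x Ux; have [k2 h2] := IE y.
  exists (maxn k1 k2) => //; split => //; split => /=.
    by apply: Gle h1; exact: leq_maxl.
  by apply: Ile h2; exact: leq_maxr.
have H k := coarea_bounded (ab k) (oW k) (WU k) (Woo k) (FW k) (cF k).
have [cvT _] := outer_cvg nTO cF Fle FA FE.
have cvS : {ae lam, forall y, (forall k, (nS y).-caratheodory (slice (F k) y))}.
  by apply/ae_foralln => k; have [] := H k.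
have cvS' : {ae lam, forall y, nS y (slice (F k) y) @[k --> \oo] --> nS y (slice A y) /\
    (nS y).-caratheodory (slice A y)}.
  apply: (ae_imply _ cvS) => y cy; apply: (outer_cvg (variation_over y) cy).
  - by move=> k l kl x; exact: Fle.
  - by move=> k x; exact: FA.
  - by move=> x [Ax Ux]; have [k _ hk] := FE (x, y) (conj Ax (conj Ux Logic.I)); exists k.
split; last by apply: (ae_imply _ cvS') => y [].
pose Q k (y : TR) := nS y (slice (F k) y).
have mQ k : measurable_fun [set: TR] (Q k) by have [[]] := H k.
have Q0 k y : (0 <= Q k y)%E by exact: outer_measure_ge0.
have Qle y : {homo Q^~ y : k l / (k <= l)%N >-> (k <= l)%E}.
  by move=> k l kl; apply: le_outer_measure => x; exact: Fle.
apply: (@coarea_set_ae _ (fun y => limn (Q ^~ y))).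
- apply: (emeasurable_fun_cvg Q (fun y : TR => limn (Q ^~ y)) mQ) => y _.
  by apply: ereal_nondecreasing_is_cvgn; exact: Qle.
- by apply: (ae_imply _ cvS') => y [h _]; apply/cvg_lim.
- rewrite (monotone_convergence lam measurableT mQ) //.
  under eq_fun do rewrite (proj2 (proj1 (H _))).
  exact/cvg_lim.
Qed.

(** The boxes [G k] x [I k] have finite ||T|| measure, so the coarea formula makes ||S_y||(G_k)
    finite for almost all y in I_k. Countably many k suffice, because every compact subset of U lies
    in some G_k. *)
Lemma representable_ae : {ae lam, forall y, representable U (S y)}.
Proof.
have [G [oG Gle GK KG]] := exhaustion.
pose I (k : nat) : set R := `]- k.+1%:R, k.+1%:R[%classic.
have H k : {ae lam, forall y, I k y -> (nS y (G k) < +oo)%E}.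
  have [K [cK KU GKk]] := GK k.
  have cW : nT.-caratheodory (G k `*` I k).
    by apply: nT_open; apply: open_setX => //; exact: interval_open.
  have [[mW iW] _] := coarea_cara cW.
  have Woo : (nT (G k `*` I k) < +oo)%E.
    apply: (@le_lt_trans _ _ (nT (K `*` `[- k.+1%:R, k.+1%:R]%classic))).
      apply: le_outer_measure => -[x y] [/= /GKk Kx]; rewrite /I /= in_itv /= => /andP[h1 h2].
      by split => //=; rewrite in_itv /= !ltW.
    apply: (radon_compact_lty rT).
      by apply: compact_setX => //; exact: segment_compact.
    by move=> [x y] [/= /KU].
  have : lam.-integrable setT (fun y : TR => nS y (slice (G k `*` I k) y)).
    apply/integrableP; split => //.
    under eq_integral do rewrite gee0_abs ?outer_measure_ge0//.
    by rewrite iW.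
  move=> /(integrable_ae measurableT); apply: filterS => y /(_ Logic.I).
  rewrite ge0_fin_numE ?outer_measure_ge0// => h Iy; apply: le_lt_trans h.
  by apply: le_outer_measure => x Gx; split.
have : {ae lam, forall y, forall k, I k y -> (nS y (G k) < +oo)%E} by apply/ae_foralln.
apply: ae_imply => y hy; apply: (variation_radon bX oU (linS y)) => K cK KU.
have [k1 h1] := KG K cK KU.
have [k2 h2] : exists k, I k y.
  exists (Num.bound y); rewrite /I /= in_itv /= -ltr_norml.
  by apply: lt_le_trans (unstable.ltr_norm_bound y) _; rewrite ler_nat.
apply: (@le_lt_trans _ _ (nS y (G (maxn k1 k2)))).
  by apply: le_outer_measure => x /h1; apply: Gle; exact: leq_maxl.
apply: hy; move: h2; rewrite /I /= !in_itv /= -!ltr_norml => /lt_le_trans; apply.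
by rewrite ler_nat ltnS leq_maxr.
Qed.

(** * The coarea formula for functions *)

Import HBNNSimple.

(** One of the two integrals may be infinite, as [ointegrable] allows. If it is that of b, then b <=
    (a - b)^- + a forces the negative part of a - b to have infinite integral; the other case is
    symmetric. *)
Lemma integral_funeB d (X : measurableType d)
  (mu : {measure set X -> \bar R}) (a b : X -> \bar R) :
  measurable_fun setT a -> measurable_fun setT b ->
  (forall x, 0 <= a x)%E -> (forall x, 0 <= b x)%E ->
  (\int[mu]_x a x < +oo \/ \int[mu]_x b x < +oo)%E ->
  (\int[mu]_x (a \- b)^\+ x < +oo \/ \int[mu]_x (a \- b)^\- x < +oo)%E /\
  (\int[mu]_x (a \- b) x = \int[mu]_x a x - \int[mu]_x b x)%E.
Proof.
move=> ma mb a0 b0 ab; have mab := emeasurable_funB ma mb.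
have mp := measurable_funepos mab; have mn := measurable_funeneg mab.
have pa : (\int[mu]_x (a \- b)^\+ x <= \int[mu]_x a x)%E.
  apply: ge0_le_integral => // x _; rewrite funeposE ge_max a0 andbT.
  by have := b0 x; have := a0 x; case: (a x) (b x) => [r||] [s||] //=; rewrite ?leNye ?leey// -EFinB !lee_fin => _; lra.
have nb : (\int[mu]_x (a \- b)^\- x <= \int[mu]_x b x)%E.
  apply: ge0_le_integral => // x _; rewrite funenegE ge_max b0 andbT /=.
  by have := b0 x; have := a0 x; case: (a x) (b x) => [r||] [s||] //=; rewrite ?leNye ?leey// -?EFinB -?EFinN !lee_fin => *; lra.
split; first by case: ab => h; [left; exact: le_lt_trans pa h|right; exact: le_lt_trans nb h].
have i0 (f : X -> \bar R) : (forall x, 0 <= f x)%E -> (\int[mu]_x f x < +oo)%E ->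
    measurable_fun setT f -> mu.-integrable setT f.
  by move=> f0 foo mf; apply/integrableP; split => //; under eq_integral do rewrite gee0_abs//.
have [aoo|aoo] := ltP (\int[mu]_x a x)%E +oo%E.
  have [boo|boo] := ltP (\int[mu]_x b x)%E +oo%E; first by rewrite integralB//; exact: i0.
  have Eb : (\int[mu]_x b x = +oo)%E by apply/eqP; rewrite eq_le leey.
  have H : (\int[mu]_x b x <= \int[mu]_x ((a \- b)^\- x + a x))%E.
    apply: ge0_le_integral => //; first exact: emeasurable_funD.
    move=> x _; rewrite funenegE.
    have := b0 x; have := a0 x; case: (a x) (b x) => [r||] [s||] //=; rewrite ?leey//=.
      rewrite -EFin_max -EFinD !lee_fin => _ _; rewrite -lerBlDr le_max; apply/orP; left; lra.
    by rewrite max_r ?leNye// add0e leey.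
  move: H; rewrite Eb (ge0_integralD mu measurableT (fun x _ => funeneg_ge0 _ x) mn (fun x _ => a0 x) ma) => H.
  rewrite integralE; have -> : (\int[mu]_x (a \- b)^\- x = +oo)%E.
    move: aoo H (integral_ge0 (D := setT) mu (fun x _ => a0 x)).
    by case: (\int[mu]_x a x)%E (\int[mu]_x (a \- b)^\- x)%E => [r||] [s||].
  have : (\int[mu]_x (a \- b)^\+ x < +oo)%E by exact: le_lt_trans aoo.
  by case: (\int[mu]_x (a \- b)^\+ x)%E (\int[mu]_x a x)%E aoo => [r||] [s||].
have Ea : (\int[mu]_x a x = +oo)%E by apply/eqP; rewrite eq_le leey.
have boo : (\int[mu]_x b x < +oo)%E by case: ab => //; rewrite Ea.
have H : (\int[mu]_x a x <= \int[mu]_x ((a \- b)^\+ x + b x))%E.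
  apply: ge0_le_integral => //; first exact: emeasurable_funD.
  move=> x _; rewrite funeposE.
  have := b0 x; have := a0 x; case: (a x) (b x) => [r||] [s||] //=; rewrite ?leey//=.
  - rewrite -EFin_max -EFinD !lee_fin => _ _; rewrite -lerBlDr le_max; apply/orP; left; lra.
  - by rewrite max_r ?leNye// add0e leey.
  - by rewrite max_r ?add0e ?leey//; exact: leNye.
move: H; rewrite Ea (ge0_integralD mu measurableT (fun x _ => funepos_ge0 _ x) mp (fun x _ => b0 x) mb) => H.
rewrite integralE; have -> : (\int[mu]_x (a \- b)^\+ x = +oo)%E.
  move: boo H (integral_ge0 (D := setT) mu (fun x _ => b0 x)).
  by case: (\int[mu]_x b x)%E (\int[mu]_x (a \- b)^\+ x)%E => [r||] [s||].
have : (\int[mu]_x (a \- b)^\- x < +oo)%E by exact: le_lt_trans boo.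
by case: (\int[mu]_x (a \- b)^\- x)%E (\int[mu]_x b x)%E boo => [r||] [s||].
Qed.

Local Notation CS y := (caratheodory_type (nS y)).
Local Notation CT := (caratheodory_type nT).

Definition coarea_fun (g : 'rV[R]_n * R -> \bar R) :=
  [/\ {ae lam, forall y, measurable_fun [set: CS y] (fun x : CS y => g (x, y))},
    measurable_fun [set: TR] (fun y : TR => \int[cara (nS y)]_x g (x, y))%E &
    (\int[lam]_y \int[cara (nS y)]_x g (x, y) = \int[cara nT]_z g z)%E].

Lemma coarea_fun_ae (g : 'rV[R]_n * R -> \bar R) (h : R -> \bar R) :
  measurable_fun [set: TR] (h : TR -> \bar R) ->
  {ae lam, forall y, measurable_fun [set: CS y] (fun x : CS y => g (x, y)) /\
    h y = (\int[cara (nS y)]_x g (x, y))%E} ->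
  (\int[lam]_y h y = \int[cara nT]_z g z)%E -> coarea_fun g.
Proof.
move=> mh hg ih; have H : ae_eq lam setT h (fun y => \int[cara (nS y)]_x g (x, y))%E.
  have F : Filter (nbhs (almost_everywhere lam)) by typeclasses eauto.
  by apply: (@filterS _ _ F) hg => y [].
have mg : measurable_fun [set: TR] (fun y : TR => \int[cara (nS y)]_x g (x, y))%E.
  exact: (ae_measurable_fun (mu := lam) (cara_complete (mu := @leb1 R)) H mh).
split => //; first by apply: (ae_imply _ hg) => y [].
by rewrite -ih; apply: ae_eq_integral measurableT mg mh _; exact: ae_eq_sym.
Qed.

Lemma coarea_fun_indic A (c : R) : 0 <= c -> nT.-caratheodory A ->
  coarea_fun (fun z => (c * \1_A z)%:E).
Proof.
move=> c0 cA; have [[mA iA] sA] := coarea_cara cA.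
have E (X : pointedType) (mu : {outer_measure set X -> \bar R}) (B : set X) :
    mu.-caratheodory B ->
    measurable_fun [set: caratheodory_type mu] (fun x : caratheodory_type mu => (c * \1_B x)%:E)
    /\ (\int[cara mu]_x (c * \1_B x)%:E = c%:E * mu B)%E.
  move=> cB; have m1 : measurable_fun [set: caratheodory_type mu]
      (fun x : caratheodory_type mu => (\1_B x)%:E : \bar R).
    by apply/measurable_EFinP; apply: measurable_indic.
  split; first by apply: (measurable_funeM c%:E m1).
  under eq_integral do rewrite EFinM.
  rewrite (ge0_integralZl (cara mu) measurableT m1)//.
  by rewrite (integral_indic (cara mu) measurableT cB) setIT.
apply: (@coarea_fun_ae _ (fun y => c%:E * nS y (slice A y))%E).
- exact: measurable_funeM.
- apply: (ae_imply _ sA) => y cy; have [m1 m2] := E _ _ _ cy; split; first exact: m1.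
  by rewrite -m2.
- rewrite (ge0_integralZl lam measurableT mA)//.
  by rewrite iA (proj2 (E _ _ _ cA)).
Qed.

Lemma coarea_funD (f g : 'rV[R]_n * R -> \bar R) :
  measurable_fun [set: CT] (f : CT -> _) -> measurable_fun [set: CT] (g : CT -> _) ->
  (forall z, 0 <= f z)%E -> (forall z, 0 <= g z)%E -> coarea_fun f -> coarea_fun g ->
  coarea_fun (fun z => f z + g z)%E.
Proof.
move=> mf mg f0 g0 [sf mIf If] [sg mIg Ig].
apply: (@coarea_fun_ae _ (fun y => \int[cara (nS y)]_x f (x, y) + \int[cara (nS y)]_x g (x, y))%E).
- exact: emeasurable_funD.
- apply: (ae_imply2 _ sf sg) => y mfy mgy; split; first exact: emeasurable_funD.
  by rewrite (ge0_integralD (cara (nS y)) measurableT (fun x _ => f0 _) mfy (fun x _ => g0 _) mgy).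
- rewrite (ge0_integralD lam measurableT _ mIf _ mIg).
  + rewrite If Ig (ge0_integralD (cara nT) measurableT _ mf _ mg)//.
  + by move=> y _; apply: integral_ge0.
  + by move=> y _; apply: integral_ge0.
Qed.

Lemma coarea_fun_sum (I : Type) (s : seq I) (f : I -> 'rV[R]_n * R -> \bar R) :
  (forall i, measurable_fun [set: CT] (f i : CT -> _)) -> (forall i z, 0 <= f i z)%E ->
  (forall i, coarea_fun (f i)) -> coarea_fun (fun z => \sum_(i <- s) f i z)%E.
Proof.
move=> mf f0 cf; elim: s => [|i s IH].
  rewrite (_ : (fun z => _) = fun z : 'rV[R]_n * R => (0 * \1_setT z)%:E); last first.
    by apply/funext => z; rewrite big_nil mul0r.
  by apply: coarea_fun_indic => //; exact: (@measurableT _ CT).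
rewrite (_ : (fun z => _) = fun z => (f i z + \sum_(i <- s) f i z)%E); last first.
  by apply/funext => z; rewrite big_cons.
apply: coarea_funD => //; first exact: (emeasurable_sum s).
by move=> z; exact: sume_ge0.
Qed.

Lemma coarea_fun_ge0 (g : 'rV[R]_n * R -> \bar R) : measurable_fun [set: CT] (g : CT -> _) ->
  (forall z, 0 <= g z)%E -> coarea_fun g.
Proof.
move=> mg g0; have [f [fle fcv]] := approximation (@measurableT _ CT) mg (fun z _ => g0 z).
pose F k : 'rV[R]_n * R -> \bar R := EFin \o (f k : CT -> R).
have F0 k z : (0 <= F k z)%E by rewrite lee_fin.
have mF k : measurable_fun [set: CT] (F k : CT -> _).
  by apply/measurable_EFinP.
have Fle z : {homo F^~ z : k l / (k <= l)%N >-> (k <= l)%E}.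
  by move=> k l kl; rewrite lee_fin; move/lefP: (fle _ _ kl); exact.
have gE : g = fun z => limn (F ^~ z).
  by apply/funext => z; apply/esym/cvg_lim => //; exact: fcv.
have cF k : coarea_fun (F k).
  (* [Num.max 0 r] equals r on the range, and it makes the term nonnegative for every real r, as
     [coarea_fun_sum] requires. *)
  rewrite (_ : F k = fun z => (\sum_(r <- finmap.enum_fset (fset_set (range (f k))))
      (Num.max 0 r * \1_(f k @^-1` [set r]) z)%:E)%E); last first.
    rewrite /F; apply/funext => z; rewrite /= fimfunE fsbig_finite//=.
    rewrite -sumEFin; apply: eq_bigr => r _; congr EFin.
    rewrite indicE; case: (boolP (z \in _)) => [|_]; rewrite ?mulr0// !mulr1 inE /= => <-.
    by apply/esym/max_idPr.
  apply: coarea_fun_sum => r.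
  - apply/measurable_EFinP; apply: measurable_funM; first exact: measurable_cst.
    by apply: measurable_indic; exact: (@measurable_sfunP _ _ _ _ (f k)).
  - by move=> z; rewrite lee_fin mulr_ge0// le_max lexx.
  - apply: coarea_fun_indic; first by rewrite le_max lexx.
    exact: (@measurable_sfunP _ _ _ _ (f k)).
pose Q k (y : TR) := (\int[cara (nS y)]_x F k (x, y))%E.
have mQ k : measurable_fun [set: TR] (Q k) by have [] := cF k.
have Q0 k y : (0 <= Q k y)%E by exact: integral_ge0.
(* For exceptional y the slices need not be measurable, so monotonicity is read off the integral as
   a supremum over simple functions. *)
have Qle y : {homo Q^~ y : k l / (k <= l)%N >-> (k <= l)%E}.
  move=> k l kl; rewrite /Q !ge0_integralTE//; apply: ereal_sup_le => _ [h hF <-].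
  by exists h => // x; apply: le_trans (hF x) _; exact: Fle.
have sF : {ae lam, forall y, forall k, measurable_fun [set: CS y] (fun x : CS y => F k (x, y))}.
  by apply/ae_foralln => k; have [] := cF k.
apply: (@coarea_fun_ae _ (fun y => limn (Q ^~ y))).
- apply: (emeasurable_fun_cvg Q (fun y : TR => limn (Q ^~ y)) mQ) => y _.
  by apply: ereal_nondecreasing_is_cvgn; exact: Qle.
- apply: (ae_imply _ sF) => y my; split.
    apply: (emeasurable_fun_cvg (fun k (x : CS y) => F k (x, y)) (fun x : CS y => g (x, y)) my).
    by move=> x _; exact: fcv.
  rewrite -(monotone_convergence (cara (nS y)) measurableT my).
  + by apply: eq_integral => x _; rewrite gE.
  + by move=> k x _.
  + by move=> x _; exact: Fle.
- rewrite (monotone_convergence lam measurableT mQ) //.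
  under eq_fun do rewrite (and3_rec (fun _ _ h => h) (cF _)).
  by rewrite gE (monotone_convergence (cara nT) measurableT mF).
Qed.

Lemma coarea_ointegrable (g : 'rV[R]_n * R -> \bar R) : ointegrable nT g ->
  [/\ {ae lam, forall y, ointegrable (nS y) (fun x => g (x, y))},
      ointegrable (@leb1 R) (fun y => \int[cara (nS y)]_x g (x, y))%E &
      (\int[cara nT]_z g z = \int[lam]_y \int[cara (nS y)]_x g (x, y))%E].
Proof.
move=> [/omeasurable_emeasurable mg Ig].
have cp := coarea_fun_ge0 (measurable_funepos mg) (fun z => funepos_ge0 g z).
have cn := coarea_fun_ge0 (measurable_funeneg mg) (fun z => funeneg_ge0 g z).
have [sp mp Ip] := cp; have [sn mn In] := cn.
pose a (y : TR) := (\int[cara (nS y)]_x g^\+ (x, y))%E.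
pose b (y : TR) := (\int[cara (nS y)]_x g^\- (x, y))%E.
have a0 y : (0 <= a y)%E by apply: integral_ge0 => x _; exact: funepos_ge0.
have b0 y : (0 <= b y)%E by apply: integral_ge0 => x _; exact: funeneg_ge0.
have sepos y : (fun x => g (x, y))^\+%E = fun x => g^\+%E (x, y).
  by apply/funext => x; rewrite !funeposE.
have seneg y : (fun x => g (x, y))^\-%E = fun x => g^\-%E (x, y).
  by apply/funext => x; rewrite !funenegE.
have IE : (fun y : TR => \int[cara (nS y)]_x g (x, y))%E = (a \- b)%E.
  by apply/funext => y; rewrite integralE sepos seneg.
have Iab : (\int[lam]_y a y < +oo \/ \int[lam]_y b y < +oo)%E by rewrite /a /b Ip In.
have [H1 H2] := integral_funeB mp mn a0 b0 Iab.
split.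
- have fin : {ae lam, forall y, (a y < +oo \/ b y < +oo)%E}.
    case: Iab => h.
      have ia : lam.-integrable setT a.
        by apply/integrableP; split => //; under eq_integral do rewrite gee0_abs//.
      have := integrable_ae measurableT ia; apply: ae_imply => y /(_ Logic.I).
      by rewrite ge0_fin_numE//; left.
    have ib : lam.-integrable setT b.
      by apply/integrableP; split => //; under eq_integral do rewrite gee0_abs//.
    have := integrable_ae measurableT ib; apply: ae_imply => y /(_ Logic.I).
    by rewrite ge0_fin_numE//; right.
  have sg : {ae lam, forall y, measurable_fun [set: CS y] (fun x : CS y => g (x, y))}.
    apply: (ae_imply2 _ sp sn) => y m1 m2.
    rewrite (_ : (fun x : CS y => _) = (fun x : CS y => g^\+ (x, y)) \- (fun x : CS y => g^\- (x, y)))%E.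
      exact: emeasurable_funB.
    by apply/funext => x; rewrite {1}[g]funeposneg.
  apply: (ae_imply2 _ fin sg) => y h m; split; last by rewrite sepos seneg.
  exact: (@emeasurable_omeasurable _ _ (nS y) setT _ (@measurableT _ (CS y)) m).
- split; last by rewrite IE.
  have mI : measurable_fun [set: TR] (fun y : TR => \int[cara (nS y)]_x g (x, y))%E.
    by rewrite IE; exact: emeasurable_funB.
  exact: (@emeasurable_omeasurable _ _ (@leb1 R) setT _ (@measurableT _ TR) mI).
- by rewrite IE integralE -Ip -In; exact/esym.
Qed.

(** Every open set is a countable union of open cubes with rational centres and half sides 1/(k+1),
    and the preimage of a cube is a finite intersection of measurable sets. *)
Lemma comp_measurable_omeasurable (X : pointedType) (mu : {outer_measure set X -> \bar R})
  p (f : X -> 'rV[R]_p) : comp_measurable (f : caratheodory_type mu -> _) ->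
  omeasurable mu setT f.
Proof.
move=> mf G oG; rewrite setTI.
pose B (q : 'rV[rat]_p * nat) : set 'rV[R]_p :=
  [set v | forall i, `|v 0 i - ratr (q.1 0 i)| < q.2.+1%:R^-1].
pose J := [set q | B q `<=` G].
have mB q : mu.-caratheodory (f @^-1` B q).
  rewrite (_ : f @^-1` B q = \bigcap_(i in [set: 'I_p])
      [set x | `|f x 0 i - ratr (q.1 0 i)| < q.2.+1%:R^-1]); last first.
    by apply/seteqP; split => [x /= h i _|x h i]; [exact: h|exact: (h i Logic.I)].
  apply: (@fin_bigcap_measurable _ (caratheodory_type mu)); first exact: finite_finset.
  move=> i _.
  have mg : measurable_fun [set: caratheodory_type mu]
      (fun x : caratheodory_type mu => `|f x 0 i - ratr (q.1 0 i)|).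
    apply: measurableT_comp; first exact: normr_measurable.
    by apply: measurable_funB; [exact: mf|exact: measurable_cst].
  have := mg measurableT `]-oo, q.2.+1%:R^-1[%classic (measurable_itv _).
  rewrite setTI => mm.
  rewrite [X in measurable X](_ : _ = (fun x : X => `|f x 0 i - ratr (q.1 0 i)|) @^-1` `]-oo, q.2.+1%:R^-1[%classic)//.
have -> : f @^-1` G = \bigcup_(k : nat) (if unpickle k is Some q then
    (if `[< J q >] then f @^-1` B q else set0) else set0).
  apply/seteqP; split => [x Gx|x [k _]]; last first.
    by case: unpickle => // q; case: asboolP => // h /h.
  have /nbhs_ballP[e /= e0 he] := open_nbhs_nbhs (conj oG Gx).
  have e2 : 0 < e / 2 by rewrite divr_gt0.
  have [k hk] : exists k : nat, k.+1%:R^-1 < e / 2.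
    have [N _ hN] := near_infty_natSinv_lt (PosNum e2).
    by exists N; exact: (hN N (leqnn N)).
  have k0 : 0 < k.+1%:R^-1 :> R by rewrite invr_gt0.
  have H i : exists q : rat, `|f x 0 i - ratr q| < k.+1%:R^-1.
    have lt : f x 0 i - k.+1%:R^-1 < f x 0 i + k.+1%:R^-1.
      by rewrite ltrBlDr -addrA ltrDl addr_gt0.
    have [q] := rat_in_itvoo lt; rewrite in_itv /= => /andP[q1 q2].
    by exists q; rewrite ltr_norml; move: q1 q2; move: (k.+1%:R^-1) (ratr q) => u v; lra.
  have [q hq] := choice H.
  pose Q : 'rV[rat]_p * nat := (\row_i q i, k).
  exists (pickle Q) => //; rewrite pickleK asboolT; last first.
    move=> v hv; apply: he; split => // a b; rewrite (ord1 a) /ball /=.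
    have h1 := hq b; have := hv b; rewrite /= mxE => h2.
    rewrite -(subrK (ratr (q b)) (f x 0 b)) -addrA.
    apply: le_lt_trans (ler_normD _ _) _; rewrite [X in _ + X]distrC.
    by move: hk h1 h2; move: (k.+1%:R^-1) => i; lra.
  by move=> i /=; rewrite mxE; exact: hq.
apply: (@bigcupT_measurable _ (caratheodory_type mu)) => k.
case: unpickle => [q|]; last exact: measurable0.
by case: asboolP => _; [exact: mB|exact: measurable0].
Qed.

Lemma coarea_section (g : 'rV[R]_n * R -> \bar R) : measurable_fun [set: CT] (g : CT -> _) ->
  {ae lam, forall y, measurable_fun [set: CS y] (fun x : CS y => g (x, y))}.
Proof.
move=> mg.
have [sp _ _] := coarea_fun_ge0 (measurable_funepos mg) (fun z => funepos_ge0 g z).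
have [sn _ _] := coarea_fun_ge0 (measurable_funeneg mg) (fun z => funeneg_ge0 g z).
apply: (ae_imply2 _ sp sn) => y m1 m2.
rewrite (_ : (fun x : CS y => _) = (fun x : CS y => g^\+ (x, y)) \- (fun x : CS y => g^\- (x, y)))%E.
  exact: emeasurable_funB.
by apply/funext => x; rewrite {1}[g]funeposneg.
Qed.

Lemma coarea_L1_section (phi : 'rV[R]_n * R -> 'rV[R]_n) : L1 nT phi -> {ae lam, forall y, L1 (nS y) (fun x => phi (x, y))}.
Proof.
move=> [mphi iphi]; have cphi := omeasurable_comp_measurable mphi.
have mE := measurable_enorm cphi.
have [sE mI II] := coarea_fun_ge0 mE (fun z => enorm_ge0 (phi z)).
have fin : {ae lam, forall y, (\int[cara (nS y)]_x (enorm (phi (x, y)))%:E < +oo)%E}.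
  have ii : lam.-integrable setT (fun y : TR => \int[cara (nS y)]_x (enorm (phi (x, y)))%:E)%E.
    apply/integrableP; split; first exact: mI.
    have I0 y : (0 <= \int[cara (nS y)]_x (enorm (phi (x, y)))%:E)%E.
      by apply: integral_ge0 => x _; rewrite lee_fin enorm_ge0.
    by under eq_integral do rewrite gee0_abs ?I0//; rewrite II.
  have := integrable_ae measurableT ii; apply: ae_imply => y /(_ Logic.I).
  rewrite ge0_fin_numE//.
  by apply: integral_ge0 => x _; rewrite lee_fin enorm_ge0.
have sec : {ae lam, forall y, forall i : 'I_n,
    measurable_fun [set: CS y] (fun x : CS y => (phi (x, y) 0 i)%:E)}.
  have F : Filter (nbhs (almost_everywhere lam)) by typeclasses eauto.
  apply: (@filter_forall _ _ _ _ F) => i.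
  by apply: (coarea_section (g := fun z => (phi z 0 i)%:E)); apply/measurable_EFinP; exact: cphi.
apply: (ae_imply2 _ fin sec) => y fy sy; split => //.
by apply: comp_measurable_omeasurable => i; apply/measurable_EFinP; exact: sy.
Qed.

(** Test functions [psi j] approach phi in L_1(||T||) at the rate 2^-(j+1). This makes the sum of
    the slice distances [d j] integrable, so they tend to 0 at almost every level without passing to
    a subsequence. [L1_ext_spec] then compares S_y(psi_j) with the extension at phi at these
    levels. *)
Lemma coarea_L1 (phi : 'rV[R]_n * R -> 'rV[R]_n) : L1 nT phi ->
  [/\ {ae lam, forall y, L1 (nS y) (fun x => phi (x, y))},
      lam.-integrable setT (fun y => (L1_ext U (S y) (fun x => phi (x, y)))%:E) &
      L1_ext Om T phi = \int[lam]_y L1_ext U (S y) (fun x => phi (x, y))].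
Proof.
move=> L1phi; have [mphi iphi] := L1phi; have cphi := omeasurable_comp_measurable mphi.
have sL1 := coarea_L1_section L1phi.
pose ep j : R := 1 / (2 ^ j.+1)%:R.
have ep0 j : 0 < ep j by rewrite divr_gt0// ltr0n expn_gt0.
have [psi hpsi] := choice (fun j => L1_dense bXR oOm rT L1phi (ep0 j)).
have tpsi j : test_function Om (psi j) by have [] := hpsi j.
have cdiff j : comp_measurable ((fun z => psi j z - phi z) : CT -> 'rV[R]_n).
  apply: comp_measurableB cphi; apply: (smooth_comp_measurable rT).
  by have [] := tpsi j.
pose d j (y : TR) : \bar R := (\int[cara (nS y)]_x (enorm (psi j (x, y) - phi (x, y)))%:E)%E.
have cd j : coarea_fun (fun z => (enorm (psi j z - phi z))%:E).
  apply: coarea_fun_ge0; first exact: (measurable_enorm (cdiff j)).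
  by move=> z; rewrite lee_fin enorm_ge0.
have md j : measurable_fun [set: TR] (d j) by have [] := cd j.
have d0 j y : (0 <= d j y)%E by apply: integral_ge0 => x _; rewrite lee_fin enorm_ge0.
have id j : (\int[lam]_y d j y <= (ep j)%:E)%E.
  by have [_ _ ->] := cd j; have [_ /ltW] := hpsi j.
have dcv : {ae lam, forall y, d j y @[j --> \oo] --> 0%E}.
  have mh : measurable_fun [set: TR] (fun y : TR => \sum_(j <oo) d j y)%E.
    by apply: ge0_emeasurable_sum => // j; exact: md.
  have ih : lam.-integrable setT (fun y : TR => \sum_(j <oo) d j y)%E.
    apply/integrableP; split; first exact: mh.
    under eq_integral do rewrite gee0_abs ?nneseries_ge0//.
    rewrite (integral_nneseries lam measurableT md)//.
    apply: (@le_lt_trans _ _ (\sum_(j <oo) (ep j)%:E)%E); last first.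
      by apply: le_lt_trans (epsilon_trick0 xpredT ler01) _; exact: ltry.
    apply: lee_nneseries => [j _ _|j _]; last exact: id.
    exact: integral_ge0.
  have := integrable_ae measurableT ih; apply: ae_imply => y /(_ Logic.I).
  rewrite ge0_fin_numE ?nneseries_ge0// => hoo.
  have := nneseries_tail_cvg hoo (fun j _ => d0 j y).
  apply: (@squeeze_cvge _ _ _ _ (fun=> 0%E)); last exact: cvg_cst.
  apply: nearW => N; rewrite d0/= -[leLHS]adde0.
  rewrite (nneseries_split _ 1)// addn1 big_nat1; apply: leeD => //.
  exact: nneseries_ge0.
pose s j (y : TR) : R := S y (fun x => psi j (x, y)).
have is_ j : lam.-integrable setT (EFin \o s j) by have [] := T_slices (tpsi j).
have sT j : T (psi j) = \int[lam]_y s j y by have [] := T_slices (tpsi j).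
pose L (y : TR) : R := L1_ext U (S y) (fun x => phi (x, y)).
have sLd : {ae lam, forall y, forall j, (`|s j y - L y|%:E <= 8 * d j y)%E}.
  apply: (ae_imply2 _ representable_ae sL1) => y ry ly j.
  exact: (L1_ext_spec bX oU (linS y) ry ly (test_function_slice y (tpsi j))).
have mL : measurable_fun [set: TR] L.
  apply/measurable_EFinP.
  (* The numbers [s j y] converge to [L y] only for almost all y; their lower limit is measurable
     and equals L there. *)
  apply: (ae_measurable_fun (mu := lam) (cara_complete (mu := @leb1 R))
    (f := fun y => limn_einf (fun j => (s j y)%:E))); last first.
    by apply: measurable_limn_einf => j; exact: measurable_int (is_ j).
  have F : Filter (nbhs (almost_everywhere lam)) by typeclasses eauto.
  apply: (@filterS2 _ _ F) dcv sLd => y dy sy _.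
  have : (s j y)%:E @[j --> \oo] --> (L y)%:E.
    apply: cvg_EFin; first exact: nearW.
    apply/cvgrPdist_le => e e0; have e8 : 0 < e / 8 by rewrite divr_gt0.
    move/fine_cvgP: dy => [dfin /cvgrPdist_lt/(_ _ e8) dlt].
    near=> j; have fj : d j y \is a fin_num by near: j; exact: dfin.
    have : `|0 - fine (d j y)| < e / 8 by near: j; exact: dlt.
    have r0 := fine_ge0 (d0 j y); have := sy j; rewrite -{1}(fineK fj) -EFinM lee_fin.
    rewrite distrC sub0r normrN /=.
    move: (fine (d j y)) r0 => r r0 h1; rewrite (ger0_norm r0) => h2.
    by apply: le_trans h1 _; lra.
  by move=> /cvg_limn_einf_sup[].
have mD j : measurable_fun [set: TR] (fun y : TR => `|s j y - L y|%:E).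
  apply/measurable_EFinP; apply: measurableT_comp; first exact: normr_measurable.
  by apply: measurable_funB => //; apply/measurable_EFinP; exact: measurable_int (is_ j).
have iD j : (\int[lam]_y `|s j y - L y|%:E <= 8 * (ep j)%:E)%E.
  apply: (@le_trans _ _ (\int[lam]_y (8 * d j y))%E).
    have m8 : measurable_fun [set: TR] (fun y : TR => 8 * d j y)%E by exact: measurable_funeM.
    apply: (ae_ge0_le_integral measurableT _ (mD j) _ m8).
    - by move=> y _.
    - by move=> y _; rewrite mule_ge0.
    - have F : Filter (nbhs (almost_everywhere lam)) by typeclasses eauto.
      by apply: (@filterS _ _ F) sLd => y h _; exact: h.
  rewrite (ge0_integralZl lam measurableT (md j))//.
  by apply: lee_wpmul2l.
have iDs j : lam.-integrable setT (EFin \o (fun y : TR => s j y - L y)).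
  apply/integrableP; split.
    apply/measurable_EFinP; apply: measurable_funB => //.
    by apply/measurable_EFinP; exact: measurable_int (is_ j).
  by apply: le_lt_trans (iD j) _; rewrite -EFinM ltry.
have iL : lam.-integrable setT (EFin \o L).
  have := integrableB measurableT (is_ 0%N) (iDs 0%N).
  apply: (eq_integrable measurableT) => y _ /=.
  by rewrite -EFinB; congr EFin; ring.
split => //.
apply: (L1_ext_unique bXR oOm linT rT L1phi) => e e0.
have [j hj] : exists j, 8 * ep j <= e.
  have e8 : 0 < e / 8 by rewrite divr_gt0.
  have [N _ hN] := near_infty_natSinv_lt (PosNum e8).
  exists N; have /= hN' := hN N (leqnn N).
  have : ep N <= N.+1%:R^-1.
    rewrite /ep div1r lef_pV2 ?posrE ?ltr0n ?expn_gt0// ler_nat.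
    by apply: ltnW; apply: leq_trans (ltn_expl N.+1 (ltnSn 1)).
  by move: hN'; move: (ep N) (N.+1%:R^-1) => u v; lra.
exists (psi j); split => //.
- have [_ /ltW h] := hpsi j; apply: le_trans h _; rewrite lee_fin; apply: le_trans hj.
  by rewrite ler_peMl// ?(ltW (ep0 _))// ler1n.
- rewrite sT -(RintegralB measurableT (is_ j) iL).
  apply: le_trans (le_normr_Rintegral measurableT (iDs j)) _.
  rewrite -lee_fin /Rintegral fineK; last first.
    rewrite ge0_fin_numE; last exact: integral_ge0.
    by apply: le_lt_trans (iD j) _; rewrite -EFinM ltry.
  by apply: le_trans (iD j) _; rewrite -EFinM lee_fin.
Unshelve. all: by end_near. Qed.

End coarea.

(** * Varifolds *)

Lemma closed_forall (T : topologicalType) (I : Type) (A : I -> set T) :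
  (forall i, closed (A i)) -> closed [set x | forall i, A i x].
Proof.
move=> cA; rewrite [X in closed X](_ : _ = \bigcap_(i in setT) A i).
  by apply: closed_bigI.
by apply/seteqP; split => [x h i _|x h i]; [exact: h|exact: (h i Logic.I)].
Qed.

Lemma closed_zero_set (R : realType) (T : topologicalType) (g : T -> R) : continuous g ->
  closed [set x | g x = 0].
Proof.
move=> cg; rewrite [X in closed X](_ : _ = (fun x => `|g x|) @^-1` [set r | r <= 0]).
  apply: closed_comp; last exact: closed_le.
  by move=> x _; apply: continuous_comp; [exact: cg|exact: norm_continuous].
by apply/seteqP; split => x /=; [move=> ->; rewrite normr0|rewrite normr_le0 => /eqP].
Qed.

(** * Compactness of the Grassmannian *)

Section grassmannian.
Variables (R : realType) (n m : nat).
Local Notation G := (@grassmann R n m).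

(** In the rank factorisation P = C R the two factors can be cancelled in P P = P, which leaves R C
    = 1; the trace of C R is that of R C. *)
Lemma trace_idempotent (P : 'M[R]_n) : P *m P = P -> \tr P = (\rank P)%:R.
Proof.
move=> PP; have := PP; rewrite -{1 2 3}(mulmx_base P) mulmxA -(mulmxA (col_base P)).
move=> /(row_free_inj (row_base_free P)).
rewrite -[RHS]mulmx1 => /(row_full_inj (col_base_full P)) h.
by rewrite -{1}(mulmx_base P) mxtrace_mulC h mxtrace1.
Qed.

(* Unlike the rank, the trace is continuous, so G(n,m) is closed. *)
Lemma grassmannE : G = [set P | [/\ P *m P = P, P^T = P & \tr P = m%:R]].
Proof.
apply/seteqP; split => P [PP PT].
  by move=> rP; split => //; rewrite trace_idempotent// rP.
by rewrite trace_idempotent// => /eqP; rewrite eqr_nat => /eqP rP; split.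
Qed.

(** For a symmetric idempotent matrix a diagonal entry is the sum of the squares of its row. So it
    dominates its own square, hence is at most 1, and it dominates the square of each entry of the
    row. *)
Lemma grassmann_le1 P i j : G P -> `|P i j| <= 1.
Proof.
move=> [PP PT _]; have E a : P a a = \sum_k P a k ^+ 2.
  rewrite -{1}PP mxE; apply: eq_bigr => k _.
  by rewrite -{2}PT mxE expr2.
have H a b : P a b ^+ 2 <= P a a.
  by rewrite E (bigD1 b)//= lerDl sumr_ge0// => k _; exact: sqr_ge0.
have P1 : P i i <= 1.
  have := H i i; have [|p0] := lerP (P i i) 0; first by move=> /le_trans h _; exact: h.
  by rewrite expr2 ger_pMr.
by rewrite -(@expr_le1 _ 2)// -normrX ger0_norm ?sqr_ge0// (le_trans (H i j)).
Qed.

Lemma vec_mx_continuous : continuous (@vec_mx R n n).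
Proof.
move=> v A [P hP PA].
have : \forall w \near v, forall i j, P i j (vec_mx w i j).
  have FF := @nbhs_filter ('rV[R]_(n * n)) v.
  apply: (@filter_forall _ _ _ _ FF) => i; apply: (@filter_forall _ _ _ _ FF) => j.
  have := hP i j; rewrite mxE => /(@coord_continuous _ _ _ 0 (mxvec_index i j) v).
  by apply: (@filterS _ _ FF) => w; rewrite mxE.
by apply: (@filterS _ _ (@nbhs_filter ('rV[R]_(n * n)) v)) => w h; exact: PA.
Qed.

Lemma compact_grassmann : compact G.
Proof.
(* Boundedness and closedness are checked on row vectors of length n^2, where the entries are smooth
   coordinate functions. *)
pose A : set 'rV[R]_(n * n) := [set v | G (vec_mx v)].
have -> : G = vec_mx @` A.
  apply/seteqP; split => [P GP|_ [v Av <-]//].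
  by exists (mxvec P); rewrite /A/= mxvecK.
apply: continuous_compact.
  by apply: continuous_subspaceT; exact: vec_mx_continuous.
apply: bounded_closed_compact.
  exists 1; split; first exact: num_real.
  move=> M M1 v Av; apply: le_trans (ltW M1).
  rewrite [leLHS](_ : _ = mx_norm v)// mx_normrE; apply: bigmax_le => // -[i k] _ /=; rewrite (ord1 i).
  case/mxvec_indexP: k => a b; have := grassmann_le1 a b Av; by rewrite mxE.
rewrite /A grassmannE.
pose c i j (v : 'rV[R]_(n * n)) : R := v 0 (mxvec_index i j).
have sc i j : smooth (c i j) by exact: smooth_coord.
pose F (q : 'I_n * 'I_n) (v : 'rV[R]_(n * n)) : R :=
  \sum_k c q.1 k v * c k q.2 v - c q.1 q.2 v.
have -> : [set v | (fun P => [/\ P *m P = P, P^T = P & \tr P = m%:R]) (@vec_mx R n n v)] =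
   [set v | forall q, F q v = 0] `&` ([set v | forall q : 'I_n * 'I_n, c q.2 q.1 v - c q.1 q.2 v = 0]
   `&` [set v | \sum_i c i i v - m%:R = 0]).
  apply/seteqP; split => v /=.
    move=> [/matrixP h1 /matrixP h2 h3]; split; last split.
    - move=> [i j]; have := h1 i j; rewrite /F /c !mxE /= => <-.
      by apply/eqP; rewrite subr_eq0; apply/eqP/eq_bigr => k _; rewrite !mxE.
    - by move=> [i j]; have := h2 i j; rewrite !mxE /c /= => ->; rewrite subrr.
    - by rewrite -h3; apply/eqP; rewrite subr_eq0; apply/eqP/eq_bigr => k _; rewrite !mxE.
  move=> [h1 [h2 h3]]; split.
  - apply/matrixP => i j; have /eqP := h1 (i, j); rewrite subr_eq0 => /eqP.
    by rewrite /c !mxE /= => <-; apply: eq_bigr => k _; rewrite !mxE.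
  - by apply/matrixP => i j; have /eqP := h2 (i, j); rewrite subr_eq0 => /eqP; rewrite !mxE.
  - move/eqP: h3; rewrite subr_eq0 => /eqP <-.
    by apply: eq_bigr => k _; rewrite !mxE.
apply: closedI; last apply: closedI.
- apply: closed_forall => q; apply: closed_zero_set; apply: smooth_continuous.
  by apply: smoothB => //; apply: smooth_sum => k _; exact: smoothM.
- apply: closed_forall => q; apply: closed_zero_set; apply: smooth_continuous.
  exact: smoothB.
- apply: closed_zero_set; apply: smooth_continuous.
  by apply: smoothB; [exact: smooth_sum|exact: smooth_cst].
Qed.

End grassmannian.

(** * The weight of a varifold *)

Section weight_theory.
Variables (R : realType) (n m : nat) (U : set 'rV[R]_n).
Variable V : {outer_measure set ('rV[R]_n * 'M[R]_n) -> \bar R}.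
Hypotheses (oU : open U) (rV : is_varifold m U V).
Local Notation G := (@grassmann R n m).
Local Notation w := (weight m V).

Lemma varifold_setX A : V (A `*` setT) = w A.
Proof.
rewrite -(radon_setI rV); apply/eqP; rewrite eq_le; apply/andP; split.
  by apply: le_outer_measure => -[x P] [[/= Ax _] [/= _ GP]].
rewrite /weight -(radon_setI rV (A `*` G)); apply: le_outer_measure.
by move=> [x P] [[/= Ax GP] [/= Ux _]].
Qed.

Lemma weight_over : measure_over U w.
Proof.
apply/eqP; rewrite eq_le outer_measure_ge0 andbT; case: rV => <- _ _ _ _.
by apply: le_outer_measure => -[x P] [/= nUx GP] [].
Qed.

Lemma cylinder_cara_weight E : V.-caratheodory (E `*` setT) -> w.-caratheodory E.
Proof.
move=> cE A; rewrite /weight (cE (A `*` G)); congr (V _ + V _)%E.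
  by apply/seteqP; split => -[x P] /=; [move=> [[? ?] [? _]]|move=> [[? ?] ?]].
apply/seteqP; split => -[x P] /=; last by move=> [[Ax nEx] GP]; split => // -[].
by move=> [[Ax GP] nE]; split => //; split => // Ex; apply: nE.
Qed.

Lemma open_fst (A : set 'rV[R]_n) : open A -> open (A `*` [set: 'M[R]_n]).
Proof. by move=> oA; apply: open_setX => //; exact: openT. Qed.

Lemma weight_radon : radon U w.
Proof.
have cO A : open A -> w.-caratheodory A.
  by move=> oA; apply: cylinder_cara_weight; apply: (radon_open_cara rV); exact: open_fst.
split.
- exact: weight_over.
- move=> K cK KU; apply: (radon_compact_lty rV).
    by apply: compact_setX => //; exact: compact_grassmann.
  by move=> [x P] [/= /KU].
- by move=> A oA; apply: cO; exact: openI.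
- move=> A oA; apply/eqP; rewrite eq_le; apply/andP; split; last first.
    by apply: ge_ereal_sup => _ [K [cK KA] <-]; exact: le_outer_measure.
  rewrite [leLHS](_ : _ = V ((A `*` setT) `&` (U `*` G))); last first.
    by rewrite (radon_setI rV) varifold_setX; exact: (measure_over_setI A weight_over).
  have [_ _ _ inn _] := rV; rewrite inn; last exact: open_fst.
  apply: ge_ereal_sup => _ [K [cK KA] <-]; apply: (@le_trans _ _ (w (fst @` K))).
    apply: le_outer_measure => -[x P] Kx; split; first by exists (x, P).
    by have [_ [_]] := KA _ Kx.
  apply: ereal_sup_ubound; exists (fst @` K) => //; split.
    apply: continuous_compact => //; apply: continuous_subspaceT.
    by move=> p; exact: cvg_fst.
  by move=> _ [[x P] /KA[[/= Ax _] [/= Ux _]] <-].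
- move=> A AU; apply/eqP; rewrite eq_le; apply/andP; split.
    apply: le_ereal_inf_tmp => _ [Z [oO AO] <-]; apply: le_outer_measure => x Ax.
    by split; [exact: AO|exact: AU].
  have AG : A `*` G `<=` U `*` G by move=> [x P] [/= /AU].
  rewrite [leRHS](_ : _ = V (A `*` G))//; have [_ _ _ _ out] := rV; rewrite out//.
  apply: le_ereal_inf_tmp => _ [W [oW AW] <-].
  (* The points whose whole fibre lies in W. As G(n,m) is compact, they form an open set, which
     replaces W by a cylinder. *)
  pose Z := [set x | forall P, G P -> W (x, P)].
  have oO : open Z.
    rewrite openE => x Ox; rewrite /interior.
    have /compact_near_coveringP := @compact_grassmann R n m.
    move=> /(_ _ (nbhs x) (fun y P => W (y, P))); apply => P GP.
    have : nbhs (x, P) W by apply: open_nbhs_nbhs; split => //; exact: Ox.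
    by case=> -[B C] /= [nB nC] BC; exists (C, B) => //= -[u v] [/= Cu Bv]; exact: BC.
  apply: (@le_trans _ _ (w (Z `&` U))).
    apply: ereal_inf_lbound; exists Z => //; split => // x Ax P GP.
    by apply: AW; split.
  apply: le_outer_measure => -[x P] [[/= Ox Ux] GP]; split; [exact: Ox|by split].
Qed.

(** On a piece of finite weight, E differs by a ||V|| null set from a countable intersection of open
    sets. The cylinder over the latter is V measurable, and the cylinder over a ||V|| null set is V
    null. *)
Lemma varifold_cylinder_cara E : w.-caratheodory E -> V.-caratheodory (E `*` setT).
Proof.
move=> cE; have [H [oH Hle HK HKU]] := exhaustion oU.
have rw := weight_radon.
have HU k : H k `<=` U by have [K [_ KU HkK]] := HK k; exact: subset_trans KU.
have woo k : (w (H k) < +oo)%E.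
  have [K [cK KU HkK]] := HK k; apply: le_lt_trans (radon_compact_lty rw cK KU).
  exact: le_outer_measure.
pose F k := E `&` H k.
have cF k : w.-caratheodory (F k).
  by apply: caratheodory_measurable_setI => //; exact: (radon_open_cara rw).
have Foo k : (w (F k) < +oo)%E.
  by apply: le_lt_trans (woo k); apply: le_outer_measure => x [].
have cVF k : V.-caratheodory (F k `*` setT).
  have HZ j : exists Z, [/\ open Z, F k `<=` Z & (w Z <= w (F k) + (j.+1%:R^-1)%:E)%E].
    have j0 : 0 < j.+1%:R^-1 :> R by rewrite invr_gt0.
    have [Z [oO FO Ole]] := radon_outer rw j0 (Foo k); exists Z; split => // x Fx.
    by apply: FO; split => //; case: Fx => _ /HU.
  have [Z hZ] := choice HZ.
  pose B := \bigcap_j Z j.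
  have FB : F k `<=` B by move=> x Fx j _; have [_ h _] := hZ j; exact: h.
  have N0 : w (B `\` F k) = 0%E.
    apply/eqP; rewrite eq_le outer_measure_ge0 andbT; apply/lee_addgt0Pr => e e0; rewrite add0e.
    have [j hj] : exists j : nat, j.+1%:R^-1 < e.
      have [N _ hN] := near_infty_natSinv_lt (PosNum e0).
      by exists N; exact: (hN N (leqnn N)).
    have [oO FO Ole] := hZ j.
    have fin : w (F k) \is a fin_num by rewrite ge0_fin_numE ?outer_measure_ge0.
    apply: (@le_trans _ _ (w (Z j `\` F k))).
      by apply: le_outer_measure => x [Bx nFx]; split => //; exact: Bx.
    move: Ole; rewrite (cF k (Z j)) (_ : Z j `&` F k = F k); last first.
      by apply/seteqP; split => [x []//|x Fx]; split => //; exact: FO.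
    rewrite leeD2lE// => /le_trans; apply; rewrite lee_fin; exact: ltW.
  rewrite (_ : F k `*` setT = (B `*` setT) `\` ((B `\` F k) `*` setT)); last first.
    apply/seteqP; split => -[x P] /=; first by move=> [Fx _]; split; [split => //; exact: FB|move=> [[]]].
    by move=> [[Bx _] h]; split => //; apply: contrapT => nF; apply: h.
  apply: caratheodory_measurable_setD.
    rewrite (_ : B `*` setT = \bigcap_j (Z j `*` setT)); last first.
      apply/seteqP; split => -[x P] /=; first by move=> [Bx _] j _; split => //; exact: Bx.
      by move=> h; split => // j _; have [] := h j Logic.I.
    apply: (@bigcapT_measurable _ (caratheodory_type V)) => j.
    by apply: (radon_open_cara rV); apply: open_fst; have [] := hZ j.
  by apply: cara_null; rewrite varifold_setX.
have [|||_ //] := @outer_cvg R _ V (U `*` G) (E `*` setT) (fun k => F k `*` setT)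
  (let: And5 h _ _ _ _ := rV in h) cVF.
- by move=> k l kl [x P] [/= [Ex Hx] _]; split => //; split => //; exact: Hle Hx.
- by move=> k [x P] [/= [Ex _] _].
- move=> [x P] [/= [Ex _] [Ux _]].
  have [|_ ->|k hk] := HKU [set x]; first exact: compact_set1.
    by [].
  by exists k => //; split => //; split => //; exact: hk.
Qed.

End weight_theory.

(** * Integration with respect to a restricted outer measure *)

Section restriction.
Variables (R : realType) (X : pointedType) (mu : {outer_measure set X -> \bar R}).
Variables (B : set X).
Hypothesis cB : mu.-caratheodory B.
Local Notation TX := (caratheodory_type mu).
Local Notation nu := (outer_restr mu B).

Lemma outer_restr_cara A : mu.-caratheodory A -> (nu).-caratheodory A.
Proof.
move=> cA Z; rewrite /outer_restr /= (cA (Z `&` B)).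
by rewrite setIAC [Z `&` ~` A `&` B]setIAC.
Qed.

Lemma ge0_integral_outer_restr (f : X -> \bar R) :
  measurable_fun [set: TX] (f : TX -> \bar R) -> (forall x, 0 <= f x)%E ->
  (\int[cara nu]_x f x = \int[cara mu]_(x in (B : set TX)) f x)%E.
Proof.
(* The two integrals live on different sigma-algebras. Measurability for [mu] implies measurability
   for [nu], so the identity is a measurable map along which the integral is pushed forward. *)
move=> mf f0; pose phi : caratheodory_type nu -> TX := id.
have mphi : measurable_fun setT phi.
  by move=> _ A mA; rewrite setTI; exact: outer_restr_cara.
rewrite -[LHS](@ge0_integral_pushforward _ _ _ _ R phi mphi (cara nu) setT f measurableT mf) //.
pose m1 := pushforward (cara nu) phi.
have mC : measurable (~` B : set TX) by exact: measurableC.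
rewrite (@ge0_negligible_integral _ TX R m1 setT (~` B))//.
- rewrite setTD setCK; apply: eq_measure_integral => A mA AB.
  rewrite /m1 /pushforward /= /outer_restr.
  by congr (mu _); apply/seteqP; split => [x []//|x Ax]; split => //; exact: AB.
- by change (mu (~` B `&` B) = 0%E); rewrite setICl outer_measure0.
Qed.

Lemma Rintegral_outer_restr (g : X -> R) : measurable_fun [set: TX] (g : TX -> R) ->
  \int[cara nu]_x g x = \int[cara mu]_x (\1_B x * g x).
Proof.
move=> mg; rewrite /Rintegral; congr fine.
have mE : measurable_fun [set: TX] (EFin \o (g : TX -> R)) by apply/measurable_EFinP.
transitivity (\int[cara mu]_(x in (B : set TX)) (g x)%:E)%E.
  rewrite integralE [RHS]integralE; congr (_ - _)%E.
    by apply: ge0_integral_outer_restr => //; exact: measurable_funepos.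
  by apply: ge0_integral_outer_restr => //; exact: measurable_funeneg.
rewrite [LHS]integral_mkcond; apply: (@eq_integral _ TX R (cara mu) setT) => x _; rewrite /patch indicE.
by case: ifPn => _; rewrite ?mul1r ?mul0r.
Qed.

End restriction.

(** * The integrand of the first variation *)

Section tangential_divergence.
Variables (R : realType) (n m : nat) (U : set 'rV[R]_n).
Variable V : {outer_measure set ('rV[R]_n * 'M[R]_n) -> \bar R}.
Hypotheses (oU : open U) (rV : is_varifold m U V).
Local Notation G := (@grassmann R n m).
Local Notation CV := (caratheodory_type V).
Implicit Types theta psi : 'rV[R]_n -> 'rV[R]_n.

Definition tdiv theta (z : 'rV[R]_n * 'M[R]_n) : R := \tr (z.2^T *m jacobian theta z.1).

Lemma tdivE theta z : differentiable theta z.1 ->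
  tdiv theta z = \sum_i \sum_j z.2 i j * 'D_(delta_mx 0 i) theta z.1 0 j.
Proof.
move=> dt; rewrite /tdiv /mxtrace exchange_big /=; apply: eq_bigr => j _.
rewrite mxE; apply: eq_bigr => i _; rewrite mxE; congr (_ * _).
by rewrite /jacobian mxE deriveE.
Qed.

Lemma tdiv_linear a theta psi z : differentiable theta z.1 -> differentiable psi z.1 ->
  tdiv (fun x => a *: theta x + psi x) z = a * tdiv theta z + tdiv psi z.
Proof.
move=> dt dp.
have daz : differentiable (a \*: theta) z.1 by exact: differentiableZ.
have dd : differentiable (fun x => a *: theta x + psi x) z.1 by exact: differentiableD.
rewrite !tdivE// mulr_sumr -big_split /=; apply: eq_bigr => i _.
rewrite mulr_sumr -big_split /=; apply: eq_bigr => j _.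
rewrite (_ : (fun x => a *: theta x + psi x) = (a \*: theta) + psi)//.
rewrite deriveD; [|exact: diff_derivable..].
rewrite deriveZ; last exact: diff_derivable.
by rewrite !mxE; ring.
Qed.

Lemma test_function_derive theta v : test_function U theta ->
  test_function U ('D_v theta) /\ spt ('D_v theta) `<=` spt theta.
Proof.
move=> [st ct tU].
have h : spt ('D_v theta) `<=` spt theta.
  apply: spt_sub; first exact: closed_spt.
  move=> x hx; apply: contrapT => nx; move/eqP: hx; apply.
  have : \forall y \near x, theta y = 0.
    have : nbhs x (~` spt theta).
      by apply: open_nbhs_nbhs; split => //; apply: closed_openC; exact: closed_spt.
    by apply: filterS => y ny; exact: spt_eq0.
  move=> h; have [v0|v0] := eqVneq v 0.
    by rewrite v0 deriveE ?linear0//; exact: smooth_differentiable.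
  rewrite (@near_eq_derive _ _ _ theta (fun=> 0) x v h); exact: derive_cst.
split => //; split; [exact: smooth_derive| |exact: subset_trans tU].
by apply: (@subclosed_compact _ _ (spt theta)) => //; exact: closed_spt.
Qed.

Lemma measurable_tdiv theta : smooth theta -> measurable_fun [set: CV] (tdiv theta : CV -> R).
Proof.
move=> st.
have -> : tdiv theta = fun z => \sum_i \sum_j z.2 i j * 'D_(delta_mx 0 i) theta z.1 0 j.
  by apply/funext => z; rewrite tdivE//; exact: smooth_differentiable.
have mc (g : 'rV[R]_n * 'M[R]_n -> R) : continuous g -> measurable_fun [set: CV] (g : CV -> R).
  by move=> cg; apply: (@omeasurable_measurable _ _ V setT); exact: (radon_continuous rV).
apply: measurable_sum => i; apply: measurable_sum => j; apply: measurable_funM; apply: mc.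
  move=> z; apply: (@continuous_comp _ _ _ snd (fun M : 'M[R]_n => M i j)); first exact: cvg_snd.
  exact: coord_continuous.
move=> z; apply: (@continuous_comp _ _ _ fst (fun x => 'D_(delta_mx 0 i) theta x 0 j)).
  exact: cvg_fst.
apply: (@continuous_comp _ _ _ ('D_(delta_mx 0 i) theta) (fun M : 'rV[R]_n => M 0 j)).
  by apply: smooth_continuous; exact: smooth_derive.
exact: coord_continuous.
Qed.

Lemma tdiv_bound theta : test_function U theta -> exists2 B : R, 0 <= B &
  forall z, G z.2 -> `|tdiv theta z| <= B * \1_(spt theta) z.1.
Proof.
move=> tt; have [st _ _] := tt.
have H i : exists M : R, 0 <= M /\ forall x, enorm ('D_(delta_mx 0 i) theta x) <= M.
  by apply: test_function_bounded; exact: (test_function_derive (delta_mx 0 i) tt).1.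
have [M hM] := choice H.
exists (\sum_(i < n) \sum_(j < n) M i).
  by apply: sumr_ge0 => i _; apply: sumr_ge0 => j _; have [] := hM i.
move=> [x P] /= GP; rewrite tdivE /=; last exact: smooth_differentiable.
rewrite indicE; have [sx|sx] := boolP (x \in spt theta); last first.
  rewrite mulr0 big1 ?normr0// => i _; apply: big1 => j _.
  have -> : 'D_(delta_mx 0 i) theta x = 0.
    have ns : ~ spt ('D_(delta_mx 0 i) theta) x.
      move=> h; have h' := (test_function_derive (delta_mx 0 i) tt).2 x h.
      by move/negP: sx; apply; rewrite inE.
    exact: (spt_eq0 ns).
  by rewrite mxE mulr0.
rewrite mulr1; apply: le_trans (ler_norm_sum _ _ _) _; apply: ler_sum => i _.
apply: le_trans (ler_norm_sum _ _ _) _; apply: ler_sum => j _.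
rewrite normrM -[leRHS]mul1r; apply: ler_pM => //; first exact: (grassmann_le1 _ _ GP).
by apply: le_trans (coord_le_enorm _ _) _; have [] := hM i.
Qed.

Lemma varifold_ae : {ae cara V, forall z, (U `*` G) z}.
Proof.
exists (~` (U `*` G)); split.
- by apply: caratheodory_measurable_setC; exact: (radon_dom_cara rV).
- by case: rV.
- by [].
Qed.

Lemma integrable_tdiv (u : 'rV[R]_n * 'M[R]_n -> R) (C : R) theta :
  measurable_fun [set: CV] (u : CV -> R) -> (forall z, `|u z| <= C) -> test_function U theta ->
  (cara V).-integrable setT (EFin \o (fun z : CV => u z * tdiv theta z)).
Proof.
move=> mu uC tt; have [st ct tU] := tt; have [B B0 hB] := tdiv_bound tt.
have C0 : 0 <= C by apply: le_trans (uC (0, 0)).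
have mm : measurable_fun [set: CV] (fun z : CV => u z * tdiv theta z).
  by apply: measurable_funM => //; exact: measurable_tdiv.
have cK : V.-caratheodory (spt theta `*` setT).
  apply: (varifold_cylinder_cara oU rV); apply: (radon_closed_cara (weight_radon oU rV)).
  exact: closed_spt.
have m1 : measurable_fun [set: CV] (fun z : CV => (\1_(spt theta `*` setT) z)%:E : \bar R).
  by apply/measurable_EFinP; exact: measurable_indic.
apply/integrableP; split; first by apply/measurable_EFinP.
apply: (@le_lt_trans _ _ (\int[cara V]_z ((C * B)%:E * (\1_(spt theta `*` setT) z)%:E))%E); last first.
  rewrite (ge0_integralZl (cara V) measurableT m1)//; last by rewrite lee_fin mulr_ge0.
  rewrite (integral_indic (cara V) measurableT cK) setIT.
  rewrite [X in (_ * X)%E](_ : _ = weight m V (spt theta)); last exact: (varifold_setX rV).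
  have fw : weight m V (spt theta) \is a fin_num.
    rewrite ge0_fin_numE ?outer_measure_ge0//.
    exact: (radon_compact_lty (weight_radon oU rV) ct tU).
  by rewrite -(fineK fw) -EFinM ltry.
(* The bound of [tdiv] uses that the entries of P are at most 1, which is true on G(n,m) only, hence
   V almost everywhere. *)
apply: (ae_ge0_le_integral measurableT).
- by move=> z _.
- by apply/measurable_EFinP; apply: measurableT_comp mm; exact: normr_measurable.
- by move=> z _; rewrite -EFinM lee_fin !mulr_ge0.
- exact: measurable_funeM.
- apply: (ae_imply _ varifold_ae) => -[x P] [/= Ux GP] _.
  rewrite -EFinM lee_fin normrM -mulrA; apply: ler_pM => //.
  apply: le_trans (hB (x, P) GP) _; rewrite /= !indicE; apply: ler_wpM2l => //.
  rewrite ler_nat; case: (boolP (x \in _)) => // xs.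
  by rewrite mem_set//; split => //=; rewrite inE in xs.
Qed.

Lemma linear_first_variation : linear_on U (first_variation V).
Proof.
move=> a theta psi tt tp; have [st _ _] := tt; have [sp _ _] := tp.
have E (phi : 'rV[R]_n -> 'rV[R]_n) : first_variation V phi = \int[cara V]_z tdiv phi z by [].
have i1 phi : test_function U phi -> (cara V).-integrable setT (EFin \o (fun z : CV => tdiv phi z)).
  move=> tphi; have m1 : measurable_fun [set: CV] ((fun=> 1) : CV -> R) by exact: measurable_cst.
  have n1 (z : 'rV[R]_n * 'M[R]_n) : `|1 : R| <= 1 by rewrite normr1.
  have := integrable_tdiv m1 n1 tphi.
  by apply: (eq_integrable measurableT) => z _ /=; rewrite mul1r.
have i2 : (cara V).-integrable setT (EFin \o (fun z : CV => a * tdiv theta z)).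
  have := integrableZl measurableT a (i1 _ tt).
  by apply: (eq_integrable measurableT) => z _ /=.
rewrite !E (_ : a * _ = \int[cara V]_z (a * tdiv theta z)); last first.
  by rewrite RintegralZl//; exact: i1.
rewrite -(RintegralD measurableT i2 (i1 _ tp)); apply: eq_Rintegral => z _.
by rewrite tdiv_linear//; exact: smooth_differentiable.
Qed.

Lemma fst_measurable (a : 'rV[R]_n -> R) :
  measurable_fun [set: caratheodory_type (weight m V)] (a : caratheodory_type (weight m V) -> R) ->
  measurable_fun [set: CV] (fun z : CV => a z.1).
Proof.
move=> ma _ Y mY; rewrite setTI.
have := ma measurableT Y mY; rewrite setTI => /(varifold_cylinder_cara oU rV).
rewrite (_ : (a @^-1` Y) `*` setT = (fun z : CV => a z.1) @^-1` Y)//.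
by apply/seteqP; split => [[x P] []|[x P]].
Qed.

End tangential_divergence.

(** * The boundary functional of a bounded function *)

Section level_functional.
Variables (R : realType) (n m : nat) (U : set 'rV[R]_n).
Variable V : {outer_measure set ('rV[R]_n * 'M[R]_n) -> \bar R}.
Hypotheses (oU : open U) (rV : is_varifold m U V) (rdV : radon U (dvar U V)).
Local Notation dV := (first_variation V).
Local Notation mu := (variation_measure U (first_variation V)).
Local Notation w := (weight m V).
Local Notation CV := (caratheodory_type V).
Local Notation Cw := (caratheodory_type w).
Local Notation Cmu := (caratheodory_type mu).
Implicit Types (theta psi : 'rV[R]_n -> 'rV[R]_n) (a b : 'rV[R]_n -> R).

Let bX : has_bumps 'rV[R]_n := @has_bumps_row R n.
Let lin := linear_first_variation oU rV.

(** Both ||delta V|| and ||V|| occur: the first in the extension of delta V to the field a theta,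
    the second in the integral over V of a function of x times [tdiv]. *)
Definition admissible a := [/\ measurable_fun [set: Cmu] (a : Cmu -> R),
  measurable_fun [set: Cw] (a : Cw -> R) & exists C : R, forall x, `|a x| <= C].

(* [a] plays the part of [gamma \o f] in the defining identity of T(V). *)
Definition Lam a theta : R := L1_ext U dV (fun x => a x *: theta x) -
  \int[cara V]_z (a z.1 * tdiv theta z).

Lemma admissible_lin (c : R) a b : admissible a -> admissible b ->
  admissible (fun x => c * a x + b x).
Proof.
move=> [m1 m2 [A hA]] [m3 m4 [B hB]]; split.
- apply: measurable_funD => //; apply: measurable_funM => //; exact: measurable_cst.
- apply: measurable_funD => //; apply: measurable_funM => //; exact: measurable_cst.
- exists (`|c| * A + B) => x; apply: le_trans (ler_normD _ _) _; apply: lerD => //.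
  by rewrite normrM; exact: ler_wpM2l.
Qed.

Lemma admissible0 : admissible (fun=> 0).
Proof.
by split; [exact: measurable_cst|exact: measurable_cst|exists 0 => x; rewrite normr0].
Qed.

Lemma L1_admissible a theta : admissible a -> test_function U theta ->
  L1 mu (fun x => a x *: theta x).
Proof.
move=> [ma _ [C hC]] tt; have [st _ _] := tt.
have C0 : 0 <= C by apply: le_trans (hC 0).
have mt := smooth_comp_measurable rdV st.
have mat := comp_measurable_scale ma mt.
split; first exact: comp_measurable_omeasurable mat.
apply: (@le_lt_trans _ _ (\int[cara mu]_x (C%:E * (enorm (theta x))%:E))%E).
  apply: (@ge0_le_integral _ _ _ (cara mu) setT measurableT).
  - by move=> x _; rewrite lee_fin enorm_ge0.
  - exact: measurable_enorm mat.
  - by apply: measurable_funeM; exact: measurable_enorm mt.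
  - by move=> x _; rewrite -EFinM lee_fin enormZ; apply: ler_wpM2r; rewrite ?enorm_ge0.
rewrite (ge0_integralZl (cara mu) measurableT (measurable_enorm mt))//; last first.
  by move=> x _; rewrite lee_fin enorm_ge0.
have := integral_enorm_lty rdV tt.
have : (0 <= \int[cara mu]_x (enorm (theta x))%:E)%E.
  by apply: integral_ge0 => x _; rewrite lee_fin enorm_ge0.
case: (\int[cara mu]_x (enorm (theta x))%:E)%E => [r _ _|_|//]; last by rewrite ltxx.
by rewrite -EFinM ltry.
Qed.

Lemma tdiv_admissible a theta : admissible a -> test_function U theta ->
  (cara V).-integrable setT (EFin \o (fun z : CV => a z.1 * tdiv theta z)).
Proof.
move=> [_ ma [C hC]] tt.
have mf := fst_measurable oU rV ma.
exact: (integrable_tdiv oU rV mf (fun z => hC z.1) tt).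
Qed.

Lemma Lam_linear_l (c : R) a b theta : admissible a -> admissible b -> test_function U theta ->
  Lam (fun x => c * a x + b x) theta = c * Lam a theta + Lam b theta.
Proof.
move=> aa ab tt; have aab := admissible_lin c aa ab.
have la := L1_admissible aa tt; have lb := L1_admissible ab tt.
have lab := L1_admissible aab tt.
have E : (fun x => (c * a x + b x) *: theta x) = fun x => c *: (a x *: theta x) + b x *: theta x.
  by apply/funext => x; rewrite scalerDl scalerA.
rewrite /Lam E (L1_ext_linear bX oU lin rdV la lb); last by rewrite -E.
have ia := tdiv_admissible aa tt; have ib := tdiv_admissible ab tt.
have ica : (cara V).-integrable setT (EFin \o (fun z : CV => c * (a z.1 * tdiv theta z))).
  have := integrableZl measurableT c ia.
  by apply: (eq_integrable measurableT) => z _ /=.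
have H : \int[cara V]_z ((c * a z.1 + b z.1) * tdiv theta z) =
    c * \int[cara V]_z (a z.1 * tdiv theta z) + \int[cara V]_z (b z.1 * tdiv theta z).
  rewrite (_ : c * _ = \int[cara V]_z (c * (a z.1 * tdiv theta z))); last by rewrite RintegralZl.
  rewrite -(RintegralD measurableT ica ib); apply: eq_Rintegral => z _.
  by rewrite mulrDl mulrA.
have alg (p q r s : R) : c * p + q - (c * r + s) = c * (p - r) + (q - s) by ring.
by rewrite [X in _ - X = _]H; exact: alg.
Qed.

Lemma Lam_linear_r (c : R) a theta psi : admissible a -> test_function U theta ->
  test_function U psi ->
  Lam a (fun x => c *: theta x + psi x) = c * Lam a theta + Lam a psi.
Proof.
move=> aa tt tp.
have tc : test_function U (fun x => c *: theta x + psi x).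
  by apply: test_functionD => //; exact: test_functionZ.
have l1 := L1_admissible aa tt; have l2 := L1_admissible aa tp.
have l3 := L1_admissible aa tc.
have E : (fun x => a x *: (c *: theta x + psi x)) = fun x => c *: (a x *: theta x) + a x *: psi x.
  by apply/funext => x; rewrite scalerDr !scalerA mulrC.
rewrite /Lam E (L1_ext_linear bX oU lin rdV l1 l2); last by rewrite -E.
have i1 := tdiv_admissible aa tt; have i2 := tdiv_admissible aa tp.
have ic : (cara V).-integrable setT (EFin \o (fun z : CV => c * (a z.1 * tdiv theta z))).
  have := integrableZl measurableT c i1.
  by apply: (eq_integrable measurableT) => z _ /=.
have H : \int[cara V]_z (a z.1 * tdiv (fun x => c *: theta x + psi x) z) =
    c * \int[cara V]_z (a z.1 * tdiv theta z) + \int[cara V]_z (a z.1 * tdiv psi z).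
  transitivity (\int[cara V]_z (c * (a z.1 * tdiv theta z)) + \int[cara V]_z (a z.1 * tdiv psi z)).
    rewrite -(RintegralD measurableT ic i2); apply: eq_Rintegral => z _.
    have [st _ _] := tt; have [sp _ _] := tp.
    rewrite tdiv_linear; [|exact: smooth_differentiable|exact: smooth_differentiable].
    by rewrite mulrDr mulrCA.
  by congr (_ + _); exact: (RintegralZl c measurableT i1).
have alg (p q r s : R) : c * p + q - (c * r + s) = c * (p - r) + (q - s) by ring.
by rewrite [X in _ - X = _]H; exact: alg.
Qed.

Lemma Lam0 theta : test_function U theta -> Lam (fun=> 0) theta = 0.
Proof.
move=> tt; have := Lam_linear_l (-1) admissible0 admissible0 tt.
rewrite (_ : (fun x : 'rV[R]_n => -1 * 0 + 0) = fun=> 0 :> R); last first.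
  by apply/funext => x; rewrite mulr0 addr0.
by rewrite mulN1r addNr.
Qed.

Lemma admissible_sum (N : nat) (c : nat -> R) (a : nat -> 'rV[R]_n -> R) :
  (forall j, admissible (a j)) -> admissible (fun x => \sum_(j < N) c j * a j x).
Proof.
move=> aa; elim: N => [|N IH].
  by rewrite (_ : (fun x => _) = fun=> 0); [exact: admissible0|apply/funext => x; rewrite big_ord0].
rewrite (_ : (fun x => _) = fun x => c N * a N x + \sum_(j < N) c j * a j x).
  exact: admissible_lin.
by apply/funext => x; rewrite big_ord_recr addrC.
Qed.

Lemma Lam_sum (N : nat) (c : nat -> R) (a : nat -> 'rV[R]_n -> R) theta :
  (forall j, admissible (a j)) -> test_function U theta ->
  Lam (fun x => \sum_(j < N) c j * a j x) theta = \sum_(j < N) c j * Lam (a j) theta.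
Proof.
move=> aa tt; elim: N => [|N IH].
  rewrite big_ord0 (_ : (fun x => _) = fun=> 0); first exact: Lam0.
  by apply/funext => x; rewrite big_ord0.
rewrite (_ : (fun x => _) = fun x => c N * a N x + \sum_(j < N) c j * a j x).
  by rewrite Lam_linear_l//; [rewrite big_ord_recr /= addrC IH|exact: admissible_sum].
by apply/funext => x; rewrite big_ord_recr addrC.
Qed.

Lemma L1_integral_integrable theta : test_function U theta ->
  (cara mu).-integrable setT (EFin \o (fun x : Cmu => enorm (theta x))).
Proof.
move=> tt; have [st _ _] := tt; apply/integrableP; split.
  exact: (measurable_enorm (smooth_comp_measurable rdV st)).
under eq_integral do rewrite gee0_abs ?lee_fin ?enorm_ge0//.
exact: (integral_enorm_lty rdV tt).
Qed.

Lemma L1_ext_admissible_le a theta : admissible a -> test_function U theta ->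
  `|L1_ext U dV (fun x => a x *: theta x)| <= 8 * \int[cara mu]_x (`|a x| * enorm (theta x)).
Proof.
move=> aa tt; have la := L1_admissible aa tt; have [_ lty] := la.
have := L1_ext_bound bX oU lin rdV la.
rewrite -lee_fin => h; apply: le_trans h _; rewrite EFinM; apply: lee_wpmul2l => //.
rewrite /Rintegral fineK.
  by rewrite le_eqVlt; apply/orP; left; apply/eqP; apply: eq_integral => x _; rewrite enormZ.
rewrite ge0_fin_numE; last by apply: integral_ge0 => x _; rewrite lee_fin mulr_ge0 ?enorm_ge0.
rewrite (_ : (fun x => _) = fun x => (enorm (a x *: theta x))%:E)//.
by apply/funext => x; rewrite enormZ.
Qed.

(** One M serves for all a with |a| <= 1; applied to the indicators of {f > y} it bounds S_y(theta)
    independently of y. *)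
Lemma Lam_bound theta : test_function U theta -> exists M : R, forall a, admissible a ->
  (forall x, `|a x| <= 1) -> `|Lam a theta| <= M.
Proof.
move=> tt; exists (8 * \int[cara mu]_x enorm (theta x) + \int[cara V]_z `|tdiv theta z|).
move=> a aa a1; apply: le_trans (ler_normB _ _) _; apply: lerD.
  apply: le_trans (L1_ext_admissible_le aa tt) _; rewrite ler_pM2l//.
  apply: (le_Rintegral measurableT).
  - apply: (le_integrable measurableT _ _ (L1_integral_integrable tt)).
      have [ma _ _] := aa; have [st _ _] := tt.
      apply/measurable_EFinP; apply: measurable_funM.
        exact: (measurableT_comp (@normr_measurable R setT) ma).
      by apply/measurable_EFinP; exact: (measurable_enorm (smooth_comp_measurable rdV st)).
    move=> x _ /=; rewrite lee_fin [leRHS]ger0_norm ?enorm_ge0// normrM normr_id.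
    by rewrite [`|enorm _|]ger0_norm ?enorm_ge0// ler_piMl ?enorm_ge0.
  - exact: L1_integral_integrable.
  - by move=> x _; rewrite ler_piMl ?enorm_ge0.
have i1 := tdiv_admissible aa tt.
have i2 : (cara V).-integrable setT (EFin \o (fun z : CV => `|tdiv theta z|)).
  have m1 : measurable_fun [set: CV] ((fun=> 1) : CV -> R) by exact: measurable_cst.
  have n1 (z : 'rV[R]_n * 'M[R]_n) : `|1 : R| <= 1 by rewrite normr1.
  have := integrable_abse (integrable_tdiv oU rV m1 n1 tt).
  by apply: (eq_integrable measurableT) => z _ /=; rewrite mul1r.
apply: le_trans (le_normr_Rintegral measurableT i1) _.
apply: (le_Rintegral measurableT) => //; first exact: (integrable_abse i1).
by move=> z _; rewrite normrM ler_piMl.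
Qed.

Lemma Lam_cvg (a : nat -> 'rV[R]_n -> R) a0 (C : R) theta : (forall k, admissible (a k)) ->
  admissible a0 -> (forall k x, `|a k x| <= C) -> (forall x, a k x @[k --> \oo] --> a0 x) ->
  test_function U theta -> Lam (a k) theta @[k --> \oo] --> Lam a0 theta.
Proof.
move=> aa aa0 aC acv tt; have [st _ _] := tt.
have C0 : 0 <= C by apply: le_trans (aC 0%N 0).
have a0C x : `|a0 x| <= C.
  by apply: (cvgr_to_le (cvg_norm (acv x))); apply: nearW => k; exact: aC.
apply: cvgB; last first.
  apply: (@Rintegral_dominated_cvg _ _ _ (cara V) setT _ _
    (fun z => C * `|tdiv theta z|) measurableT).
  - by move=> k; apply/measurable_EFinP; exact: measurable_int (tdiv_admissible (aa k) tt).
  - by move=> z _; apply: cvgMr_tmp; exact: acv.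
  - have mC : measurable_fun [set: CV] ((fun=> C) : CV -> R) by exact: measurable_cst.
    have nC (z : 'rV[R]_n * 'M[R]_n) : `|C| <= C by rewrite ger0_norm.
    have := integrable_abse (integrable_tdiv oU rV mC nC tt).
    by apply: (eq_integrable measurableT) => z _ /=; rewrite normrM (ger0_norm C0).
  - by move=> k z _; rewrite normrM; apply: ler_wpM2r.
(* [L1_ext] is not given as an integral, so dominated convergence is applied to the bound 8 \int
   |a_k - a_0| |theta| d||delta V|| of the difference. *)
have adk k : admissible (fun x => -1 * a0 x + a k x) by exact: admissible_lin.
have H : \int[cara mu]_x (`|-1 * a0 x + a k x| * enorm (theta x)) @[k --> \oo] -->
    \int[cara mu]_x (0 : R).
  have me : measurable_fun [set: Cmu] (fun x : Cmu => enorm (theta x)).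
    by apply/measurable_EFinP; exact: (measurable_enorm (smooth_comp_measurable rdV st)).
  apply: (@Rintegral_dominated_cvg _ _ _ (cara mu) setT _ _
    (fun x => (C + C) * enorm (theta x)) measurableT).
  - move=> k; apply: measurable_funM => //; have [mk _ _] := adk k.
    exact: (measurableT_comp (@normr_measurable R setT) mk).
  - move=> x _; rewrite -(mul0r (enorm (theta x))); apply: cvgMr_tmp.
    rewrite -[X in _ --> X](normr0 R); apply: cvg_norm.
    rewrite (_ : 0 = -1 * a0 x + a0 x); last by rewrite mulN1r addNr.
    by apply: cvgD; [exact: cvg_cst|exact: acv].
  - have := integrableZl measurableT (C + C) (L1_integral_integrable tt).
    by apply: (eq_integrable measurableT) => x _ /=.
  - move=> k x _; rewrite normrM normr_id [`|enorm _|]ger0_norm ?enorm_ge0//.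
    apply: ler_wpM2r; first exact: enorm_ge0.
    by apply: le_trans (ler_normD _ _) _; rewrite mulN1r normrN; apply: lerD.
rewrite Rintegral_cst// mul0r in H.
apply/cvgrPdist_le => e e0.
have e8 : 0 < e / 8 by rewrite divr_gt0.
have /cvgrPdist_le/(_ _ e8) := H; apply: filterS => k hk.
have := L1_ext_admissible_le (adk k) tt.
have E : (fun x => (-1 * a0 x + a k x) *: theta x) =
    fun x => -1 *: (a0 x *: theta x) + a k x *: theta x.
  by apply/funext => x; rewrite scalerDl scalerA.
rewrite E (L1_ext_linear bX oU lin rdV (L1_admissible aa0 tt) (L1_admissible (aa k) tt)); last first.
  by rewrite -E; exact: L1_admissible (adk k) tt.
move=> h; rewrite -normrN opprB; rewrite mulN1r addrC in h; apply: le_trans h _.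
move: hk; rewrite sub0r normrN; move: (\int[cara mu]_x _) => I hI.
by have := ler_norm I; lra.
Qed.

(** Fields that agree almost everywhere have the same neighbourhood filter on test functions, so the
    two values are the same limit. *)
Lemma L1_ext_ae theta psi : comp_measurable (theta : Cmu -> _) -> comp_measurable (psi : Cmu -> _) ->
  {ae cara mu, forall x, theta x = psi x} -> L1_ext U dV theta = L1_ext U dV psi.
Proof.
move=> mt mp h.
suff E : L1_nbhs U dV theta = L1_nbhs U dV psi by rewrite /L1_ext E.
have I (phi : 'rV[R]_n -> 'rV[R]_n) : test_function U phi ->
    (\int[cara mu]_x (enorm (phi x - theta x))%:E = \int[cara mu]_x (enorm (phi x - psi x))%:E)%E.
  move=> [sp _ _]; have mphi := smooth_comp_measurable rdV sp.
  apply: ae_eq_integral measurableT _ _ _.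
  - exact: measurable_enorm (comp_measurableB mphi mt).
  - exact: measurable_enorm (comp_measurableB mphi mp).
  - have F : Filter (nbhs (almost_everywhere (cara mu))) by typeclasses eauto.
    by apply: (@filterS _ _ F) h => x -> _.
rewrite /L1_nbhs /filter_from; apply/funext => A /=; apply/propext.
split => -[e e0 hA]; exists e; try exact: e0.
  move=> phi [tp hphi]; apply: hA; split; first exact: tp.
  by rewrite (I phi tp); exact: hphi.
move=> phi [tp hphi]; apply: hA; split; first exact: tp.
by rewrite -(I phi tp); exact: hphi.
Qed.

End level_functional.

(** * Primitives of test functions *)

Section primitive.
Variable R : realType.
Local Notation lam := (cara (@leb1 R)).
Local Notation TR := (caratheodory_type (@leb1 R)).

Variable om : R -> R.
Hypothesis tom : test_function setT om.

(** With the indicator of y < t as a factor, the value at t = f(x) is an integral over levels y of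
    om(y) times the indicator of {f > y} at x; its discretisation is then a combination of
    superlevel sets. *)
Definition primitive (t : R) : R := \int[lam]_y (om y * (y < t)%R%:R).

Lemma ltr_measurable (t : R) : measurable_fun [set: TR] ((fun y : R => (y < t)%R%:R) : TR -> R).
Proof.
rewrite (_ : (fun _ => _) = \1_(`]-oo, t[%classic)); last first.
  apply/funext => y; rewrite indicE; congr (_%:R); congr nat_of_bool.
  by apply/idP/idP; [move=> h; rewrite mem_set//= in_itv|rewrite inE /= in_itv].
by apply: measurable_indic; exact: leb1_itv.
Qed.

Lemma primitive_integrable (t : R) :
  lam.-integrable setT (EFin \o (fun y : TR => om y * (y < t)%R%:R)).
Proof.
apply: (@test_bounded_integrable R om (fun y => (y < t)%R%:R) 1 tom (ltr_measurable t)).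
by move=> y; rewrite ger0_norm// lern1 leq_b1.
Qed.

Lemma primitive_le (s t c e : R) : s < t -> (forall y, s <= y < t -> `|om y - c| <= e) ->
  `|primitive t - primitive s - c * (t - s)| <= e * (t - s).
Proof.
move=> st h.
have E : primitive t - primitive s - c * (t - s) = \int[lam]_y ((om y - c) * \1_(`[s, t[%classic) y).
  rewrite -(Rintegral_lam_itv true c st) /primitive.
  rewrite -(RintegralB measurableT (primitive_integrable t) (primitive_integrable s)).
  have i1 : lam.-integrable setT (EFin \o (fun y : TR => om y * (y < t)%R%:R - om y * (y < s)%R%:R)).
    have := integrableB measurableT (primitive_integrable t) (primitive_integrable s).
    by apply: (eq_integrable measurableT) => y _.
  rewrite -(RintegralB measurableT i1 (integrable_lam_itv true s t c)).
  apply: eq_Rintegral => y _; rewrite -mulrBr mulrBl; congr (_ * _ - _).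
  rewrite indicE; have -> : (y \in `[s, t[%classic) = (s <= y < t).
    by apply/idP/idP; [rewrite inE /= in_itv|move=> yy; rewrite mem_set//= in_itv].
  case: (ltrP y s) => ys; last by rewrite subr0.
  by rewrite (lt_trans ys st) subrr.
have mo : measurable_fun [set: TR] (om : TR -> R).
  by apply: continuous_lam_measurable; apply: smooth_continuous; case: tom.
have e0 : 0 <= e by apply: le_trans (h s _); rewrite ?lexx.
have ii : lam.-integrable setT (EFin \o (fun y : TR => (om y - c) * \1_(`[s, t[%classic) y)).
  apply: (le_integrable measurableT _ _ (integrable_lam_itv true s t e)).
    apply/measurable_EFinP; apply: measurable_funM.
      by apply: measurable_funB => //; exact: measurable_cst.
    by apply: measurable_indic; exact: leb1_itv.
  move=> y _ /=; rewrite lee_fin !normrM (ger0_norm e0) indicE.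
  case: (boolP (y \in _)) => [|_]; last by rewrite normr0 !mulr0.
  by rewrite inE /= in_itv /= normr1 !mulr1; exact: h.
rewrite E -(Rintegral_lam_itv true e st); apply: le_trans (le_normr_Rintegral measurableT ii) _.
apply: (le_Rintegral measurableT).
- exact: (integrable_abse ii).
- exact: integrable_lam_itv.
- move=> y _; rewrite normrM indicE.
  case: (boolP (y \in _)) => [|_]; last by rewrite normr0 !mulr0.
  by rewrite inE /= in_itv /= normr1 !mulr1; exact: h.
Qed.

Lemma primitive_cvg (t : R) :
  h^-1 *: (primitive (h *: 1 + t) - primitive t) @[h --> (0 : R)^'] --> om t.
Proof.
apply/cvgrPdist_le => e e0.
have co : {for t, continuous om} by apply: smooth_continuous; case: tom.
have /cvgrPdist_le/(_ _ e0) := co => /nbhs_ballP[d /= d0 hd].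
near=> h.
have h0 : h != 0 by near: h; exact: nbhs_dnbhs_neq.
have hd' : `|h| < d.
  near: h; apply: dnbhs0_lt; exact: d0.
have B y : `|y - t| < d -> `|om y - om t| <= e.
  by move=> yt; rewrite distrC; apply: hd; rewrite /ball /= distrC.
rewrite /GRing.scale /= mulr1 -(@ler_pM2r _ `|h|) ?normr_gt0// -normrM.
rewrite mulrBl mulrAC mulVf// mul1r distrC.
have [hp|hn] : 0 < h \/ h < 0 by move: h0; rewrite neq_lt => /orP[]; [right|left].
  have := @primitive_le t (h + t) (om t) e; rewrite (_ : h + t - t = h); last by ring.
  rewrite (gtr0_norm hp); apply; first by rewrite ltrDr.
  move=> y /andP[y1 y2]; apply: B; rewrite (gtr0_norm hp) in hd'.
  by rewrite ger0_norm ?subr_ge0//; lra.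
have := @primitive_le (h + t) t (om t) e; rewrite (_ : t - (h + t) = - h); last by ring.
rewrite (ltr0_norm hn) => H; rewrite -normrN.
rewrite [X in `|X|](_ : _ = primitive t - primitive (h + t) - om t * - h); last by ring.
apply: H; first by lra.
move=> y /andP[y1 y2]; apply: B; rewrite (ltr0_norm hn) in hd'.
by rewrite ltr_norml; apply/andP; split; lra.
Unshelve. all: by end_near. Qed.

Lemma derive1_primitive : derive1 primitive = om.
Proof.
apply/funext => t; rewrite derive1E /derive; apply/cvg_lim => //; exact: primitive_cvg.
Qed.

Lemma smooth_primitive : smooth primitive.
Proof.
have d1 t : derivable primitive t 1 by apply: cvgP; exact: primitive_cvg.
have df t : differentiable primitive t by apply/derivable1_diffP; exact: d1.
move=> vs t; elim/last_ind: vs => [|vs v _] //=.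
rewrite /iter_derive foldr_rcons.
have -> : 'D_v primitive = fun t => v *: om t.
  apply/funext => s; rewrite deriveE//.
  have -> : 'd primitive s v = v *: 'd primitive s 1.
    by rewrite -linearZ /= /GRing.scale /= mulr1.
  by rewrite -deriveE// -derive1E derive1_primitive.
by apply: smoothZ; case: tom.
Qed.

End primitive.

Section radon_sum.
Variables (R : realType) (n : nat) (U : set 'rV[R]_n).
Hypothesis oU : open U.

(** Where both measures are finite, additivity of the sum together with subadditivity of each
    summand forces additivity of each. The exhaustion of U by the sets [H k] removes the
    finiteness. *)
Lemma outer_add_cara (mu nu : {outer_measure set 'rV[R]_n -> \bar R}) E :
  radon U mu -> radon U nu -> (outer_add mu nu).-caratheodory E -> mu.-caratheodory E.
Proof.
move=> rmu rnu cE; have [H [oH Hle HK HKU]] := exhaustion oU.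
have fin (ka : {outer_measure set 'rV[R]_n -> \bar R}) k A : radon U ka -> A `<=` H k ->
    ka A \is a fin_num.
  move=> rka AH; rewrite ge0_fin_numE ?outer_measure_ge0//.
  have [K [cK KU HkK]] := HK k; apply: le_lt_trans (radon_compact_lty rka cK KU).
  by apply: le_outer_measure; exact: subset_trans HkK.
have cH k : mu.-caratheodory (H k) by exact: (radon_open_cara rmu).
have cF k : mu.-caratheodory (E `&` H k).
  apply: le_caratheodory_measurable => A.
  have h1 : (mu (A `&` H k `&` E) + mu (A `&` H k `&` ~` E) <= mu (A `&` H k))%E.
    have := cE (A `&` H k); rewrite /outer_add /=.
    have sub B : A `&` H k `&` B `<=` H k by move=> x [[]].
    have sA : A `&` H k `<=` H k by move=> x [].
    have ge (ka : {outer_measure set 'rV[R]_n -> \bar R}) :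
        (ka (A `&` H k) <= ka (A `&` H k `&` E) + ka (A `&` H k `&` ~` E))%E.
      apply: le_trans (outer_measureU2 _ _ _); apply: le_outer_measure => x Ax.
      by have [Ex|nEx] := pselect (E x); [left|right].
    have := ge nu.
    have f1 := fin mu k _ rmu sA; have f2 := fin nu k _ rnu sA.
    have f3 := fin mu k _ rmu (sub E); have f4 := fin nu k _ rnu (sub E).
    have f5 := fin mu k _ rmu (sub (~` E)); have f6 := fin nu k _ rnu (sub (~` E)).
    rewrite -(fineK f1) -(fineK f2) -(fineK f3) -(fineK f4) -(fineK f5) -(fineK f6).
    rewrite -!EFinD !lee_fin => h [h']; move: h h'.
    move: (fine _) (fine _) (fine _) (fine _) (fine _) (fine _) => *; lra.
  have h2 : (mu (A `&` ~` (E `&` H k)) <= mu (A `&` H k `&` ~` E) + mu (A `&` ~` H k))%E.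
    apply: le_trans (outer_measureU2 _ _ _); apply: le_outer_measure => x [Ax nx].
    have [Hx|nHx] := pselect (H k x); last by right.
    by left; split => // Ex; apply: nx.
  rewrite (cH k A) setIA setIAC; apply: le_trans (leeD (lexx _) h2) _.
  by rewrite addeA; apply: leeD.
have [|||_ //] := @outer_cvg R _ mu U E (fun k => E `&` H k) (let: And5 h _ _ _ _ := rmu in h) cF.
- by move=> k l kl x [Ex Hx]; split => //; exact: Hle Hx.
- by move=> k x [].
- move=> x [Ex Ux]; have [|_ ->|k hk] := HKU [set x]; first exact: compact_set1.
    by [].
  by exists k => //; split => //; exact: hk.
Qed.

End radon_sum.

Lemma setX_cylinder (X Y : Type) (A : set X) (B : set Y) :
  A `*` B = (A `*` setT) `&` snd @^-1` B.
Proof. by apply/seteqP; split => [[x y] [? ?]|[x y] [[? _] ?]]. Qed.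

(** * Superlevel sets *)

Section generalised_derivative.
Variables (R : realType) (n m : nat) (U : set 'rV[R]_n).
Variable V : {outer_measure set ('rV[R]_n * 'M[R]_n) -> \bar R}.
Variables (D : set 'rV[R]_n) (f : 'rV[R]_n -> R) (F : 'rV[R]_n -> 'cV[R]_n).
Hypotheses (oU : open U) (rV : is_varifold m U V) (rdV : radon U (dvar U V)).
Hypothesis wF : weak_derivative m U V D f F.
Local Notation dV := (first_variation V).
Local Notation mu := (variation_measure U (first_variation V)).
Local Notation w := (weight m V).
Local Notation CV := (caratheodory_type V).
Local Notation Cw := (caratheodory_type w).
Local Notation Cmu := (caratheodory_type mu).
Local Notation lam := (cara (@leb1 R)).
Local Notation TR := (caratheodory_type (@leb1 R)).
Implicit Types (theta psi : 'rV[R]_n -> 'rV[R]_n).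

Let rw : radon U w := weight_radon oU rV.

Lemma domain_null : w (~` D) = 0%E /\ mu (~` D) = 0%E.
Proof.
have [[DU D0] _ _ _ _] := wF.
have [w0 m0] : w (U `\` D) = 0%E /\ mu (U `\` D) = 0%E.
  have h1 := outer_measure_ge0 w (U `\` D); have h2 := outer_measure_ge0 mu (U `\` D).
  move: D0; rewrite /outer_add /= /dvar => /eqP; rewrite padde_eq0//.
  by move=> /andP[/eqP h3 /eqP h4].
have H (nu : {outer_measure set 'rV[R]_n -> \bar R}) : radon U nu -> nu (U `\` D) = 0%E ->
    nu (~` D) = 0%E.
  move=> rnu nu0; rewrite -(radon_setI rnu) -nu0; congr (nu _).
  by apply/seteqP; split => x [].
by split; [exact: H rw w0|exact: H rdV m0].
Qed.

Lemma omeasurable_f : omeasurable w setT f /\ omeasurable mu setT f.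
Proof.
have [w0 m0] := domain_null; have [_ mf _ _ _] := wF.
have H (nu : {outer_measure set 'rV[R]_n -> \bar R}) : nu (~` D) = 0%E ->
    (forall A : set R, open A -> nu.-caratheodory (D `&` f @^-1` A)) -> omeasurable nu setT f.
  move=> nu0 h A oA; rewrite setTI.
  rewrite (_ : f @^-1` A = (D `&` f @^-1` A) `|` (~` D `&` f @^-1` A)); last first.
    by rewrite -setIUl setUv setTI.
  apply: caratheodory_measurable_setU; first exact: h.
  apply: cara_null; apply/eqP; rewrite eq_le outer_measure_ge0 andbT -nu0.
  by apply: le_outer_measure => x [].
split; apply: H => // A oA.
  exact: (outer_add_cara oU rw rdV (mf A oA)).
apply: (outer_add_cara oU rdV rw) => Z; have := mf A oA Z.
have c Y : (outer_add w (dvar U V) : {outer_measure set _ -> \bar R}) Y =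
    (outer_add (dvar U V) w : {outer_measure set _ -> \bar R}) Y by exact: addeC.
by rewrite !c.
Qed.

Lemma admissible_comp (g : R -> R) (C : R) :
  measurable_fun [set: measurableTypeR R] (g : measurableTypeR R -> R) ->
  (forall t, `|g t| <= C) -> admissible m U V (fun x => g (f x)).
Proof.
move=> mg gC; have [mw mmu] := omeasurable_f; split; last by exists C.
- exact: (measurableT_comp mg (omeasurable_measurable mmu)).
- exact: (measurableT_comp mg (omeasurable_measurable mw)).
Qed.

Definition superlevel (y t : R) : R := (y < t)%R%:R.

Lemma superlevel_le1 y t : `|superlevel y t| <= 1.
Proof. by rewrite /superlevel ger0_norm// lern1 leq_b1. Qed.

Lemma admissible_superlevel y : admissible m U V (fun x => superlevel y (f x)).
Proof.
apply: (admissible_comp (C := 1)) => [|t]; last exact: superlevel_le1.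
rewrite (_ : superlevel y = \1_(`]y, +oo[%classic)); last first.
  apply/funext => t; rewrite indicE /superlevel; congr (_%:R); congr nat_of_bool.
  by apply/idP/idP; [move=> h; rewrite mem_set//= in_itv/= h|rewrite inE /= in_itv/= andbT].
by apply: measurable_indic; exact: measurable_itv.
Qed.

Let E y := [set x | D x /\ y < f x].
Local Notation S y := (vboundary m U V (E y)).

(** The left side cuts theta off outside E(y), a subset of D, whereas the right side multiplies it
    by an indicator formed with the values of f everywhere. They can differ only outside D, which is
    null for ||V|| and for ||delta V||. *)
Lemma vboundaryE y theta : test_function U theta ->
  S y theta = Lam U V (fun x => superlevel y (f x)) theta.
Proof.
move=> tt; have [st _ _] := tt; have [w0 m0] := domain_null.
have aa := admissible_superlevel y.
have [maw mam] : measurable_fun [set: Cw] ((fun x => superlevel y (f x)) : Cw -> R) /\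
    measurable_fun [set: Cmu] ((fun x => superlevel y (f x)) : Cmu -> R) by case: aa.
have [ofw ofm] := omeasurable_f.
have cE (nu : {outer_measure set 'rV[R]_n -> \bar R}) : nu (~` D) = 0%E -> omeasurable nu setT f ->
    nu.-caratheodory (E y).
  move=> nu0 of_; rewrite (_ : E y = (setT `&` f @^-1` `]y, +oo[%classic) `&` D); last first.
    by apply/seteqP; split => x; rewrite /E /= in_itv /= andbT; [move=> []|move=> [[_ ?] ?]].
  apply: caratheodory_measurable_setI; first by apply: of_; exact: interval_open.
  rewrite -[D]setCK; apply: caratheodory_measurable_setC; exact: cara_null.
have E1 : drestr U dV (E y) theta = L1_ext U dV (fun x => superlevel y (f x) *: theta x).
  rewrite /drestr; apply: (L1_ext_ae rdV).
  - rewrite (_ : patch _ _ _ = fun x => \1_(E y) x *: theta x); last first.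
      by apply/funext => x; rewrite /patch indicE; case: ifPn; rewrite ?scale1r ?scale0r.
    apply: comp_measurable_scale; last exact: (smooth_comp_measurable rdV st).
    by apply: measurable_indic; exact: (cE mu m0 ofm).
  - exact: (comp_measurable_scale mam (smooth_comp_measurable rdV st)).
  exists (~` D); split => //; first exact: cara_null.
  move=> x /= hx; apply: contra_not hx => Dx; rewrite /patch /superlevel.
  have [xE|xE] := boolP (x \in E y).
    by move: xE; rewrite inE => -[_ ->]; rewrite scale1r.
  case: (ltrP y (f x)) => h; last by rewrite scale0r.
  by move/negP: xE; case; rewrite inE.
have cG : V.-caratheodory (E y `*` @grassmann R n m).
  rewrite setX_cylinder; apply: caratheodory_measurable_setI.
    by apply: (varifold_cylinder_cara oU rV); exact: (cE w w0 ofw).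
  apply: (radon_closed_cara rV).
  apply: closed_comp; first by move=> z _; exact: cvg_snd.
  by apply: compact_closed; [exact: norm_hausdorff|exact: compact_grassmann].
have mt := measurable_tdiv rV st.
suff E2 : first_variation (outer_restr V (E y `*` @grassmann R n m)) theta =
    \int[cara V]_z (superlevel y (f z.1) * tdiv theta z).
  exact: (congr2 (fun a b => a - b) E1 E2).
transitivity (\int[cara (outer_restr V (E y `*` @grassmann R n m))]_z tdiv theta z); first by [].
rewrite (Rintegral_outer_restr cG mt) /Rintegral; congr fine.
have mf := fst_measurable oU rV maw.
apply: ae_eq_integral measurableT _ _ _.
- apply/measurable_EFinP; apply: measurable_funM; last exact: mt.
  by apply: measurable_indic; exact: cG.
- by apply/measurable_EFinP; exact: measurable_funM.
have N0 : {ae cara V, forall z, D z.1}.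
  exists (~` D `*` setT); split.
  - apply: (varifold_cylinder_cara oU rV); exact: cara_null.
  - by rewrite /cara /= (varifold_setX rV).
  - exact: (fun z h => conj h I).
have FF : Filter (nbhs (almost_everywhere (cara V))) by typeclasses eauto.
apply: (@filterS2 _ _ FF) N0 (varifold_ae rV) => -[x P] /= Dx [Ux GP] _.
congr (_ * _)%:E; rewrite indicE /superlevel; congr (_%:R); congr nat_of_bool.
apply/idP/idP; first by rewrite inE => -[[]].
exact: (fun h => mem_set (conj (conj Dx h) GP)).
Qed.

Lemma linear_vboundary y : linear_on U (S y).
Proof.
move=> c theta psi tt tp.
have tc : test_function U (fun x => c *: theta x + psi x).
  by apply: test_functionD => //; exact: test_functionZ.
by rewrite !vboundaryE// (Lam_linear_r oU rV rdV c (admissible_superlevel y) tt tp).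
Qed.

Lemma vboundary_bounded theta : test_function U theta ->
  exists M : R, forall y, `|S y theta| <= M.
Proof.
move=> tt; have [M hM] := Lam_bound oU rV rdV tt; exists M => y.
rewrite vboundaryE//; apply: hM; first exact: admissible_superlevel.
by move=> x; exact: superlevel_le1.
Qed.

(** As z decreases to y, the sets {f > z} increase to {f > y}, so their indicators converge at every
    point. If right continuity failed, a sequence of such z would contradict [Lam_cvg]. *)
Lemma vboundary_right_continuous theta : test_function U theta ->
  right_continuous (fun y => S y theta).
Proof.
move=> tt y e e0; apply: contrapT => H.
have H' k : exists z, y < z < y + k.+1%:R^-1 /\ e < `|S z theta - S y theta|.
  apply: contrapT => nz; apply: H; exists k.+1%:R^-1; first by rewrite invr_gt0.
  move=> z yz; rewrite leNgt; apply/negP => ez; apply: nz; by exists z.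
have [z hz] := choice H'.
have cv : Lam U V (fun x => superlevel (z k) (f x)) theta @[k --> \oo] -->
    Lam U V (fun x => superlevel y (f x)) theta.
  apply: (Lam_cvg oU rV rdV (C := 1) _ _ _ _ tt).
  - by move=> k; exact: admissible_superlevel.
  - exact: admissible_superlevel.
  - by move=> k x; exact: superlevel_le1.
  - move=> x; apply: cvg_near_cst; case: (ltrP y (f x)) => yf.
      have yf0 : 0 < f x - y by rewrite subr_gt0.
      near=> k; have [/andP[_ z2] _] := hz k.
      have hk : k.+1%:R^-1 < f x - y by near: k; exact: (near_infty_natSinv_lt (PosNum yf0)).
      rewrite /superlevel yf (_ : (z k < f x) = true)//.
      by apply: lt_trans z2 _; rewrite -ltrBrDl.
    apply: nearW => k; have [/andP[z1 _] _] := hz k.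
    by rewrite /superlevel !ltNge yf (le_trans yf (ltW z1)).
have /cvgrPdist_lt/(_ _ e0) := cv => -[N _ hN].
have [_] := hz N; rewrite !vboundaryE// distrC => h.
by have := hN N (leqnn N); rewrite ltNge (ltW h).
Unshelve. all: by end_near. Qed.

Lemma vboundary_tensor (om : R -> R) theta : test_function setT om -> test_function U theta ->
  \int[cara w]_x ((om (f x) *: theta x) *m F x) 0 0 = \int[lam]_y (om y * S y theta).
Proof.
move=> tom tt; have [so co _] := tom; have [_ _ _ _ wd] := wF.
pose g := primitive om.
have sg : smooth g by exact: smooth_primitive.
have dg : derive1 g = om by exact: derive1_primitive.
have gE : \int[cara w]_x ((om (f x) *: theta x) *m F x) 0 0 = Lam U V (fun x => g (f x)) theta.
  have := wd theta g tt sg; rewrite dg => /(_ co) h.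
  rewrite /Lam h (_ : \int[cara V]_z (g (f z.1) * tdiv theta z) =
    \int[cara V]_z (g (f z.1) * \tr ((z.2)^T *m jacobian theta z.1)))//.
  rewrite addrAC subrr add0r; apply: eq_Rintegral => x _.
  by rewrite -scalemxAl mxE.
have [A A0 hA] := compact_interval co.
have ab : - A < A by rewrite gtrN.
have om0 y : ~~ (- A <= y < A) -> om y = 0.
  by move=> ny; apply: spt_eq0 => /hA /andP[/ltW h1 h2]; move/negP: ny; apply; rewrite h1.
have [B hB] : exists B : R, forall y, `|om y| <= B.
  by have [B _ hB] := test_function_real_bounded tom; exists B.
have B0 : 0 <= B by apply: le_trans (hB 0).
pose c k j : R := \int[lam]_y (om y * \1_(cell (- A) A k j) y).
have icell k j : lam.-integrable setT (EFin \o (fun y : TR => om y * \1_(cell (- A) A k j) y)).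
  apply: (@test_bounded_integrable R om (\1_(cell (- A) A k j)) 1 tom).
    by apply: measurable_indic; exact: measurable_cell.
  by move=> y; rewrite indicE ger0_norm// lern1 leq_b1.
(* Both the function [a k] at a point and [Lam] of [a k] are sums of the form \sum_j c_j u_j.
   Written as integrals of om against a step function, they are handled by the single limit
   [gridcv], for u = [superlevel] at f(x) and for u = S_y(theta). *)
have sumE k (u : nat -> R) : \sum_(j < k.+1) c k j * u j =
    \int[lam]_y (om y * gridfun (- A) A k k.+1 u y).
  rewrite /gridfun; elim: (k.+1) => [|N IH].
    by rewrite big_ord0; under eq_Rintegral do rewrite big_ord0 mulr0; rewrite Rintegral_cst// mul0r.
  rewrite big_ord_recr /= IH; under [RHS]eq_Rintegral do rewrite big_ord_recr /= mulrDr.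
  have i1 : lam.-integrable setT (EFin \o (fun y : TR =>
      om y * (\sum_(j < N) u j * \1_(cell (- A) A k j) y))).
    apply: (@test_bounded_integrable R om (gridfun (- A) A k N u) (\sum_(j < N) `|u j|) tom).
      exact: measurable_gridfun.
    move=> y; apply: le_trans (ler_norm_sum _ _ _) _; apply: ler_sum => j _.
    by rewrite normrM ler_piMr// indicE ger0_norm// lern1 leq_b1.
  have i2 : lam.-integrable setT (EFin \o (fun y : TR => om y * (u N * \1_(cell (- A) A k N) y))).
    have := integrableZl measurableT (u N) (icell k N).
    by apply: (eq_integrable measurableT) => y _ /=; rewrite -EFinM mulrCA.
  rewrite (RintegralD measurableT i1 i2); congr (_ + _).
  rewrite /c mulrC -(RintegralZl (u N) measurableT (icell k N)).
  by apply: eq_Rintegral => y _; rewrite mulrCA.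
have gridcv (u : R -> R) (M : R) : right_continuous u -> (forall y, `|u y| <= M) ->
    \int[lam]_y (om y * gridfun (- A) A k k.+1 (fun j => u (node (- A) A k j.+1)) y)
      @[k --> \oo] --> \int[lam]_y (om y * u y).
  move=> ru uM; have M0 : 0 <= M by apply: le_trans (uM 0).
  apply: (@Rintegral_dominated_cvg _ _ _ lam setT _ _ (fun y => `|om y| * M) measurableT).
  - move=> k; apply: measurable_funM; last exact: measurable_gridfun.
    by apply: continuous_lam_measurable; exact: smooth_continuous.
  - move=> y _; have [yA|yA] := boolP (- A <= y < A); last first.
      by rewrite om0// mul0r; under eq_fun do rewrite mul0r; exact: cvg_cst.
    by apply: cvgMl_tmp; exact: gridfun_right_cvg.
  - have mM : measurable_fun [set: TR] ((fun=> M) : TR -> R) by exact: measurable_cst.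
    have nM (y : R) : `|M| <= M by rewrite ger0_norm.
    have := integrable_abse (test_bounded_integrable tom mM nM).
    by apply: (eq_integrable measurableT) => y _ /=; rewrite normrM (ger0_norm M0).
  - move=> k y _; rewrite normrM; apply: ler_wpM2l => //.
    have [yA|yA] := boolP (- A <= y < A); last by rewrite gridfun_out// normr0.
    have [j jk cj] := cell_exists ab k yA.
    by rewrite (gridfunE ab _ _ cj) ltnS jk.
pose a k (x : 'rV[R]_n) : R := \sum_(j < k.+1) c k j * superlevel (node (- A) A k j.+1) (f x).
have rs t : right_continuous (fun y => superlevel y t).
  move=> y e e0; case: (ltrP y t) => yt.
    exists (t - y); first by rewrite subr_gt0.
    move=> z /andP[_ zt]; rewrite /superlevel yt (_ : (z < t) = true) ?subrr ?normr0 ?ltW//.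
    by move: zt; lra.
  exists 1 => // z /andP[yz _]; rewrite /superlevel !ltNge yt (le_trans yt (ltW yz)).
  by rewrite subrr normr0 ltW.
have adk k j : admissible m U V (fun x => superlevel (node (- A) A k j.+1) (f x)).
  exact: admissible_superlevel.
have cv1 : Lam U V (a k) theta @[k --> \oo] --> Lam U V (fun x => g (f x)) theta.
  have aE k x : a k x = \int[lam]_y (om y * gridfun (- A) A k k.+1
      (fun j => superlevel (node (- A) A k j.+1) (f x)) y).
    by rewrite -sumE.
  have io : lam.-integrable setT (EFin \o (fun y : TR => `|om y * 1|)).
    have m1 : measurable_fun [set: TR] ((fun=> 1) : TR -> R) by exact: measurable_cst.
    have n1 (y : R) : `|1| <= 1 :> R by rewrite normr1.
    exact: integrable_abse (test_bounded_integrable tom m1 n1).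
  have bd (u : R -> R) : measurable_fun [set: TR] (u : TR -> R) -> (forall y, `|u y| <= 1) ->
      `|\int[lam]_y (om y * u y)| <= \int[lam]_y `|om y * 1|.
    move=> mu1 u1; have iu := test_bounded_integrable tom mu1 u1.
    apply: le_trans (le_normr_Rintegral measurableT iu) _.
    apply: (le_Rintegral measurableT (integrable_abse iu) io) => y _.
    by rewrite mulr1 normrM ler_piMr.
  apply: (Lam_cvg oU rV rdV (C := \int[lam]_y `|om y * 1|) _ _ _ _ tt).
  - by move=> k; exact: (admissible_sum k.+1 (c k) (adk k)).
  - apply: (@admissible_comp _ (\int[lam]_y `|om y * 1|)).
      exact: (continuous_measurable_fun (smooth_continuous sg)).
    move=> t; apply: bd; first exact: ltr_measurable.
    by move=> y; rewrite ger0_norm// lern1 leq_b1.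
  - move=> k x; rewrite aE; apply: bd; first exact: measurable_gridfun.
    move=> y; have [yA|yA] := boolP (- A <= y < A); last by rewrite gridfun_out// normr0.
    have [j jk cj] := cell_exists ab k yA.
    by rewrite (gridfunE ab _ _ cj) ltnS jk; exact: superlevel_le1.
  - move=> x; under eq_fun do rewrite aE.
    exact: (gridcv (fun y => superlevel y (f x)) 1 (rs (f x)) (fun y => superlevel_le1 y (f x))).
have cv2 : Lam U V (a k) theta @[k --> \oo] --> \int[lam]_y (om y * S y theta).
  have [M hM] := vboundary_bounded tt.
  have LE : (fun k => Lam U V (a k) theta) = fun k =>
      \int[lam]_y (om y * gridfun (- A) A k k.+1 (fun j => S (node (- A) A k j.+1) theta) y).
    apply/funext => k; rewrite -sumE /a (Lam_sum oU rV rdV k.+1 (c k) (adk k) tt).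
    by apply: eq_bigr => j _; rewrite vboundaryE.
  by rewrite LE; exact: gridcv (vboundary_right_continuous tt) hM.
by rewrite gE; apply: (cvg_unique _ cv1 cv2); exact: norm_hausdorff.
Qed.

End generalised_derivative.

(** The integral of a nonnegative function is the supremum over the simple functions below it, so
    monotonicity holds for arbitrary functions, such as the operator norm of the weak derivative. *)
Lemma integral_mono_ge0 d (X : measurableType d) (R : realType) (mu : {measure set X -> \bar R})
    (D : set X) (f g : X -> \bar R) : (forall x, D x -> (0 <= f x)%E) ->
  (forall x, D x -> (f x <= g x)%E) ->
  (\int[mu]_(x in D) f x <= \int[mu]_(x in D) g x)%E.
Proof.
move=> f0 fg; rewrite [leLHS]integral_mkcond [leRHS]integral_mkcond.
have f0' x : (0 <= (f \_ D) x)%E by apply: erestrict_ge0.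
have fg' x : ((f \_ D) x <= (g \_ D) x)%E by apply: lee_restrict.
have g0' x : (0 <= (g \_ D) x)%E by apply: le_trans (f0' x) (fg' x).
rewrite (ge0_integralTE _ f0') (ge0_integralTE _ g0').
apply: le_ereal_sup => _ [k hk <-]; exists k => // x.
by apply: le_trans (hk x) (fg' x).
Qed.

(** [fine] sends an infinite integral to 0, which is still below the nonnegative right side, so the
    inequality holds for all values of the integrals. *)
Lemma Rintegral_le_dominated d (X : measurableType d) (R : realType)
    (mu : {measure set X -> \bar R}) (f : X -> R) (g : X -> \bar R) :
  (forall x, (`|f x|%:E <= g x)%E) -> ((\int[mu]_x f x)%:E <= \int[mu]_x g x)%E.
Proof.
move=> fg; have g0 x : (0 <= g x)%E by apply: le_trans (fg x); rewrite lee_fin.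
have G0 : (0 <= \int[mu]_x g x)%E by apply: integral_ge0 => x _; exact: g0.
have le_fine (x : \bar R) : (x <= \int[mu]_x g x -> (fine x)%:E <= \int[mu]_x g x)%E by case: x.
rewrite /Rintegral; apply: le_fine; rewrite integralE.
apply: (@le_trans _ _ (\int[mu]_x ((fun x => (f x)%:E)^\+ x))%E).
  rewrite -[leRHS]adde0; apply: leeD2l; rewrite oppe_le0; apply: integral_ge0 => x _.
  exact: funeneg_ge0.
apply: integral_mono_ge0 => x _; first exact: funepos_ge0.
by apply: le_trans (fg x); rewrite funeposE ge_max !lee_fin ler_norm normr_ge0.
Qed.

Lemma coord_le_opnorm (R : realType) (n : nat) (a : 'cV[R]_n) i : `|a i 0| <= opnorm a.
Proof.
pose e := delta_mx (0 : 'I_1) i : 'rV[R]_n.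
have ea : (e *m a) 0 0 = a i 0.
  rewrite mxE (bigD1 i)//= big1 ?addr0 ?mxE ?eqxx ?mul1r// => j ji.
  by rewrite mxE eqxx (negbTE ji) mul0r.
rewrite -ea; apply: ub_le_sup; last first.
  exists e => //=; rewrite /enorm (bigD1 i)//= big1 ?addr0; last first.
    by move=> j ji; rewrite mxE eqxx (negbTE ji) expr0n.
  by rewrite mxE !eqxx expr1n sqrtr1.
exists (\sum_j `|a j 0|) => _ [v /= v1 <-]; rewrite mxE.
apply: le_trans (ler_norm_sum _ _ _) _; apply: ler_sum => j _; rewrite normrM ler_piMl//.
exact: le_trans (coord_le_enorm v j) v1.
Qed.

(** * Boxes, local finiteness of ||T||, and the graph of f *)

Section level_null.
Variables (R : realType) (n m : nat) (U : set 'rV[R]_n).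
Variable V : {outer_measure set ('rV[R]_n * 'M[R]_n) -> \bar R}.
Variables (D : set 'rV[R]_n) (f : 'rV[R]_n -> R) (F : 'rV[R]_n -> 'cV[R]_n).
Variable T : ('rV[R]_n * R -> 'rV[R]_n) -> R.
Hypotheses (oU : open U) (rV : is_varifold m U V) (rdV : radon U (dvar U V)).
Hypothesis wF : weak_derivative m U V D f F.
Hypothesis linT : linear_on (U `*` [set: R]) T.
Local Notation w := (weight m V).
Hypothesis TE : forall phi : 'rV[R]_n * R -> 'rV[R]_n,
  test_function (U `*` [set: R]) phi ->
  T phi = \int[cara w]_x (phi (x, f x) *m F x) 0 0.
Local Notation Cw := (caratheodory_type w).
Local Notation nT := (variation_measure (U `*` [set: R]) T).

Let rw : radon U w := weight_radon oU rV.

(** A substitute for the operator norm: its measurability is immediate from that of the coordinates,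
    and it is at most n times [opnorm]. *)
Definition coord_norm (x : 'rV[R]_n) : R := \sum_i `|F x i 0|.

Lemma coord_norm_ge0 x : 0 <= coord_norm x.
Proof. exact: sumr_ge0. Qed.

Lemma measurable_coord_norm : measurable_fun [set: Cw] (coord_norm : Cw -> R).
Proof.
have [_ _ mF _ _] := wF.
apply: measurable_sum => i; apply: measurableT_comp => //.
apply: (@omeasurable_measurable _ _ w setT (fun x => F x i 0)) => A oA.
have oA' : open ((fun a : 'cV[R]_n => a i 0) @^-1` A).
  by apply: open_comp => // a _; exact: coord_continuous.
exact: (mF _ oA').
Qed.

Definition mass (A : set 'rV[R]_n) : \bar R := (\int[cara w]_(x in A) (coord_norm x)%:E)%E.

Lemma measurable_box (O : set 'rV[R]_n) (I : set R) : open O -> open I ->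
  measurable (O `&` f @^-1` I : set Cw).
Proof.
move=> oO oI; apply: caratheodory_measurable_setI; first exact: (radon_open_cara rw oO).
by have [mw _] := omeasurable_f oU rV rdV wF; have := mw _ oI; rewrite setTI.
Qed.

Lemma box_bound (O : set 'rV[R]_n) (I : set R) : open O -> O `<=` U -> open I ->
  (nT (O `*` I) <= mass (O `&` f @^-1` I))%E.
Proof.
move=> oO OU oI.
rewrite (variation_open (has_bumps_prod (@has_bumps_row R n) (@has_bumps_real R)) _ linT);
  [|exact: open_setX oU openT|exact: open_setX].
apply: ge_ereal_sup => _ [phi [tp sp p1] <-].
rewrite (TE tp) /mass [leRHS]integral_mkcond; apply: Rintegral_le_dominated => x.
have [sx|sx] := pselect (spt phi (x, f x)); last first.
  rewrite (spt_eq0 sx) mul0mx mxE normr0; apply: erestrict_ge0 => y _.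
  by rewrite lee_fin coord_norm_ge0.
rewrite patchE mem_set; last exact: (sp _ sx).
rewrite lee_fin mxE; apply: le_trans (ler_norm_sum _ _ _) _; apply: ler_sum => i _.
by rewrite normrM ler_piMl//; apply: le_trans (coord_le_enorm _ i) (p1 _).
Qed.

Lemma mass_lty (K O : set 'rV[R]_n) (s : R) : compact K -> K `<=` U -> open O -> O `<=` K ->
  0 <= s -> (mass (O `&` f @^-1` `]- s, s[%classic)%R < +oo)%E.
Proof.
move=> cK KU oO OK s0; have [_ _ _ /(_ K s cK KU s0) fin _] := wF.
have [w0 _] := domain_null oU rV rdV wF.
have oI : open (`]- s, s[%classic : set R) by exact: interval_open.
have mB := measurable_box oO oI.
have mh := measurable_coord_norm.
have h0 x : (0 <= (coord_norm x)%:E)%E by rewrite lee_fin coord_norm_ge0.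
have mDc : measurable (~` D : set Cw) by exact: cara_null.
have mh' A : measurable_fun (A : set Cw) (EFin \o (coord_norm : Cw -> R)).
  by apply/measurable_EFinP; exact: measurable_funTS.
rewrite /mass (@ge0_negligible_integral _ _ _ (cara w) _ _ _ mDc mB (mh' _) (fun x _ => h0 x) w0).
set B := (X in (\int[_]_(x in X) _ < _)%E).
have mBD : measurable (B : set Cw) by exact: measurableD.
(* The sum of the coordinates is at most n times the operator norm; n + 1 is also positive for n =
   0. The constant is moved to the side of [coord_norm], whose measurability is known. *)
pose c : R := n.+1%:R; have c0 : 0 < c by rewrite ltr0n.
have -> : (\int[cara w]_(x in B) (coord_norm x)%:E =
    c%:E * \int[cara w]_(x in B) (c^-1 * coord_norm x)%:E)%E.
  rewrite -ge0_integralZl_EFin//.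
  - by apply: eq_integral => x _; rewrite -EFinM mulrA divff ?mul1r// gt_eqF.
  - by move=> x _; rewrite lee_fin mulr_ge0 ?coord_norm_ge0// invr_ge0 ltW.
  - apply/measurable_EFinP; apply: measurable_funM; first exact: measurable_cst.
    exact: measurable_funTS.
rewrite lte_mul_pinfty ?lee_fin ?ltW//; apply: le_lt_trans fin.
rewrite [leLHS]integral_mkcond [leRHS]integral_mkcond; apply: integral_mono_ge0 => x _.
  by apply: erestrict_ge0 => y _; rewrite lee_fin mulr_ge0 ?coord_norm_ge0// invr_ge0 ltW.
have o0 (a : 'cV[R]_n) : 0 <= opnorm a.
  case: n a => [|p] a; last exact: le_trans (coord_le_opnorm a 0).
  rewrite /opnorm; apply: le_trans (ub_le_sup _ _); last by exists 0; rewrite /= ?enorm0.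
    by rewrite normr_ge0.
  by exists 0 => _ [v _ <-]; rewrite mxE big_ord0 normr0.
rewrite !patchE; case: ifPn => [|_]; last first.
  by case: ifP => // _; rewrite lee_fin.
rewrite inE => -[[Ox fx] /contrapT Dx]; rewrite mem_set; last first.
  split; first exact: OK; split => //=.
  by move: fx; rewrite /= in_itv /= => /andP[h1 h2]; rewrite ler_norml !ltW.
rewrite lee_fin ler_pdivrMl// /coord_norm; apply: (@le_trans _ _ (\sum_(i < n) opnorm (F x))).
  by apply: ler_sum => i _; exact: coord_le_opnorm.
by rewrite sumr_const card_ord -mulr_natl ler_wpM2r// ler_nat.
Qed.

Lemma representable_T : representable (U `*` [set: R]) T.
Proof.
have [H [oH mH HK KH]] := exhaustion oU.
apply: (variation_radon (has_bumps_prod (@has_bumps_row R n) (@has_bumps_real R)) _ linT).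
  exact: open_setX oU openT.
move=> C cC CU.
have c1 : compact (fst @` C).
  by apply: continuous_compact cC; apply: continuous_subspaceT => p; exact: cvg_fst.
have c2 : compact (snd @` C).
  by apply: continuous_compact cC; apply: continuous_subspaceT => p; exact: cvg_snd.
have C1U : fst @` C `<=` U by move=> _ [p Cp <-]; have [] := CU p Cp.
have [k Hk] := KH _ c1 C1U; have [A A0 hA] := compact_interval c2.
have [K [cK KU HkK]] := HK k.
apply: le_lt_trans (mass_lty cK KU (oH k) HkK (ltW A0)).
have oI : open (`]- A, A[%classic : set R) by exact: interval_open.
apply: le_trans (box_bound (oH k) (subset_trans HkK KU) oI).
apply: le_outer_measure => p Cp; split; first by apply: Hk; exists p.
by rewrite /= in_itv /=; apply: hA; exists p.
Qed.

(* If G is an open set containing the set A := O \ f^{-1}(]r,s[), then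
   O \cap G \cap f^{-1}(]r,s[) is contained in G \ A and so has small measure. *)
Lemma variation_box_eq0 (O : set 'rV[R]_n) (r s : R) : (exists K, [/\ compact K, K `<=` U & O `<=` K]) ->
  open O -> nT ((O `&` ~` (f @^-1` `]r, s[%classic)) `*` `]r, s[%classic) = 0%E.
Proof.
move=> [K [cK KU OK]] oO; set I := `]r, s[%classic; set A := O `&` _.
have oI : open I by exact: interval_open.
(* The integrability of the weak derivative is given on the sets {|f| <= s}, so
   ]r,s[ is placed in the symmetric interval ]-t,t[. *)
pose t := Num.max `|r| `|s|; have t0 : 0 <= t by rewrite le_max normr_ge0.
have It x : I x -> - t < x < t.
  rewrite /I /= in_itv /= => /andP[rx xs]; apply/andP; split.
    by apply: le_lt_trans rx; rewrite lerNl le_max -normrN ler_norm.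
  by apply: lt_le_trans xs _; rewrite le_max ler_norm orbT.
have OU : O `<=` U by exact: subset_trans OK KU.
pose C := O `&` f @^-1` `]- t, t[%classic.
have mC : measurable (C : set Cw) by exact: measurable_box oO (interval_open _ _).
have mh := measurable_coord_norm.
pose g : 'rV[R]_n -> R := fun x => \1_C x * coord_norm x.
have ig : (cara w).-integrable setT (EFin \o (g : Cw -> R)).
  apply/integrableP; split.
    by apply/measurable_EFinP; apply: measurable_funM => //; exact: measurable_indic.
  apply: le_lt_trans (mass_lty cK KU oO OK t0); rewrite /mass -/C [leRHS]integral_mkcond.
  apply: integral_mono_ge0 => // x _; rewrite /g /= patchE indicE.
  by case: ifPn => _; rewrite ?mul1r ?mul0r ?normr0// ger0_norm// coord_norm_ge0.
have wA : (w A < +oo)%E.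
  apply: le_lt_trans (radon_compact_lty rw cK KU); apply: le_outer_measure.
  by move=> x [/OK].
have mA : w.-caratheodory A.
  apply: caratheodory_measurable_setI; first exact: (radon_open_cara rw oO).
  apply: caratheodory_measurable_setC.
  by have [mw _] := omeasurable_f oU rV rdV wF; have := mw _ oI; rewrite setTI.
apply/eqP; rewrite eq_le outer_measure_ge0 andbT; apply/lee_addgt0Pr => e e0; rewrite add0e.
(* Absolute continuity of the integral: sets of weight below d have mass below e inside C, where g
   is [coord_norm]. *)
have [d [d0 hd]] := integral_normr_continuous ig e0.
have d2 : 0 < d / 2 by rewrite divr_gt0.
have [G [oG AG wG]] := radon_outer rw d2 wA.
pose W := (O `&` G) `&` f @^-1` I.
have oOG : open (O `&` G) by exact: openI.
have mW : measurable (W : set Cw) by exact: measurable_box oOG oI.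
have wW : (w W < d%:E)%E.
  have WG : W `<=` G `&` ~` A by move=> x [[Ox Gx] fx]; split => // -[_]; exact.
  apply: le_lt_trans (le_outer_measure w _ _ WG) _.
  have A1 : (w A <= w (G `&` A))%E.
    apply: le_outer_measure => x Ax; split => //; apply: AG; split => //; apply: OU; by case: Ax.
  have hle : (w A + w (G `&` ~` A) <= w A + (d / 2)%:E)%E.
    apply: le_trans wG; apply: (@le_trans _ _ (w (G `&` A) + w (G `&` ~` A))%E).
      exact: leeD2r.
    by rewrite le_eqVlt; apply/orP; left; apply/eqP; exact: esym (mA G).
  have fA : w A \is a fin_num by rewrite ge0_fin_numE ?outer_measure_ge0.
  move: hle; rewrite leeD2lE// => hle; apply: le_lt_trans hle _.
  by rewrite lte_fin ltr_pdivrMr// mulr_natr mulr2n ltrDl.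
have := hd W mW wW; set q := Rintegral _ _ _ => qe.
have massW : mass W = q%:E.
  rewrite /q /Rintegral fineK; last first.
    apply: (integrable_fin_num mW).
    exact: integrable_norm (integrableS measurableT mW (@subsetT _ W) ig).
  apply: eq_integral => x; rewrite inE => -[[Ox Gx] fx]; rewrite /g /= indicE mem_set ?mul1r.
    by rewrite ger0_norm// coord_norm_ge0.
  by split => //=; rewrite in_itv /=; exact: It.
apply: (@le_trans _ _ (mass W)); last by rewrite massW lee_fin ltW.
apply: le_trans (box_bound oOG _ oI); last by move=> x [/OU].
apply: le_outer_measure => p [Ap Ip]; split => //; split; first by case: Ap.
by apply: AG; split => //; apply: OU; case: Ap.
Qed.

Lemma level_null : nT [set p | [/\ U p.1, D p.1 & f p.1 <> p.2]] = 0%E.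
Proof.
have [H [oH mH HK KH]] := exhaustion oU.
(* If f(x) <> y, then some interval with rational ends contains y but not f(x), and (x,y) lies in
   the corresponding box. There are countably many boxes. *)
pose B (i : rat * rat * nat) : set ('rV[R]_n * R) := let I := `]ratr i.1.1, ratr i.1.2[%classic in
  (H i.2 `&` ~` (f @^-1` I)) `*` I.
have B0 i : nT (B i) = 0%E by apply: variation_box_eq0; [exact: HK|exact: oH].
pose Bn k := if unpickle k is Some i then B i else set0.
have Bn0 k : nT (Bn k) = 0%E by rewrite /Bn; case: unpickle => [i|]; rewrite ?outer_measure0.
apply/eqP; rewrite eq_le outer_measure_ge0 andbT.
apply: (@le_trans _ _ (nT (\bigcup_k Bn k))); last first.
  apply: le_trans (outer_measure_sigma_subadditive _ _) _.
  by rewrite eseries0// => k _ _; exact: Bn0.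
apply: le_outer_measure => -[x y] /= [Ux _ fy].
have [k Hk] : exists k, H k x.
  have [k Hk] := KH _ (@compact_set1 _ x) (fun z (zx : z = x) => ltac:(by rewrite zx)).
  by exists k; exact: Hk.
have d0 : 0 < `|f x - y| by rewrite normr_gt0 subr_eq0; apply/eqP.
have [a a1] : exists q : rat, ratr q \in `]y - `|f x - y|, y[.
  by apply: rat_in_itvoo; rewrite ltrBlDr ltrDl.
have [b b1] : exists q : rat, ratr q \in `]y, y + `|f x - y|[.
  by apply: rat_in_itvoo; rewrite ltrDl.
have Bk : Bn (pickle (a, b, k)) = B (a, b, k) by rewrite /Bn pickleK.
exists (pickle (a, b, k)); first exact: I.
rewrite Bk.
move: a1 b1; rewrite !in_itv /= => /andP[a1 a2] /andP[b1 b2].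
split; last by rewrite /= in_itv /= a2.
split; first exact: Hk.
rewrite /= in_itv /= => /andP[c1 c2].
have : `|f x - y| < `|f x - y| by rewrite {1}ltr_norml; apply/andP; split; lra.
by rewrite ltxx.
Qed.

End level_null.

Unset Implicit Arguments.

Theorem mainTheorem2 (R : realType) (m n : nat)
  (m_gt0 : (0 < m)%N) (n_gt0 : (0 < n)%N) (le_mn : (m <= n)%N)
  (U : set 'rV[R]_n) (U_open : open U)
  (V : {outer_measure set ('rV[R]_n * 'M[R]_n) -> \bar R})
  (V_rect : rectifiable_varifold m U V)
  (dV_radon : radon U (dvar U V))
  (D : set 'rV[R]_n) (f : 'rV[R]_n -> R) (f_T : in_T m U V D f)
  (VDf : 'rV[R]_n -> 'cV[R]_n) (VDfP : weak_derivative m U V D f VDf)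
  (T : ('rV[R]_n * R -> 'rV[R]_n) -> R)
  (T_distr : is_distribution (U `*` [set: R]) T)
  (TE : forall phi : 'rV[R]_n * R -> 'rV[R]_n,
    test_function (U `*` [set: R]) phi ->
    T phi = \int[cara (weight m V)]_x (phi (x, f x) *m VDf x) 0 0)
  (E : R -> set 'rV[R]_n)
  (EE : forall y, E y = [set x | D x /\ y < f x]) :
  let normT := variation_measure (U `*` [set: R]) T in
  let VdE y := vboundary m U V (E y) in
  let normVdE y := variation_measure U (VdE y) in
  [/\ representable (U `*` [set: R]) T,
      forall phi : 'rV[R]_n * R -> 'rV[R]_n, L1 normT phi ->
        [/\ {ae cara leb1, forall y, L1 (normVdE y) (fun x => phi (x, y))},
            (cara leb1).-integrable setT
              (fun y => (L1_ext U (VdE y) (fun x => phi (x, y)))%:E) &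
            L1_ext (U `*` [set: R]) T phi =
            \int[cara leb1]_y L1_ext U (VdE y) (fun x => phi (x, y))],
      forall g : 'rV[R]_n * R -> \bar R, ointegrable normT g ->
        [/\ {ae cara leb1, forall y,
              ointegrable (normVdE y) (fun x => g (x, y))},
            ointegrable leb1
              (fun y => \int[cara (normVdE y)]_x g (x, y))%E &
            (\int[cara normT]_z g z =
             \int[cara leb1]_y \int[cara (normVdE y)]_x g (x, y))%E] &
      {ae cara leb1, forall y, representable U (VdE y) /\
        normVdE y (U `&` [set x | D x /\ f x <> y]) = 0%E} ].
Proof.
set Om := U `*` [set: R].
have rV : is_varifold m U V by case: V_rect.
have linT : linear_on Om T by case: T_distr.
have EE' : E = fun y => [set x | D x /\ y < f x] by apply/funext => y; exact: EE.
pose S y := vboundary m U V (E y).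
have linS y : linear_on U (S y).
  by rewrite /S EE'; exact: (linear_vboundary U_open rV dV_radon VDfP).
have bS theta : test_function U theta -> exists M : R, forall y, `|S y theta| <= M.
  move=> tt; have [M hM] := vboundary_bounded U_open rV dV_radon VDfP tt.
  by exists M => y; rewrite /S EE'.
have rcS theta : test_function U theta -> right_continuous (S^~ theta).
  move=> tt; have := vboundary_right_continuous U_open rV dV_radon VDfP tt.
  by rewrite /S EE'.
have TS (om : R -> R) (theta : 'rV[R]_n -> 'rV[R]_n) :
    test_function [set: R] om -> test_function U theta ->
    T (fun p => om p.2 *: theta p.1) = \int[cara leb1]_y (om y * S y theta).
  move=> tom tt; rewrite TE; last first.
    by have [] := test_function_tensor (U := U) tom tt.
  by rewrite /S EE'; exact: (vboundary_tensor U_open rV dV_radon VDfP tom tt).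
have rT : representable Om T := representable_T U_open rV dV_radon VDfP linT TE.
have T0 := level_null U_open rV dV_radon VDfP linT TE.
move=> normT VdE normVdE; split.
- exact: rT.
- exact: (coarea_L1 U_open linT rT linS rcS bS TS).
- exact: (coarea_ointegrable U_open linT rT linS rcS bS TS).
(* The coarea formula for the ||T|| null set Z says that the integral over y of the measures of its
   slices is 0, so almost all of them vanish. *)
pose Z := [set p : 'rV[R]_n * R | [/\ U p.1, D p.1 & f p.1 <> p.2]].
have [[mZ IZ] _] := coarea_cara U_open linT rT linS rcS bS TS (cara_null T0).
have aZ : {ae cara leb1, forall y, normVdE y (slice Z y) = 0%E}.
  have h : (\int[cara leb1]_y `|normVdE y (slice Z y)| = 0)%E.
    under eq_integral do rewrite gee0_abs ?outer_measure_ge0//.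
    by rewrite IZ.
  have F : Filter (nbhs (almost_everywhere (cara (@leb1 R)))) by typeclasses eauto.
  apply: (@filterS _ _ F) ((ae_eq_integral_abs (cara leb1) measurableT mZ).1 h) => y hy.
  exact: hy.
apply: (ae_imply2 _ (representable_ae U_open linT rT linS rcS bS TS) aZ) => y ry zy.
split; first exact: ry.
rewrite -[RHS]zy; congr (normVdE y _).
by apply/seteqP; split => x; [move=> [? []]|move=> []].
Qed.
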